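(* Let $0<E<2$ and $p\ge 2$. There exist constants $\delta,C>0$ depending only on $(E,p)$ such that the following holds. Let $(N,v)$ be a pair of random variables with $N\in\mathbb N$, $v\in\mathbb H\cup\mathbb R$, $\mathbb E N=d$ and $\mathbb P(N\ge 1)=1$, and assume that either $v$ is real-valued or $\mathbb E N^{2p}<\infty$. Let $\lambda\in(0,1)$ be such that $\lambda+\alpha_p(\lambda)\le\delta$, where $$\alpha_p(\lambda)=\mathbb E\left[\mathbf 1_{\mathcal E_\lambda^c}(1+|v|)^{2p}\left(\frac Nd+\frac dN\right)^p\right],\qquad \mathcal E_\lambda=\left\{|v|<\lambda,\ N\ge 2,\ \frac Nd\in(1-\lambda,1+\lambda)\right\}.$$ Then for every $z\in\mathbb H_E$ and every $\mathbb H$-valued random variable $g(z)$ satisfying the equation in distribution $$g(z)\stackrel{d}{=}-\Big(z+\frac1d\sum_{i=1}^N g_i(z)+v\Big)^{-1},$$ where $(g_i(z))_{i\ge1}$ are i.i.d. copies of $g(z)$ independent of $(N,v)$, one has $$\mathbb E\left[|g(z)-\Gamma(z)|^p\right]\le C\sqrt{\lambda+\alpha_p(\lambda)},\qquad \mathbb E\left[(\Im g(z))^{-p}\right]\le C.$$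
   Context: $\mathbb N=\{0,1,\dots\}$, $\mathbb H=\{z\in\mathbb C:\Im z>0\}$, $\mathbb H_E=\{z\in\mathbb H:\Re z\in(-E,E),\ \Im z\le1\}$. $\Gamma(z)=\int\frac{d\mu_{sc}(x)}{x-z}$ is the Cauchy–Stieltjes transform of the semicircle law $\mu_{sc}=\frac1{2\pi}\mathbf 1_{\{|x|\le2\}}\sqrt{4-x^2}\,dx$; it satisfies $\Gamma(z)\in\mathbb H$ and $\Gamma(z)=-(z+\Gamma(z))^{-1}$ for $z\in\mathbb H$. $\mathcal E_\lambda^c$ is the complement of the event $\mathcal E_\lambda$. $N$ and $v$ need not be independent. $\alpha_p(\lambda)$ may be infinite. *)

(* Defs.v *)
From HB Require Import structures.
From mathcomp Require Import all_boot all_order all_algebra.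
From mathcomp Require Import complex.
From mathcomp Require Import all_classical all_reals all_analysis.

Set Implicit Arguments.
Unset Strict Implicit.
Unset Printing Implicit Defensive.

Import Order.TTheory GRing.Theory Num.Theory.
Import numFieldNormedType.Exports.

Local Open Scope classical_set_scope.
Local Open Scope complex_scope.
Local Open Scope ring_scope.

(* Borel sigma-algebra of R[i], pulled back from R * R. *)
Section complex_measurable.
Context {R : realType}.

Definition complex_pair (z : R[i]) : R * R := (complex.Re z, complex.Im z).

Definition complex_measurable : set (set R[i]) :=
  preimage_set_system setT complex_pair measurable.

Let complex_sigma_algebra : sigma_algebra setT complex_measurable.
Proof. exact/sigma_algebra_preimage/sigma_algebra_measurable. Qed.

Let complex_measurable0 : complex_measurable set0.
Proof. by case: complex_sigma_algebra. Qed.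

Let complex_measurableC A : complex_measurable A -> complex_measurable (~` A).
Proof. by case: complex_sigma_algebra => _ + _ => /[apply]; rewrite setTD. Qed.

Let complex_measurable_bigcup (F : (set R[i])^nat) :
  (forall i, complex_measurable (F i)) -> complex_measurable (\bigcup_i F i).
Proof. by case: complex_sigma_algebra => _ _; exact. Qed.

HB.instance Definition _ := isPointed.Build R[i] 0.

HB.instance Definition _ := @isMeasurable.Build default_measure_display
  R[i] complex_measurable complex_measurable0 complex_measurableC
  complex_measurable_bigcup.

End complex_measurable.

Section semicircle.
Context {R : realType}.

Definition semicircle_pdf (x : R) : R :=
  (2 * pi)^-1 * \1_(`[- 2, 2]%classic : set R) x * Num.sqrt (4 - x ^+ 2).

(* The complex integral of (x - z)^-1 is taken componentwise. *)
Definition Gamma (z : R[i]) : R[i] :=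
  (\int[lebesgue_measure]_x
     (complex.Re ((x%:C - z)^-1) * semicircle_pdf x)) +i*
  (\int[lebesgue_measure]_x
     (complex.Im ((x%:C - z)^-1) * semicircle_pdf x)).

Definition upper_half_strip (E : R) : set R[i] :=
  [set z | [/\ - E < complex.Re z < E, 0 < complex.Im z & complex.Im z <= 1]].

End semicircle.

Section laws.
Local Open Scope ereal_scope.
Context {R : realType}.

Definition same_law d1 d2 d (T1 : measurableType d1) (T2 : measurableType d2)
    (S : measurableType d) (P1 : probability T1 R) (X1 : T1 -> S)
    (P2 : probability T2 R) (X2 : T2 -> S) :=
  forall A : set S, measurable A -> P1 (X1 @^-1` A) = P2 (X2 @^-1` A).

(* The variables X, Y 0, Y 1, ... are mutually independent. Taking some of the
   B i equal to setT gives the product rule for every finite subfamily. *)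
Definition independent_of_sequence d d1 d2 (T : measurableType d)
    (S1 : measurableType d1) (S2 : measurableType d2) (P : probability T R)
    (X : T -> S1) (Y : nat -> T -> S2) :=
  forall (n : nat) (A : set S1) (B : nat -> set S2),
    measurable A -> (forall i, measurable (B i)) ->
    P (X @^-1` A `&` \bigcap_(i < n) (Y i @^-1` B i)) =
      P (X @^-1` A) * \prod_(i < n) P (Y i @^-1` B i).

End laws.

Section recursive_equation.
Context {R : realType} {d0 : measure_display} {T : measurableType d0}.
Context (P : probability T R) (N : {RV P >-> nat}) (v : {RV P >-> R[i]}).
Context (d : R).

Definition good_event (lam : R) : set T :=
  [set w | [/\ Normc.normc (v w) < lam, (2 <= N w)%N
             & 1 - lam < (N w)%:R / d < 1 + lam]].

Definition alpha (p lam : R) : \bar R :=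
  'E_P[fun w => (\1_(~` good_event lam) w
                * (1 + Normc.normc (v w)) `^ (2 * p)
                * ((N w)%:R / d + d / (N w)%:R) `^ p)%R].

Definition rde_rhs (z : R[i]) (gs : nat -> T -> R[i]) (w : T) : R[i] :=
  - (z + (d^-1)%:C * (\sum_(i < N w) gs i w) + v w)^-1.

(* g need not be defined on the space that carries N, v and the copies. *)
Definition solves_rde d1 (T' : measurableType d1) (P' : probability T' R)
    (z : R[i]) (g : {RV P' >-> R[i]}) : Prop :=
  exists gs : nat -> {RV P >-> R[i]},
    [/\ forall i, same_law P (gs i) P' g,
        independent_of_sequence P (fun w => (N w, v w)) (fun i => gs i)
      & same_law P' g P (rde_rhs z (fun i => gs i))].

End recursive_equation.

(* Main.v *)
(* Write m = Gamma z, gap(g) = |g - m|^2 / Im g and g' = - (z + w + v)^-1 with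
   w = (N/d) h, h the mean of g_1, ..., g_N. The map - (z + .)^-1 fixes m and
   does not increase the gap, and the gap is convex, so on the good event
   gap(g') is at most gap(h) up to O(lam), while the bad event costs
   O(alpha (1 + E gap(g)^p)). Hence x = E gap(g)^p is at most
   E [good; gap(h)^p] + O(eps (1 + x)), eps = lam + alpha. The reverse
   inequality is Jensen's, so every convexity gap
   F(a, b) = (gap(a)^p + gap(b)^p) / 2 - gap((a + b) / 2)^p between h and the
   g_i, and between two independent copies of g, has mean O(eps (1 + x)). For
   p >= 2 a small F(a, b) forces a and b to be close in a chart, so closeness
   propagates along h, g_i, an independent copy of g, and g'. But h and its
   image g' are never close unless h is near m. This gives x = O(eps (1 + x)),
   hence x = O(eps), from which both bounds follow. That x is finite for fixed
   z only uses |g|^2 / Im g <= 1 / Im z and the finiteness of alpha.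
   The equation for Gamma comes from x = 2 cos s and the expansion of
   1 / (x - z) in Chebyshev polynomials of the second kind. *)
Require Import Defs.
From HB Require Import structures.
From mathcomp Require Import all_boot all_order all_algebra.
From mathcomp Require Import complex ring lra.
From mathcomp Require Import all_classical all_reals all_analysis.
From mathcomp Require Import measurable_realfun.

Set Implicit Arguments.
Unset Strict Implicit.
Unset Printing Implicit Defensive.

Import Order.TTheory GRing.Theory Num.Theory.
Import numFieldNormedType.Exports.

Local Open Scope classical_set_scope.
Local Open Scope complex_scope.
Local Open Scope ring_scope.

(** * Real powers *)

Section real_powers.
Context {R : realType}.
Implicit Types a b p t : R.

(** As [Im z] tends to 0 the map - (z + .)^-1 becomes a hyperbolic isometry, so it yields no
    contraction factor uniform in [z]. All the gain comes from the strict convexity lost when the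
    g_i are averaged, and [E] enters the constants only through a lower bound on the imaginary part
    of [Gamma z]. The obstacle is that g' is a function of the g_i, so nothing is known about the
    joint law of g_i and g'. A fresh copy g~, independent of both, is therefore inserted between
    them. Since g' has the law of g, F(g_i, g~) and F(g', g~) both have the mean of F over two
    independent copies. That mean is bounded by Jensen's inequality along the cycle g_1, ..., g_N,
    g_1, whose neighbours are independent because N >= 2 on the good event. The square root in the
    first bound reflects that |g - m| is comparable to the square root of the gap near m. *)

Lemma powR_convex p t a b : 1 <= p -> 0 <= t <= 1 -> 0 <= a -> 0 <= b ->
  (t * a + (1 - t) * b) `^ p <= t * a `^ p + (1 - t) * b `^ p.
Proof.
move=> p1 /andP[t0 t1] a0 b0.
have := @convex_powR R p p1 (Itv01 t0 t1) a b.
rewrite !convRE /=; apply; rewrite inE/= in_itv/= ?a0 ?b0//.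
Qed.

Lemma powR_midpoint p a b : 1 <= p -> 0 <= a -> 0 <= b ->
  ((a + b) / 2) `^ p <= (a `^ p + b `^ p) / 2.
Proof.
move=> p1 a0 b0; have := @powR_convex p 2^-1 a b p1 _ a0 b0.
have -> : 1 - 2^-1 = 2^-1 :> R by field.
by rewrite -!mulrDr ![2^-1 * _]mulrC; apply; apply/andP; split; lra.
Qed.

Lemma powRS p a : 0 <= a -> 1 <= p -> a `^ p = a `^ (p - 1) * a.
Proof. by move=> a0 p1; rewrite mulrC mulr_powRB1//; lra. Qed.

Lemma ler_powRl p a b : 0 <= p -> 0 <= a -> a <= b -> a `^ p <= b `^ p.
Proof. by move=> p0 a0 ab; apply: ge0_ler_powR; rewrite ?nnegrE//; lra. Qed.

Lemma powR_superadd p a b : 1 <= p -> 0 <= a -> 0 <= b ->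
  a `^ p + a `^ (p - 1) * b <= (a + b) `^ p.
Proof.
move=> p1 a0 b0; rewrite [a `^ p]powRS// [(a + b) `^ p]powRS ?addr_ge0//.
rewrite -mulrDr ler_wpM2r ?addr_ge0//.
by apply: ler_powRl; lra.
Qed.

(* For p >= 2 the convexity gap of the p-th power is quadratic. *)
Lemma powR_midpoint_gap p a b : 2 <= p -> 0 <= a -> 0 <= b ->
  ((a + b) / 2) `^ p + ((a + b) / 2) `^ (p - 2) * ((a - b) / 2) ^+ 2
    <= (a `^ p + b `^ p) / 2.
Proof.
move=> p2 a0 b0; set m := (a + b) / 2; set s := (a - b) / 2.
have m0 : 0 <= m by rewrite /m; lra.
have sqrp q x : 0 <= x -> x `^ (2 * q) = (x ^+ 2) `^ q.
  by move=> x0; rewrite powRrM powR_mulrn.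
(* The squares of the half sum and half difference add up to [(a ^+ 2 + b ^+ 2) / 2]. Since
   [p / 2 >= 1], the [p / 2]-th power obeys both [powR_superadd] and midpoint convexity. *)
have -> : p = 2 * (p / 2) by field.
have -> : 2 * (p / 2) - 2 = 2 * (p / 2 - 1) by field.
rewrite !sqrp//.
apply: (@le_trans _ _ ((m ^+ 2 + s ^+ 2) `^ (p / 2))).
  by apply: powR_superadd; rewrite ?sqr_ge0//; lra.
have -> : m ^+ 2 + s ^+ 2 = (a ^+ 2 + b ^+ 2) / 2 by rewrite /m /s; field.
by apply: powR_midpoint; rewrite ?sqr_ge0//; lra.
Qed.

Lemma powR_addl p a b : 0 <= p -> 0 <= a -> 0 <= b ->
  (a + b) `^ p <= 2 `^ p * (a `^ p + b `^ p).
Proof.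
move=> p0; wlog ab : a b / a <= b => [hw a0 b0|a0 b0].
  have [ab|/ltW ba] := leP a b; first exact: hw.
  by rewrite addrC [a `^ p + _]addrC; exact: hw.
apply: (@le_trans _ _ ((2 * b) `^ p)).
  by apply: ler_powRl; lra.
rewrite powRM//; apply: ler_wpM2l; rewrite ?powR_ge0// lerDr powR_ge0//.
Qed.

(** The base on the left is [1 + 2 * (c * x)] times a convex combination of [y] and 1 in which 1 has
    weight at most [c * x]. Convexity handles the combination, and the chord over [x] in [0, 1]
    handles the factor, so the error stays linear in [x]. *)
Lemma powR_perturb p c x y : 1 <= p -> 0 <= c -> 0 <= x <= 1 -> 0 <= y ->
  ((1 + c * x) * y + c * x) `^ p
    <= (1 + (1 + 2 * c) `^ p * (1 + c) * x) * y `^ p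
       + (1 + 2 * c) `^ p * (1 + c) * x.
Proof.
move=> p1 c0 /andP[x0 x1] y0.
have cx0 : 0 <= c * x by rewrite mulr_ge0.
set q := (1 + 2 * c) `^ p.
have q0 : 0 <= q by rewrite powR_ge0.
have step : (1 + 2 * (c * x)) `^ p <= 1 + x * (q - 1).
  have -> : 1 + 2 * (c * x) = x * (1 + 2 * c) + (1 - x) * 1 by ring.
  have -> : 1 + x * (q - 1) = x * q + (1 - x) * 1 `^ p by rewrite powR1; ring.
  by apply: powR_convex => //; [rewrite x0|lra].
have stepq : (1 + 2 * (c * x)) `^ p <= q.
  by apply: ler_powRl; [lra|lra|rewrite lerD2l ler_wpM2l// ler_piMr].
have b0 : 0 < 1 + 2 * (c * x) by lra.
pose t := (1 + c * x) / (1 + 2 * (c * x)).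
have t01 : 0 <= t <= 1.
  rewrite /t ler_pdivlMr// mul0r ler_pdivrMr// mul1r; apply/andP; split; lra.
have tc : 1 - t <= c * x.
  rewrite /t lerBlDr -lerBlDl ler_pdivlMr//; nra.
have -> : (1 + c * x) * y + c * x = (1 + 2 * (c * x)) * (t * y + (1 - t) * 1).
  by rewrite /t; field; rewrite gt_eqF.
have ty0 : 0 <= t * y + (1 - t) * 1.
  by rewrite addr_ge0// mulr_ge0//; lra.
rewrite powRM; [|lra|lra].
have cv : (t * y + (1 - t) * 1) `^ p <= t * y `^ p + (1 - t) * 1.
  by have := @powR_convex p t y 1 p1 t01 y0 ler01; rewrite powR1.
move: cv step stepq; set w := (_ + _) `^ p; set r := (1 + _) `^ p; set v := y `^ p.
have v0 : 0 <= v by rewrite powR_ge0.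
have r0 : 0 <= r by rewrite powR_ge0.
move=> cv step stepq.
apply: (le_trans (ler_wpM2l r0 cv)); rewrite mulrDr mulr1 lerD//.
  apply: (@le_trans _ _ (r * v)); first by rewrite ler_wpM2l// ler_piMl//; lra.
  apply: ler_wpM2r => //; apply: (le_trans step).
  by rewrite lerD2l [q * _ * _]mulrC ler_wpM2l//; nra.
by apply: (le_trans (ler_pM r0 _ stepq tc)); [lra|nra].
Qed.

End real_powers.

(** * The upper half-plane *)

Section half_plane.
Context {R : realType}.
Implicit Types (x y z w m g : R[i]) (p t k : R).
Local Notation Re := complex.Re.
Local Notation Im := complex.Im.
Local Notation normc := Normc.normc.

Lemma normc_sq z : normc z ^+ 2 = Re z ^+ 2 + Im z ^+ 2.
Proof. by case: z => a b /=; rewrite sqr_sqrtr// addr_ge0// sqr_ge0. Qed.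

Lemma normc_ge0 z : 0 <= normc z.
Proof. by case: z => a b /=; rewrite sqrtr_ge0. Qed.

Lemma normc_triangle x y : normc (x + y) <= normc x + normc y.
Proof.
have : `|x + y| <= `|x| + `|y| by exact: ler_normD.
by rewrite !normc_def -rmorphD lecR; case: x => ? ?; case: y.
Qed.

Lemma normcN z : normc (- z) = normc z.
Proof. by case: z => a b /=; rewrite !sqrrN. Qed.

Lemma normc_sub x y : normc (x - y) = normc (y - x).
Proof. by rewrite -normcN opprB. Qed.

Lemma normc_triangleB x y : normc (x - y) <= normc x + normc y.
Proof. by rewrite -[normc y]normcN normc_triangle. Qed.

Lemma normc_triangle_sub x y z : normc (x - z) <= normc (x - y) + normc (y - z).
Proof. by rewrite -{1}[x](subrK y) -addrA normc_triangle. Qed.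

Lemma normc_real (r : R) : normc r%:C = `|r|.
Proof. by rewrite /= expr0n/= addr0 sqrtr_sqr. Qed.

Lemma normc_Im z : `|Im z| <= normc z.
Proof.
by rewrite -ler_sqr ?nnegrE ?normc_ge0// normc_sq real_normK ?num_real// lerDr sqr_ge0.
Qed.

Lemma normc_Re z : `|Re z| <= normc z.
Proof.
by rewrite -ler_sqr ?nnegrE ?normc_ge0// normc_sq real_normK ?num_real// lerDl sqr_ge0.
Qed.

Lemma ReD x y : Re (x + y) = Re x + Re y.
Proof. by case: x; case: y. Qed.

Lemma ImD x y : Im (x + y) = Im x + Im y.
Proof. by case: x; case: y. Qed.

Lemma ReN x : Re (- x) = - Re x.
Proof. by case: x. Qed.

Lemma ImN x : Im (- x) = - Im x.
Proof. by case: x. Qed.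

Lemma ReZ (r : R) x : Re (r%:C * x) = r * Re x.
Proof. by case: x => a b /=; rewrite mul0r subr0. Qed.

Lemma ImZ (r : R) x : Im (r%:C * x) = r * Im x.
Proof. by case: x => a b /=; rewrite mul0r addr0. Qed.

Lemma Im_neg_inv z : Im (- z^-1) = Im z / normc z ^+ 2.
Proof. by rewrite normc_sq; case: z => a b /=; rewrite opprK. Qed.

Lemma Im_gt0_neq0 z : 0 < Im z -> z != 0.
Proof. by apply: contraTneq => -> /=; rewrite ltxx. Qed.

Lemma normc_gt0 z : 0 < Im z -> 0 < normc z.
Proof. by move=> z0; apply: (lt_le_trans _ (normc_Im z)); rewrite normr_gt0 gt_eqF. Qed.

Definition midc x y := (2^-1)%:C * (x + y).

Lemma Im_midc x y : Im (midc x y) = (Im x + Im y) / 2.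
Proof. by rewrite ImZ ImD mulrC. Qed.

(* [hgap m g / Im m] is [2 (cosh (dist g m) - 1)] for the hyperbolic distance
   of the upper half-plane. *)
Definition hgap m g := normc (g - m) ^+ 2 / Im g.

(** [hgap] is the perspective of the squared modulus, so its convexity defect is a squared distance
    between these quotients, weighted by the imaginary parts. *)
Definition hdisp m g := (Im g)^-1%:C * (g - m).

Lemma hgap_ge0 m g : 0 < Im g -> 0 <= hgap m g.
Proof. by move=> g0; rewrite divr_ge0 ?sqr_ge0 ?ltW. Qed.

Lemma normc_hdisp m g : 0 < Im g -> normc (hdisp m g) = normc (g - m) / Im g.
Proof.
by move=> g0; rewrite Normc.normcM normc_real gtr0_norm ?invr_gt0// mulrC.
Qed.

Lemma hgapE m g : 0 < Im g -> hgap m g = normc (hdisp m g) ^+ 2 * Im g.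
Proof. by move=> g0; rewrite normc_hdisp// /hgap; field; rewrite gt_eqF. Qed.

Definition hdefect m x y :=
  Im x * Im y / (Im x + Im y) / 2 * normc (hdisp m x - hdisp m y) ^+ 2.

Lemma hdefect_ge0 m x y : 0 < Im x -> 0 < Im y -> 0 <= hdefect m x y.
Proof.
move=> x0 y0; rewrite mulr_ge0 ?sqr_ge0// divr_ge0// divr_ge0//.
  by rewrite mulr_ge0// ltW.
by rewrite addr_ge0// ltW.
Qed.

Lemma hgap_midc m x y : 0 < Im x -> 0 < Im y ->
  hgap m (midc x y) = (hgap m x + hgap m y) / 2 - hdefect m x y.
Proof.
move=> x0 y0; rewrite /hgap /hdefect Im_midc !normc_sq /hdisp.
rewrite !(ReD, ImD, ReN, ImN, ReZ, ImZ).
field; rewrite !gt_eqF//; exact: addr_gt0.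
Qed.

Definition hconv_gap p m x y :=
  (hgap m x `^ p + hgap m y `^ p) / 2 - hgap m (midc x y) `^ p.

(** Two sources of convexity add up: that of [hgap] itself, through [hdefect], and that of the p-th
    power, through the spread of the two values. The first alone is too weak when the imaginary
    parts differ greatly, since its weight is at most half the smaller one. *)
Lemma hconv_gap_ge p m x y : 2 <= p -> 0 < Im x -> 0 < Im y ->
  ((hgap m x + hgap m y) / 2) `^ (p - 1) * hdefect m x y +
  ((hgap m x + hgap m y) / 2) `^ (p - 2) * ((hgap m x - hgap m y) / 2) ^+ 2
    <= hconv_gap p m x y.
Proof.
move=> p2 x0 y0; have p1 : 1 <= p by lra.
have gx := hgap_ge0 m x0; have gy := hgap_ge0 m y0.
have := powR_midpoint_gap p2 gx gy.
have mid0 : 0 <= hgap m (midc x y) by rewrite hgap_ge0// Im_midc; lra.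
have D0 := hdefect_ge0 m x0 y0; rewrite /hconv_gap.
move: mid0; rewrite hgap_midc//; set h := (hgap m x + hgap m y) / 2 => mid0.
have : (h - hdefect m x y) `^ p <= h `^ (p - 1) * (h - hdefect m x y).
  by rewrite [X in X <= _]powRS// ler_wpM2r// ler_powRl//; lra.
rewrite [h `^ p]powRS//; last by lra.
lra.
Qed.

Lemma hconv_gap_ge0 p m x y : 2 <= p -> 0 < Im x -> 0 < Im y ->
  0 <= hconv_gap p m x y.
Proof.
move=> p2 x0 y0; apply: le_trans (hconv_gap_ge m p2 x0 y0).
by rewrite addr_ge0// mulr_ge0// ?powR_ge0 ?hdefect_ge0 ?sqr_ge0.
Qed.

(** If [Im x <= 4 * Im y], the weight in [hdefect] is large enough. Otherwise nearly equal gap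
    values force [hdisp m y] to be at least 3/2 times as long as [hdisp m x], hence at most 3 times
    as long as their difference, and the defect becomes too large for [k <= 1000^-1]. *)
Lemma hdisp_close m x y k : 0 < Im x -> 0 < Im y -> 0 < k <= 1000^-1 ->
  hdefect m x y <= k * hgap m x -> `|hgap m x - hgap m y| <= k * hgap m x ->
  normc (hdisp m x - hdisp m y) ^+ 2 <= 10 * k * normc (hdisp m x) ^+ 2.
Proof.
move=> x0 y0 /andP[k0 k1]; rewrite ler_distlC /hdefect !hgapE//.
move: (normc_triangle_sub (hdisp m y) (hdisp m x) 0); rewrite !subr0 normc_sub.
set A := normc (hdisp m x); set B := normc (hdisp m y); set D := normc (_ - _).
have A0 : 0 <= A by exact: normc_ge0.
have B0 : 0 <= B by exact: normc_ge0.
have D0 : 0 <= D by exact: normc_ge0.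
set a := Im x; set b := Im y => BDA hD /andP[hl hu].
have ab0 : 0 < a + b by rewrite addr_gt0.
have hD' : a * b * D ^+ 2 <= 2 * k * A ^+ 2 * a * (a + b).
  have : a * b / (a + b) / 2 * D ^+ 2 * (2 * (a + b)) <= k * (A ^+ 2 * a) * (2 * (a + b)).
    by rewrite ler_wpM2r//; lra.
  have -> : a * b / (a + b) / 2 * D ^+ 2 * (2 * (a + b)) = a * b * D ^+ 2.
    by field; rewrite gt_eqF.
  by move=> h; apply: (le_trans h); rewrite le_eqVlt; apply/orP; left; apply/eqP; ring.
have {hD hD'}hD : b * D ^+ 2 <= 2 * k * A ^+ 2 * (a + b).
  by rewrite -(ler_pM2l x0); lra.
have [ba|ba] := leP a (4 * b).
  have : b * D ^+ 2 <= b * (10 * k * A ^+ 2).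
    have kA : 0 <= k * A ^+ 2 by rewrite mulr_ge0 ?sqr_ge0// ltW.
    apply: (le_trans hD); nra.
  by rewrite ler_pM2l.
have [A00|An0] := eqVneq A 0.
  move: hD; rewrite A00 expr0n/= !mulr0 mul0r => hD.
  by rewrite -(ler_pM2l y0) mulr0.
have Ap : 0 < A by rewrite lt_def An0.
exfalso.
have A2 : 0 < A ^+ 2 by rewrite exprn_gt0.
have h1 : 3 * (A ^+ 2 * b) <= B ^+ 2 * b.
  have : A ^+ 2 * a * (1 - k) <= B ^+ 2 * b by lra.
  have : A ^+ 2 * (4 * b) <= A ^+ 2 * a by rewrite ler_pM2l// ltW.
  nra.
have h2 : 3 * A ^+ 2 <= B ^+ 2 by rewrite -(ler_pM2r y0) -mulrA.
have h3 : 3 * A <= 2 * B.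
  by rewrite -ler_sqr ?nnegrE ?mulr_ge0// !exprMn; nra.
have h4 : B ^+ 2 <= 9 * D ^+ 2.
  by have B3 : B <= 3 * D; [lra|nra].
have h5 : b * B ^+ 2 <= 18 * k * A ^+ 2 * (a + b) by nra.
have h6 : A ^+ 2 * a * (1 - k) <= B ^+ 2 * b by lra.
have kA : 0 < A ^+ 2 * a by rewrite mulr_gt0.
have kA' : A ^+ 2 * b <= A ^+ 2 * a by rewrite ler_pM2l//; lra.
nra.
Qed.

(** The midpoint is at least [a / 2], so if either conclusion fails, one of the two terms alone
    reaches k^2 (a/2)^p. *)
Lemma power_gap_threshold p k (a b D F : R) : 2 <= p -> 0 < k <= 1 ->
  0 <= a -> 0 <= b -> 0 <= D ->
  ((a + b) / 2) `^ (p - 1) * D + ((a + b) / 2) `^ (p - 2) * ((a - b) / 2) ^+ 2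
    <= F ->
  F < k ^+ 2 * 2^-1 `^ p * a `^ p ->
  D <= k * a /\ `|a - b| <= k * a.
Proof.
move=> p2 /andP[k0 k1] a0 b0 D0; set h := (a + b) / 2.
have [q gq] : exists q, a = 2 * q by exists (a / 2); field.
have hq : q <= h by rewrite /h; lra.
have q0 : 0 <= q by lra.
have -> : k ^+ 2 * 2^-1 `^ p * a `^ p = k ^+ 2 * q `^ p.
  rewrite gq powRM// mulrA -(mulrA (k ^+ 2)) -powRM ?invr_ge0//.
  by rewrite mulVf// powR1 mulr1.
have c1 : 0 <= h `^ (p - 1) * D by rewrite mulr_ge0// powR_ge0.
have c2 : 0 <= h `^ (p - 2) * ((a - b) / 2) ^+ 2.
  by rewrite mulr_ge0// ?sqr_ge0// powR_ge0.
have e1 : q `^ p = q `^ (p - 1) * q by rewrite powRS//; lra.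
have e2 : q `^ p = q `^ (p - 2) * q ^+ 2.
  have pp : p - 1 - 1 = p - 2 by ring.
  by rewrite e1 [q `^ (p - 1)]powRS ?pp -?mulrA -?expr2//; lra.
have m1 : q `^ (p - 1) <= h `^ (p - 1) by apply: ler_powRl; lra.
have m2 : q `^ (p - 2) <= h `^ (p - 2) by apply: ler_powRl; lra.
have n1 : 0 <= q `^ (p - 1) by exact: powR_ge0.
have n2 : 0 <= q `^ (p - 2) by exact: powR_ge0.
move=> hge hF; have {}hF := le_lt_trans hge hF.
split; rewrite leNgt; apply/negP => hlt; move: hF; apply/negP; rewrite -leNgt.
  apply: (@le_trans _ _ (h `^ (p - 1) * D)); last by rewrite lerDl.
  rewrite e1 mulrCA; apply: ler_pM => //; first by rewrite mulr_ge0 ?sqr_ge0.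
  rewrite ltW// (le_lt_trans _ hlt)// gq; have : 0 <= k * q by rewrite mulr_ge0// ltW.
  by nra.
apply: (@le_trans _ _ (h `^ (p - 2) * ((a - b) / 2) ^+ 2)); last by rewrite lerDr.
rewrite e2 mulrCA; apply: ler_pM => //; first by rewrite mulr_ge0 ?sqr_ge0.
rewrite -exprMn -[X in _ <= X]real_normK ?num_real// normrM [`|2^-1|]gtr0_norm//.
rewrite ler_sqr ?nnegrE; [|by rewrite mulr_ge0// ltW|by rewrite mulr_ge0].
have ka : k * a = 2 * (k * q) by rewrite gq; ring.
by move: hlt; rewrite ka; lra.
Qed.

(* Two points with a small convexity gap are close in the [hdisp] chart. *)
Lemma hconv_gap_close p m t x y : 2 <= p -> 0 < Im x -> 0 < Im y ->
  0 < t <= 1 ->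
  hconv_gap p m x y < (t ^+ 2 / 1000) ^+ 2 * 2^-1 `^ p * hgap m x `^ p ->
  normc (hdisp m x - hdisp m y) <= t * normc (hdisp m x) /\
  `|hgap m x - hgap m y| <= t * hgap m x.
Proof.
(* [k] serves three demands: the smallness required by [hdisp_close], [10 * k <= t ^+ 2] for its
   conclusion after a square root, and [k <= t] for the gap values. *)
move=> p2 x0 y0 /andP[t0 t1]; set k := t ^+ 2 / 1000 => hF.
have t2 : t ^+ 2 <= t by rewrite expr2; nra.
have t20 : 0 < t ^+ 2 by rewrite exprn_gt0.
have k0 : 0 < k <= 1000^-1 by rewrite /k; apply/andP; split; lra.
have kt : 10 * k <= t ^+ 2 /\ k <= t by rewrite /k; split; lra.
have k1 : 0 < k <= 1 by lra.
have gx := hgap_ge0 m x0.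
have [HD HG] := power_gap_threshold p2 k1 gx (hgap_ge0 m y0)
  (hdefect_ge0 m x0 y0) (hconv_gap_ge m p2 x0 y0) hF.
split; last by apply: (le_trans HG); rewrite ler_wpM2r//; case: kt.
have hd := hdisp_close x0 y0 k0 HD HG.
have n0 := normc_ge0 (hdisp m x); have d0 := normc_ge0 (hdisp m x - hdisp m y).
rewrite -ler_sqr ?nnegrE ?mulr_ge0//; last by lra.
by apply: (le_trans hd); rewrite exprMn ler_wpM2r ?sqr_ge0//; case: kt.
Qed.

End half_plane.

(** * Averages over finitely many points and Jensen's inequality *)

Section averages.
Context {R : realType}.
Implicit Types (x y z w m g h : R[i]) (p t k s : R).
Local Notation Re := complex.Re.
Local Notation Im := complex.Im.
Local Notation normc := Normc.normc.

Definition mean n (f : nat -> R) : R := n%:R^-1 * \sum_(i < n) f i.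

Definition cmean n (f : nat -> R[i]) : R[i] := (n%:R^-1)%:C * \sum_(i < n) f i.

Lemma Im_cmean n (f : nat -> R[i]) : Im (cmean n f) = mean n (fun i => Im (f i)).
Proof.
rewrite ImZ; congr (_ * _).
by elim/big_ind2 : _ => // x u y v <- <-; rewrite ImD.
Qed.

Lemma mean_gt0 n (f : nat -> R) : (0 < n)%N ->
  (forall i, (i < n)%N -> 0 < f i) -> 0 < mean n f.
Proof.
case: n => // n _ f0; rewrite mulr_gt0 ?invr_gt0 ?ltr0n//.
rewrite big_ord_recl ltr_pwDl ?f0// sumr_ge0// => i _.
by rewrite ltW// f0.
Qed.

Lemma mean_ge0 n (f : nat -> R) :
  (forall i, (i < n)%N -> 0 <= f i) -> 0 <= mean n f.
Proof. by move=> f0; rewrite mulr_ge0 ?invr_ge0// sumr_ge0// => i _; exact: f0. Qed.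

Lemma ler_mean n (f g : nat -> R) :
  (forall i, (i < n)%N -> f i <= g i) -> mean n f <= mean n g.
Proof. by move=> fg; rewrite ler_wpM2l ?invr_ge0// ler_sum// => i _; exact: fg. Qed.

Lemma mean_const n (c : R) : (0 < n)%N -> mean n (fun=> c) = c.
Proof.
move=> n0; rewrite /mean sumr_const card_ord -[c *+ n]mulr_natl mulrA mulVf ?mul1r//.
by rewrite pnatr_eq0 -lt0n.
Qed.

Lemma eq_mean n (f g : nat -> R) :
  (forall i, (i < n)%N -> f i = g i) -> mean n f = mean n g.
Proof. by move=> fg; congr (_ * _); apply: eq_bigr => i _; exact: fg. Qed.

Lemma meanD n (f g : nat -> R) :
  mean n (fun i => f i + g i) = mean n f + mean n g.
Proof. by rewrite /mean big_split/= mulrDr. Qed.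

Lemma meanZ n (c : R) (f : nat -> R) :
  mean n (fun i => c * f i) = c * mean n f.
Proof. by rewrite /mean -mulr_sumr mulrCA. Qed.

Lemma sum_cyclic_shift (V : nmodType) n (f : nat -> V) :
  \sum_(i < n) f (i.+1 %% n)%N = \sum_(i < n) f i.
Proof.
case: n => [|n]; first by rewrite !big_ord0.
rewrite big_ord_recr [RHS]big_ord_recl /= modnn addrC; congr (_ + _).
by apply: eq_bigr => i _; rewrite modn_small//= ltnS.
Qed.

(** Replacing each point by its midpoint with the cyclic neighbour preserves the mean, so Jensen's
    inequality may be applied to the midpoints. The convexity gaps of neighbouring pairs are what
    this gains. *)
Lemma cmean_midc_shift n (f : nat -> R[i]) :
  cmean n (fun i => midc (f i) (f (i.+1 %% n)%N)) = cmean n f.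
Proof.
rewrite /cmean /midc -mulr_sumr big_split/= sum_cyclic_shift; congr (_ * _).
set S := \sum_(i < n) f i.
have -> : S + S = 2%:R%:C * S by rewrite rmorph_nat mulr_natl mulr2n.
by rewrite mulrA -rmorphM mulVf// mul1r.
Qed.

Lemma cmean_midc_cst n (f : nat -> R[i]) : (0 < n)%N ->
  cmean n (fun i => midc (f i) (cmean n f)) = cmean n f.
Proof.
move=> n0; rewrite {1}/cmean /midc -mulr_sumr big_split/= sumr_const card_ord.
have nn : (n%:R : R) != 0 by rewrite pnatr_eq0 -lt0n.
set S := \sum_(i < n) f i.
have -> : S + cmean n f *+ n = 2%:R%:C * S.
  have -> : cmean n f *+ n = n%:R%:C * cmean n f.
    by rewrite -[LHS]mulr_natl rmorph_nat.
  rewrite /cmean mulrA -rmorphM divff//.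
  by rewrite mul1r rmorph_nat mulr_natl mulr2n.
by rewrite /cmean -/S; congr (_ * _); rewrite mulrA -rmorphM mulVf// mul1r.
Qed.

Definition hconvex (G : R[i] -> R) := forall s x y, 0 <= s <= 1 ->
  0 < Im x -> 0 < Im y ->
  G (s%:C * x + (1 - s)%:C * y) <= s * G x + (1 - s) * G y.

Lemma jensen_cmean (G : R[i] -> R) n (f : nat -> R[i]) : hconvex G ->
  (0 < n)%N -> (forall i, (i < n)%N -> 0 < Im (f i)) ->
  G (cmean n f) <= mean n (G \o f).
Proof.
move=> cG; elim: n => // -[|n] IH _ f0.
  by rewrite /cmean /mean !big_ord_recl !big_ord0 !addr0 invr1 !mul1r.
have n0 : (n.+1%:R : R) != 0 by rewrite pnatr_eq0.
have n1 : (n.+2%:R : R) != 0 by rewrite pnatr_eq0.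
pose s : R := n.+1%:R / n.+2%:R.
have s1 : 1 - s = n.+2%:R^-1.
  by rewrite /s -[X in X - _](divff n1) -mulrBl -natrB// subSnn mul1r.
have sE : s * n.+1%:R^-1 = n.+2%:R^-1 by rewrite /s mulrAC divff// mul1r.
have s01 : 0 <= s <= 1.
  rewrite divr_ge0//= ler_pdivrMr ?ltr0n// mul1r ler_nat//.
have f0' i : (i < n.+1)%N -> 0 < Im (f i) by move=> ni; rewrite f0// ltnW.
have -> : cmean n.+2 f = s%:C * cmean n.+1 f + (1 - s)%:C * f n.+1.
  rewrite /cmean big_ord_recr/= mulrDr s1; congr (_ + _).
  by rewrite mulrA -rmorphM sE.
have -> : mean n.+2 (G \o f) = s * mean n.+1 (G \o f) + (1 - s) * G (f n.+1).
  rewrite /mean big_ord_recr/= mulrDr s1; congr (_ + _).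
  by rewrite mulrA sE.
apply: (le_trans (cG s _ _ s01 _ _)).
- by rewrite Im_cmean mean_gt0.
- by rewrite f0.
- by rewrite lerD2r ler_wpM2l ?IH//; case/andP: s01.
Qed.

Lemma hgap_convex m : hconvex (hgap m).
Proof.
move=> s x y /andP[s0 s1] x0 y0.
have [->|sn0] := eqVneq s 0.
  by rewrite subr0 !mul0r !add0r !mul1r.
have [->|sn1] := eqVneq s 1.
  by rewrite subrr !mul0r !addr0 !mul1r.
have sp : 0 < s by rewrite lt_def sn0.
have sp' : 0 < 1 - s by rewrite subr_gt0 lt_neqAle sn1.
have a0 : 0 < s * Im x by rewrite mulr_gt0.
have b0 : 0 < (1 - s) * Im y by rewrite mulr_gt0.
rewrite -subr_ge0.
have -> : s * hgap m x + (1 - s) * hgap m y - hgap m (s%:C * x + (1 - s)%:C * y)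
  = (s * Im x) * ((1 - s) * Im y) / (s * Im x + (1 - s) * Im y) *
    normc (hdisp m x - hdisp m y) ^+ 2.
  rewrite /hgap !normc_sq /hdisp !(ReD, ImD, ReN, ImN, ReZ, ImZ).
  by field; rewrite !gt_eqF// addr_gt0.
by rewrite mulr_ge0 ?sqr_ge0// divr_ge0 ?ltW// ?mulr_gt0// addr_gt0.
Qed.

Lemma Im_conv_gt0 s x y : 0 <= s <= 1 -> 0 < Im x -> 0 < Im y ->
  0 < Im (s%:C * x + (1 - s)%:C * y).
Proof.
move=> /andP[s0 s1] x0 y0; rewrite ImD !ImZ.
have [->|sn0] := eqVneq s 0; first by rewrite mul0r add0r subr0 mul1r.
rewrite ltr_pwDl ?mulr_gt0 ?mulr_ge0 ?subr_ge0// ?ltW//.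
by rewrite lt_def sn0.
Qed.

Lemma hgap_powR_convex m p : 1 <= p -> hconvex (fun g => hgap m g `^ p).
Proof.
move=> p1 s x y s01 x0 y0.
have gx := hgap_ge0 m x0; have gy := hgap_ge0 m y0.
apply: le_trans (powR_convex p1 s01 gx gy).
apply: ler_powRl; [lra|exact/hgap_ge0/Im_conv_gt0|exact: hgap_convex].
Qed.

(** The sublevel set at 0 is a horodisc tangent to the real axis at 0. Its convexity carries the a
    priori bound [normc g ^+ 2 * Im z <= Im g] from the g_i to their mean. *)
Lemma normc_sq_convex (c : R) : 0 <= c ->
  hconvex (fun g => normc g ^+ 2 * c - Im g).
Proof.
move=> c0 s x y /andP[s0 s1] x0 y0; rewrite -subr_ge0.
rewrite [X in 0 <= X](_ : _ = c * (s * (1 - s) * normc (x - y) ^+ 2)).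
  by rewrite mulr_ge0// mulr_ge0 ?sqr_ge0// mulr_ge0// subr_ge0.
by rewrite !normc_sq !(ReD, ImD, ReN, ImN, ReZ, ImZ); ring.
Qed.

Lemma hconv_gapC p m x y : hconv_gap p m x y = hconv_gap p m y x.
Proof. by rewrite /hconv_gap /midc [x + y]addrC [hgap m x `^ p + _]addrC. Qed.

Section variance.
Variables (p : R) (m : R[i]) (n : nat) (f : nat -> R[i]).
Hypotheses (p1 : 1 <= p) (n0 : (0 < n)%N)
  (f0 : forall i, (i < n)%N -> 0 < Im (f i)).
Let G g := hgap m g `^ p.

Lemma cmean_Im_gt0 : 0 < Im (cmean n f).
Proof. by rewrite Im_cmean mean_gt0. Qed.

(** Jensen's inequality for the midpoints of the [f i] with their own mean, which again have that
    mean. This controls the first link of the chain, from h to g_i. *)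
Lemma mean_gap_center :
  mean n (fun i => hconv_gap p m (f i) (cmean n f)) + 2^-1 * G (cmean n f)
    <= 2^-1 * mean n (G \o f).
Proof.
have Gc := hgap_powR_convex m p1.
have j := jensen_cmean (f := fun i => midc (f i) (cmean n f)) Gc n0.
rewrite cmean_midc_cst// in j.
have {}j : G (cmean n f) <= mean n (fun i => G (midc (f i) (cmean n f))).
  apply: j => i ni; rewrite Im_midc divr_gt0// addr_gt0 ?f0//.
  exact: cmean_Im_gt0.
have e : mean n (fun i => hconv_gap p m (f i) (cmean n f)) =
    2^-1 * mean n (G \o f) + 2^-1 * G (cmean n f) -
    mean n (fun i => G (midc (f i) (cmean n f))).
  rewrite -[in X in _ + X - _](mean_const (G (cmean n f)) n0).
  rewrite -2!meanZ -meanD -[X in _ - X]mul1r -mulNr -meanZ -meanD.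
  by congr mean; apply/funext => i; rewrite /hconv_gap /G /=; lra.
rewrite e; lra.
Qed.

(** The same argument with the midpoints of cyclic neighbours. After integration it bounds the gap
    between two independent copies. *)
Lemma mean_gap_shift :
  mean n (fun i => hconv_gap p m (f i) (f (i.+1 %% n)%N)) + G (cmean n f)
    <= mean n (G \o f).
Proof.
have Gc := hgap_powR_convex m p1.
have j := jensen_cmean (f := fun i => midc (f i) (f (i.+1 %% n)%N)) Gc n0.
rewrite cmean_midc_shift in j.
have {}j : G (cmean n f) <= mean n (fun i => G (midc (f i) (f (i.+1 %% n)%N))).
  by apply: j => i ni; rewrite Im_midc divr_gt0// addr_gt0 ?f0// ltn_mod.
have e : mean n (fun i => hconv_gap p m (f i) (f (i.+1 %% n)%N)) =
    mean n (G \o f) - mean n (fun i => G (midc (f i) (f (i.+1 %% n)%N))).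
  have -> : mean n (G \o f) =
      2^-1 * mean n (G \o f) + 2^-1 * mean n (fun i => G (f (i.+1 %% n)%N)).
    have -> : mean n (fun i => G (f (i.+1 %% n)%N)) = mean n (G \o f).
      by rewrite /mean (sum_cyclic_shift n (G \o f)).
    lra.
  rewrite -2!meanZ -meanD -[X in _ - X]mul1r -mulNr -meanZ -meanD.
  by congr mean; apply/funext => i; rewrite /hconv_gap /G /=; lra.
rewrite e; lra.
Qed.

End variance.
End averages.

(** * The recursion map *)

Section recursion_map.
Context {R : realType}.
Implicit Types (x y w g h v : R[i]) (p t k s lam nu : R).
Local Notation Re := complex.Re.
Local Notation Im := complex.Im.
Local Notation normc := Normc.normc.
Variables (m z : R[i]).
Hypotheses (m0 : 0 < Im m) (m1 : normc m <= 1) (z0 : 0 < Im z)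
  (mz : m * (z + m) = -1).

Definition rmap w := - (z + w)^-1.

Lemma rmap_den w : 0 <= Im w -> 0 < Im (z + w).
Proof. by move=> w0; rewrite ImD ltr_pwDl. Qed.

Lemma Im_rmap w : 0 <= Im w -> Im (rmap w) = (Im w + Im z) * normc (rmap w) ^+ 2.
Proof.
move=> w0; rewrite Im_neg_inv normcN Normc.normcV exprVn ImD.
by rewrite [Im z + _]addrC.
Qed.

Lemma Im_rmap_gt0 w : 0 <= Im w -> 0 < Im (rmap w).
Proof.
move=> w0; have d0 := rmap_den w0.
by rewrite Im_neg_inv divr_gt0// exprn_gt0// normc_gt0.
Qed.

Lemma rmapB w : 0 <= Im w -> rmap w - m = rmap w * m * (w - m).
Proof.
move=> w0; have /Im_gt0_neq0 d0 := rmap_den w0.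
have -> : w - m = (z + w) - (z + m) by ring.
rewrite mulrBr /rmap -[X in _ = _ - X]mulrA mz mulrN1 opprK.
have -> : - (z + w)^-1 * m * (z + w) = - m by rewrite mulrAC mulNr mulVf// mulN1r.
by rewrite addrC.
Qed.

(** The factor |rmap w|^2 in [Im (rmap w)] cancels the one in |rmap w - m|^2. What remains shows
    that [normc m <= 1] and [0 < Im z] are the reasons why the gap does not increase. *)
Lemma hgap_rmap w : 0 <= Im w ->
  hgap m (rmap w) = normc m ^+ 2 * (normc (w - m) ^+ 2 / (Im w + Im z)).
Proof.
move=> w0; rewrite /hgap rmapB// !Normc.normcM Im_rmap//.
have : 0 < normc (rmap w) by rewrite normc_gt0// Im_rmap_gt0.
have : 0 < Im w + Im z by rewrite addrC -ImD rmap_den.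
set a := normc (rmap w); set b := Im w + Im z => b0 a0.
by field; rewrite !gt_eqF.
Qed.

Lemma hgap_rmap_le w : 0 <= Im w ->
  hgap m (rmap w) <= normc (w - m) ^+ 2 / (Im w + Im z).
Proof.
move=> w0; rewrite hgap_rmap// ler_piMl//.
  by rewrite divr_ge0 ?sqr_ge0// addr_ge0// ltW.
by rewrite expr_le1// normc_ge0.
Qed.

Lemma Im_le_normc g : Im g <= normc g.
Proof. exact: le_trans (ler_norm _) (normc_Im g). Qed.

(** Either [Im g] is at least half of [Im m], or [g] is at distance at least [Im m / 2] from [m].
    Besides the negative moments, this turns additive errors divided by [Im h] into multiples of 1 +
    gap. *)
Lemma inv_Im_le_hgap t g : 0 < t -> t <= Im m -> 0 < Im g ->
  (Im g)^-1 <= 4 / t ^+ 2 * (1 + hgap m g).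
Proof.
move=> t0 tm g0.
have M1 : Im m <= 1 by apply: le_trans m1; exact: Im_le_normc.
have t2 : 0 < t ^+ 2 by rewrite exprn_gt0.
rewrite mulrAC ler_pdivlMr// ler_pdivrMl// /hgap.
have -> : Im g * (4 * (1 + normc (g - m) ^+ 2 / Im g)) =
    4 * (Im g + normc (g - m) ^+ 2) by field; rewrite gt_eqF.
have : (Im g - Im m) ^+ 2 <= normc (g - m) ^+ 2.
  by rewrite normc_sq ImD ImN lerDr sqr_ge0.
have : t ^+ 2 <= Im m ^+ 2 by rewrite ler_sqr ?nnegrE// ltW.
have m0' := m0; set a := Im g in g0 *; set b := Im m in m0' M1 *; set n := normc _ ^+ 2 => h1 h2.
have [ab|ab] := leP (b / 2) a; nra.
Qed.

(** With [nu] equal to N/d, its p-th power is the factor that [alpha] integrates over the bad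
    event. *)
Definition weight nu v := (nu + nu^-1) * (1 + normc v) ^+ 2.

Lemma Im_scale nu h v : 0 <= nu -> 0 < Im h -> 0 <= Im v ->
  nu * Im h <= Im (nu%:C * h + v).
Proof. by move=> nu0 h0 v0; rewrite ImD ImZ lerDl. Qed.

Lemma Im_scale_ge0 nu h v : 0 <= nu -> 0 < Im h -> 0 <= Im v ->
  0 <= Im (nu%:C * h + v).
Proof.
move=> nu0 h0 v0; apply: le_trans (Im_scale nu0 h0 v0).
by rewrite mulr_ge0// ltW.
Qed.

Lemma weight_ge1 nu v : 0 < nu -> 1 <= weight nu v.
Proof.
move=> nu0; have i0 : 0 < nu^-1 by rewrite invr_gt0.
have : nu * nu^-1 = 1 by rewrite divff// gt_eqF.
rewrite /weight; have := normc_ge0 v; set V := normc v; set u := nu^-1 in i0 * => V0 uu.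
have : 1 <= nu + u by nra.
nra.
Qed.

Lemma sqr_add3 (a b c : R) : (a + b + c) ^+ 2 <= 3 * (a ^+ 2 + b ^+ 2 + c ^+ 2).
Proof.
rewrite -subr_ge0.
have -> : 3 * (a ^+ 2 + b ^+ 2 + c ^+ 2) - (a + b + c) ^+ 2 =
  (a - b) ^+ 2 + (b - c) ^+ 2 + (a - c) ^+ 2 by ring.
by rewrite !addr_ge0 ?sqr_ge0.
Qed.

(** The displacement of the argument splits as [nu * (h - m)], [(nu - 1) * m] and [v], while its
    imaginary part is at least [nu * Im h]. Dividing the squares produces [nu] and its inverse, and
    [inv_Im_le_hgap] absorbs the inverse of [Im h]. *)
Lemma hgap_rmap_weight t nu h v : 0 < t -> t <= Im m -> 0 < nu ->
  0 < Im h -> 0 <= Im v ->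
  hgap m (rmap (nu%:C * h + v)) <=
    (3 + 12 / t ^+ 2) * weight nu v * (1 + hgap m h).
Proof.
move=> t0 tm nu0 h0 v0.
have w0 := Im_scale_ge0 (ltW nu0) h0 v0.
apply: (le_trans (hgap_rmap_le w0)).
have nh : 0 < nu * Im h by rewrite mulr_gt0.
have b1 : nu * Im h <= Im (nu%:C * h + v) + Im z.
  by apply: (le_trans (Im_scale (ltW nu0) h0 v0)); rewrite lerDl ltW.
apply: (@le_trans _ _ (normc (nu%:C * h + v - m) ^+ 2 / (nu * Im h))).
  by rewrite ler_wpM2l ?sqr_ge0// lef_pV2// posrE (lt_le_trans nh b1).
have n1 : normc (nu%:C * h + v - m) <= nu * normc (h - m) + `|nu - 1| + normc v.
  have -> : nu%:C * h + v - m = nu%:C * (h - m) + (nu - 1)%:C * m + v.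
    by rewrite rmorphB rmorph1; ring.
  apply: (le_trans (normc_triangle _ _)); rewrite lerD2r.
  apply: (le_trans (normc_triangle _ _)); rewrite !Normc.normcM !normc_real.
  by rewrite gtr0_norm// lerD2l ler_piMr.
have n2 : normc (nu%:C * h + v - m) ^+ 2 <=
    3 * (nu ^+ 2 * normc (h - m) ^+ 2 + (nu - 1) ^+ 2 + normc v ^+ 2).
  apply: (@le_trans _ _ ((nu * normc (h - m) + `|nu - 1| + normc v) ^+ 2)).
    by rewrite ler_sqr ?nnegrE ?normc_ge0//; exact: le_trans (normc_ge0 _) n1.
  by apply: (le_trans (sqr_add3 _ _ _)); rewrite exprMn real_normK ?num_real.
rewrite ler_pdivrMr//; apply: (le_trans n2).
have iy := inv_Im_le_hgap t0 tm h0; have g0 := hgap_ge0 m h0.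
have gE : normc (h - m) ^+ 2 = hgap m h * Im h by rewrite /hgap mulfVK// gt_eqF.
have K0 : 0 < 4 / t ^+ 2 by rewrite divr_gt0// exprn_gt0.
have -> : 12 / t ^+ 2 = 3 * (4 / t ^+ 2) by field; rewrite gt_eqF.
move: iy K0; rewrite gE; set K := 4 / _; set G := hgap m h in g0 *; set y := Im h in h0 *.
rewrite -[_^-1]mul1r ler_pdivrMr// /weight => iy K0.
have V0 := normc_ge0 v; set V := normc v in V0 *.
set u := nu^-1; have uu : nu * u = 1 by rewrite divff// gt_eqF.
have u0 : 0 < u by rewrite invr_gt0.
have -> : (3 + 3 * K) * ((nu + u) * (1 + V) ^+ 2) * (1 + G) * (nu * y) =
   3 * ((1 + G) * y * (nu ^+ 2 + nu * u) * (1 + V) ^+ 2)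
   + 3 * (K * (1 + G) * y * ((nu ^+ 2 + nu * u) * (1 + V) ^+ 2)) by ring.
rewrite uu.
have V1 : 1 + V ^+ 2 <= (1 + V) ^+ 2 by nra.
have n20 : 0 <= nu ^+ 2 by rewrite sqr_ge0.
have s1 : nu ^+ 2 * (G * y) <= (1 + G) * y * (nu ^+ 2 + 1) * (1 + V) ^+ 2.
  have q1 : G * y <= (1 + G) * y by rewrite ler_wpM2r ?ltW//; lra.
  have q0 : 0 <= G * y by rewrite mulr_ge0// ltW.
  have q2 : nu ^+ 2 * (G * y) <= (nu ^+ 2 + 1) * ((1 + G) * y).
    by apply: ler_pM => //; lra.
  rewrite [(1 + G) * y * _]mulrC; apply: (le_trans q2); rewrite ler_peMr//.
    by rewrite mulr_ge0//; lra.
  nra.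
have s2 : (nu - 1) ^+ 2 + V ^+ 2 <= (nu ^+ 2 + 1) * (1 + V) ^+ 2.
  have : (nu ^+ 2 + 1) * (1 + V ^+ 2) <= (nu ^+ 2 + 1) * (1 + V) ^+ 2.
    by rewrite ler_wpM2l//; lra.
  have : 0 <= nu ^+ 2 * V ^+ 2 by rewrite mulr_ge0 ?sqr_ge0.
  nra.
have s3 : (nu ^+ 2 + 1) * (1 + V) ^+ 2 <=
    K * (1 + G) * y * ((nu ^+ 2 + 1) * (1 + V) ^+ 2).
  by rewrite ler_peMl// mulr_ge0 ?sqr_ge0//; lra.
lra.
Qed.

(** A bound without the gap of [h], bought with a factor that blows up as [Im z] tends to 0. It
    serves only to show that the p-th moment of the gap is finite. *)
Lemma hgap_rmap_crude nu h v : 0 < nu -> 0 < Im h -> 0 <= Im v ->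
  normc h ^+ 2 * Im z <= Im h ->
  hgap m (rmap (nu%:C * h + v)) <= 6 / Im z * weight nu v.
Proof.
move=> nu0 h0 v0 hz.
have w0 := Im_scale_ge0 (ltW nu0) h0 v0.
apply: (le_trans (hgap_rmap_le w0)).
have b1 : nu * Im h + Im z <= Im (nu%:C * h + v) + Im z.
  by rewrite lerD2r Im_scale// ltW.
have nh : 0 < nu * Im h by rewrite mulr_gt0.
have b0 : 0 < nu * Im h + Im z by rewrite addr_gt0.
apply: (@le_trans _ _ (normc (nu%:C * h + v - m) ^+ 2 / (nu * Im h + Im z))).
  by rewrite ler_wpM2l ?sqr_ge0// lef_pV2// posrE (lt_le_trans b0 b1).
have n1 : normc (nu%:C * h + v - m) <= nu * normc h + normc v + 1.
  apply: (le_trans (normc_triangleB _ _)); rewrite lerD//.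
  apply: (le_trans (normc_triangle _ _)); rewrite lerD2r.
  by rewrite Normc.normcM normc_real gtr0_norm.
have n2 : normc (nu%:C * h + v - m) ^+ 2 <=
    3 * (nu ^+ 2 * normc h ^+ 2 + normc v ^+ 2 + 1).
  apply: (@le_trans _ _ ((nu * normc h + normc v + 1) ^+ 2)).
    by rewrite ler_sqr ?nnegrE ?normc_ge0//; exact: le_trans (normc_ge0 _) n1.
  by apply: (le_trans (sqr_add3 _ _ _)); rewrite exprMn expr1n.
rewrite ler_pdivrMr//; apply: (le_trans n2).
rewrite [X in _ <= X](_ : _ = 6 * (weight nu v * (nu * Im h + Im z)) / Im z); last by ring.
rewrite ler_pdivlMr// /weight.
have V0 := normc_ge0 v; set V := normc v in V0 *.
move: hz nh; set y := Im h in h0 *; have z0' := z0; set e := Im z in z0' *; set H := normc h ^+ 2 => hz nh.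
set u := nu^-1; have uu : nu * u = 1 by rewrite divff// gt_eqF.
have u0 : 0 < u by rewrite invr_gt0.
have V1 : 1 + V ^+ 2 <= (1 + V) ^+ 2 by nra.
have s1 : nu ^+ 2 * (H * e) <= nu * (nu * y).
  by rewrite mulrA -expr2 ler_wpM2l// sqr_ge0.
have nu1 : 1 <= nu + u by nra.
have s2 : nu <= (nu + u) * (1 + V) ^+ 2.
  have q : nu + u <= (nu + u) * (1 + V) ^+ 2 by rewrite ler_peMr//; nra.
  lra.
have s3 : V ^+ 2 + 1 <= (nu + u) * (1 + V) ^+ 2.
  have q : (1 + V) ^+ 2 <= (nu + u) * (1 + V) ^+ 2 by rewrite ler_peMl// sqr_ge0.
  lra.
set W := (nu + u) * (1 + V) ^+ 2 in s2 s3 *.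
have r1 : nu * (nu * y) <= W * (nu * y) by rewrite ler_wpM2r// ltW.
have r2 : (V ^+ 2 + 1) * e <= W * e by rewrite ler_wpM2r// ltW.
have W0 : 0 <= W * (nu * y) by rewrite mulr_ge0 ?ltW//; nra.
have W1 : 0 <= W * e by rewrite mulr_ge0 ?ltW//; nra.
nra.
Qed.

End recursion_map.

(** * The recursion map under small perturbations of N/d and v *)

Section near_fixed_point.
Context {R : realType}.
Implicit Types (x y w g h v : R[i]) (p t k s lam nu : R).
Local Notation Re := complex.Re.
Local Notation Im := complex.Im.
Local Notation normc := Normc.normc.
Variables (m z : R[i]).
Hypotheses (m0 : 0 < Im m) (m1 : normc m <= 1) (z0 : 0 < Im z)
  (mz : m * (z + m) = -1).
Local Notation rmap := (rmap z).

Lemma hgap_rmap_near t lam nu h v : 0 < t -> t <= Im m -> 0 < lam <= 2^-1 ->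
  0 < Im h -> 0 <= Im v -> `|nu - 1| <= lam -> normc v <= lam ->
  hgap m (rmap (nu%:C * h + v)) <=
    (1 + (12 + 64 / t ^+ 2) * lam) * hgap m h + (12 + 64 / t ^+ 2) * lam.
Proof.
move=> t0 tm /andP[l0 l1] h0 v0 nul vl.
have /andP[nu1 nu2] : 1 - lam <= nu <= 1 + lam by rewrite -ler_distlC distrC.
have nu0 : 0 <= nu by lra.
have w0 := Im_scale_ge0 nu0 h0 v0.
apply: (le_trans (hgap_rmap_le m1 z0 mz w0)).
have l1' : 0 < 1 - lam by lra.
have nh : 0 < (1 - lam) * Im h by rewrite mulr_gt0.
have b1 : (1 - lam) * Im h <= Im (nu%:C * h + v) + Im z.
  have := Im_scale nu0 h0 v0; have := ltW z0.
  have : (1 - lam) * Im h <= nu * Im h by rewrite ler_pM2r.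
  lra.
apply: (@le_trans _ _ (normc (nu%:C * h + v - m) ^+ 2 / ((1 - lam) * Im h))).
  by rewrite ler_wpM2l ?sqr_ge0// lef_pV2// posrE (lt_le_trans nh b1).
set a := normc (h - m).
have a0 : 0 <= a by exact: normc_ge0.
have n1 : normc (nu%:C * h + v - m) <= (1 + lam) * a + 2 * lam.
  have -> : nu%:C * h + v - m = nu%:C * (h - m) + (nu - 1)%:C * m + v.
    by rewrite rmorphB rmorph1; ring.
  apply: (le_trans (normc_triangle _ _)).
  apply: (le_trans (lerD (normc_triangle _ _) vl)).
  rewrite !Normc.normcM !normc_real -/a.
  have q1 : `|nu| * a <= (1 + lam) * a by rewrite ler_wpM2r// ger0_norm.
  have q2 : `|nu - 1| * normc m <= lam * 1 by apply: ler_pM; rewrite ?normc_ge0.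
  lra.
have n2 : normc (nu%:C * h + v - m) ^+ 2 <= ((1 + lam) * a + 2 * lam) ^+ 2.
  by rewrite ler_sqr ?nnegrE ?normc_ge0//; exact: le_trans (normc_ge0 _) n1.
rewrite ler_pdivrMr//; apply: (le_trans n2).
(* The cross term is split with weight [lam], which keeps the coefficient of [a ^+ 2] at 1 + O(lam)
   and leaves an additive error linear in [lam]. *)
have n3 : ((1 + lam) * a + 2 * lam) ^+ 2 <= (1 + lam) ^+ 3 * a ^+ 2 + 8 * lam.
  rewrite -subr_ge0.
  have -> : (1 + lam) ^+ 3 * a ^+ 2 + 8 * lam - ((1 + lam) * a + 2 * lam) ^+ 2 =
    lam * (((1 + lam) * a - 2) ^+ 2 + (4 - 4 * lam)) by ring.
  apply: mulr_ge0; first exact: ltW.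
  by have := sqr_ge0 ((1 + lam) * a - 2); lra.
apply: (le_trans n3).
have iy := inv_Im_le_hgap m0 m1 t0 tm h0; have g0 := hgap_ge0 m h0.
have gE : a ^+ 2 = hgap m h * Im h by rewrite /hgap mulfVK// gt_eqF.
have K0 : 0 < 4 / t ^+ 2 by rewrite divr_gt0// exprn_gt0.
have -> : 64 / t ^+ 2 = 16 * (4 / t ^+ 2) by field; rewrite gt_eqF.
move: iy K0; rewrite gE; set K := 4 / _; set G := hgap m h in g0 *; set y := Im h in h0 *.
rewrite -[_^-1]mul1r ler_pdivrMr// => iy K0.
have Gy : 0 <= G * y by rewrite mulr_ge0// ltW.
have c1 : (1 + lam) ^+ 3 <= (1 + 12 * lam) * (1 - lam) by nra.
have c2 : (1 + lam) ^+ 3 * (G * y) <= (1 + 12 * lam) * (1 - lam) * (G * y).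
  by rewrite ler_wpM2r.
have c3 : 8 * lam * 1 <= 8 * lam * (K * (1 + G) * y).
  by rewrite ler_wpM2l//; lra.
have c4 : 8 * lam * (K * (1 + G) * y) <= 16 * lam * (1 - lam) * (K * (1 + G) * y).
  by rewrite ler_wpM2r//; [lra|nra].
have c5 : 0 <= 12 * lam * (1 - lam) * y by rewrite !mulr_ge0//; lra.
lra.
Qed.

(* If [rmap w] were close to [h] in the [hdisp] chart while [w] is close to
   [h], then [h] would nearly solve [h = rmap h], whose only solution in the
   half-plane is [m]. *)
Lemma hdisp_rmap_far t s h w : 0 < s -> 8 * s <= t -> t <= Im m ->
  0 < Im h -> 0 <= Im w -> h != m -> normc (w - h) <= s * normc (h - m) ->
  s * normc (hdisp m h) < normc (hdisp m h - hdisp m (rmap w)).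
Proof.
move=> s0 st tm h0 w0 hm wh; rewrite ltNge; apply/negP => hd.
have M1 : Im m <= 1 by apply: le_trans m1; exact: Im_le_normc.
set g := rmap w in hd; have g0 : 0 < Im g by exact: (Im_rmap_gt0 z0).
have gn : 0 < normc g by exact: normc_gt0.
have gnz : g != 0 by exact: Im_gt0_neq0.
have a0 : 0 < normc (h - m).
  rewrite lt_def normc_ge0 andbT; apply: contra hm => /eqP /Normc.eq0_normc.
  by move/eqP; rewrite subr_eq0.
set Y := Im w + Im z.
have Y0 : 0 < Y by have := z0; rewrite /Y; lra.
set gc := (g^* )%C.
have ngc : normc gc = normc g by rewrite /gc; case: (g) => a b /=; rewrite sqrrN.
have Imgc : Im gc = - Im g by rewrite /gc; case: (g).
(* Multiplying by [Im h * Y] and the conjugate of [g] clears both denominators, since [Im g] equals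
   [Y] times |g|^2. The point [w] then survives only in an error term proportional to [w - h]. *)
have key : (hdisp m h - hdisp m g) * ((Im h * Y)%:C * gc) =
    (h - m) * (Y%:C * gc - (Im h)%:C * m) - (Im h)%:C * m * (w - h).
  have ggc : g * gc = (normc g ^+ 2)%:C.
    by rewrite normc_sq /gc; case: (g) => a b /=; simpc; congr (_ +i* _); ring.
  have e1 : hdisp m h * ((Im h * Y)%:C * gc) = (h - m) * (Y%:C * gc).
    transitivity (((Im h)^-1 * Im h)%:C * ((h - m) * (Y%:C * gc))).
      by rewrite /hdisp !rmorphM; ring.
    by rewrite mulVf ?mul1r// gt_eqF.
  have e2 : hdisp m g * ((Im h * Y)%:C * gc) = (Im h)%:C * m * (w - m).
    rewrite /hdisp (rmapB z0 mz w0) -/g.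
    have -> : ((Im g)^-1)%:C * (g * m * (w - m)) * ((Im h * Y)%:C * gc) =
        ((Im g)^-1)%:C * (Im h * Y)%:C * (g * gc) * (m * (w - m)) by ring.
    rewrite ggc -!rmorphM.
    have -> : (Im g)^-1 * (Im h * Y) * normc g ^+ 2 = Im h.
      by rewrite {1}(Im_rmap z w0) -/g -/Y; field; rewrite !gt_eqF.
    by rewrite mulrA.
  by rewrite mulrBl e1 e2; ring.
have {key}nkey : normc (h - m) * normc (Y%:C * gc - (Im h)%:C * m) <=
    s * (normc (h - m) * (Y * normc g)) + Im h * (s * normc (h - m)).
  rewrite -Normc.normcM.
  have -> : (h - m) * (Y%:C * gc - (Im h)%:C * m) =
     (hdisp m h - hdisp m g) * ((Im h * Y)%:C * gc) + (Im h)%:C * m * (w - h).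
    by rewrite key subrK.
  apply: (le_trans (normc_triangle _ _)); apply: lerD; rewrite !Normc.normcM !normc_real ?ngc.
    rewrite gtr0_norm ?mulr_gt0//.
    have hY : 0 <= Im h * Y * normc g by rewrite !mulr_ge0// ltW.
    apply: (le_trans (ler_wpM2r hY hd)); rewrite normc_hdisp//.
    by rewrite le_eqVlt; apply/orP; left; apply/eqP; field; rewrite gt_eqF.
  rewrite gtr0_norm// -mulrA ler_pM2l//.
  by apply: le_trans wh; rewrite ler_piMl ?normc_ge0.
set r := normc (Y%:C * gc - (Im h)%:C * m) in nkey.
have {}nkey : r <= s * (Y * normc g) + Im h * s.
  by rewrite -(ler_pM2l a0); apply: (le_trans nkey); rewrite le_eqVlt; apply/orP; left; apply/eqP; ring.
(* Conjugation makes the imaginary parts of both terms negative, so they cannot cancel. This is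
   where uniqueness of the fixed point in the half-plane becomes quantitative. *)
have r1 : Im h * t <= r.
  apply: le_trans (normc_Im _); rewrite ImD ImN !ImZ Imgc -normrN.
  apply: le_trans (ler_norm _).
  have : 0 <= Y * Im g by rewrite mulr_ge0// ltW.
  have : Im h * t <= Im h * Im m by rewrite ler_pM2l.
  lra.
have r2 : Y * normc g <= r + Im h.
  have -> : Y * normc g = normc (Y%:C * gc).
    by rewrite Normc.normcM normc_real ngc gtr0_norm.
  rewrite -[Y%:C * gc](subrK ((Im h)%:C * m)).
  apply: (le_trans (normc_triangle _ _)); rewrite lerD2l.
  by rewrite Normc.normcM normc_real gtr0_norm// ler_piMr// ltW.
have s1 : s * (Y * normc g) <= s * (r + Im h) by rewrite ler_pM2l.
have s2 : 8 * (s * Im h) <= Im h * t by rewrite [Im h * t]mulrC mulrA ler_pM2r.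
have r0 : 0 < r by apply: lt_le_trans r1; rewrite mulr_gt0//; lra.
have s8 : s * r <= 8^-1 * r by rewrite ler_pM2r//; lra.
have : 0 < s * Im h by rewrite mulr_gt0.
lra.
Qed.

End near_fixed_point.

Section gap_chain.
Context {R : realType}.
Variable m : R[i].
Local Notation Re := complex.Re.
Local Notation Im := complex.Im.
Local Notation normc := Normc.normc.

(** If all three gaps were small, each link would move the chart by at most the fraction s/7 of the
    current length. That length at most doubles per link, so the total is at most (1 + 2 + 4) s/7 =
    s times the initial length. The gap value at most halves per link, so the thresholds 2^-p at
    later points become 8^-p at [x0]. *)
Lemma hconv_gap_chain (p s : R) (x0 x1 x2 x3 : R[i]) : 2 <= p -> 0 < s <= 1 ->
  0 < Im x0 -> 0 < Im x1 -> 0 < Im x2 -> 0 < Im x3 ->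
  s * normc (hdisp m x0) < normc (hdisp m x0 - hdisp m x3) ->
  ((s / 7) ^+ 2 / 1000) ^+ 2 * 8^-1 `^ p * hgap m x0 `^ p <=
    hconv_gap p m x0 x1 + hconv_gap p m x1 x2 + hconv_gap p m x2 x3.
Proof.
move=> p2 /andP[s0 s1] p0 p1 p_2 p3 far; rewrite leNgt; apply/negP => small.
set t := s / 7; have t01 : 0 < t <= 1 by rewrite /t; lra.
move: (hconv_gap_ge0 m p2 p0 p1) (hconv_gap_ge0 m p2 p1 p_2) (hconv_gap_ge0 m p2 p_2 p3).
move: (@hconv_gap_close R p m t x0 x1 p2 p0 p1 t01) (@hconv_gap_close R p m t x1 x2 p2 p1 p_2 t01)
  (@hconv_gap_close R p m t x2 x3 p2 p_2 p3 t01).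
move: small; set F1 := hconv_gap p m x0 x1; set F2 := hconv_gap p m x1 x2.
set F3 := hconv_gap p m x2 x3 => small c1 c2 c3 f1 f2 f3.
have pp : 0 <= p by lra.
have g0 := hgap_ge0 m p0.
set c := (t ^+ 2 / 1000) ^+ 2 in small c1 c2 c3.
have cc : 0 <= c by exact: sqr_ge0.
clearbody c F1 F2 F3.
have bnd (q : R) : 4^-1 * hgap m x0 <= q ->
    c * 8^-1 `^ p * hgap m x0 `^ p <= c * 2^-1 `^ p * q `^ p.
  move=> hq; have -> : 8^-1 = 2^-1 * 4^-1 :> R by field.
  rewrite powRM ?invr_ge0//.
  have -> : c * (2^-1 `^ p * 4^-1 `^ p) * hgap m x0 `^ p =
      c * 2^-1 `^ p * (4^-1 `^ p * hgap m x0 `^ p) by ring.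
  rewrite -(@powRM R 4^-1 (hgap m x0) p) ?invr_ge0//.
  apply: ler_wpM2l; first by apply: mulr_ge0 => //; exact: powR_ge0.
  by apply: ler_powRl => //; apply: mulr_ge0 => //; rewrite invr_ge0.
have [d1 e1] : normc (hdisp m x0 - hdisp m x1) <= t * normc (hdisp m x0) /\
    `|hgap m x0 - hgap m x1| <= t * hgap m x0.
  apply: c1; apply: (@lt_le_trans _ _ (c * 8^-1 `^ p * hgap m x0 `^ p)); first by lra.
  by apply: bnd; lra.
have t7 : t <= 7^-1 by rewrite /t; lra.
have tg (q : R) : 0 <= q -> t * q <= 7^-1 * q by move=> q0; rewrite ler_wpM2r.
have q1 : 2^-1 * hgap m x0 <= hgap m x1.
  by move: e1; rewrite ler_distlC => /andP[? ?]; have := tg _ g0; lra.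
have [d2 e2] : normc (hdisp m x1 - hdisp m x2) <= t * normc (hdisp m x1) /\
    `|hgap m x1 - hgap m x2| <= t * hgap m x1.
  apply: c2; apply: (@lt_le_trans _ _ (c * 8^-1 `^ p * hgap m x0 `^ p)); first by lra.
  by apply: bnd; lra.
have g1 := hgap_ge0 m p1.
have q2 : 4^-1 * hgap m x0 <= hgap m x2.
  by move: e2; rewrite ler_distlC => /andP[? ?]; have := tg _ g1; lra.
have [d3 _] : normc (hdisp m x2 - hdisp m x3) <= t * normc (hdisp m x2) /\
    `|hgap m x2 - hgap m x3| <= t * hgap m x2.
  apply: c3; apply: (@lt_le_trans _ _ (c * 8^-1 `^ p * hgap m x0 `^ p)); first by lra.
  exact: bnd.
have n0 := normc_ge0 (hdisp m x0).
have n1 := normc_ge0 (hdisp m x1).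
have n2 := normc_ge0 (hdisp m x2).
have u1 : normc (hdisp m x1) <= 2 * normc (hdisp m x0).
  have := normc_triangle_sub (hdisp m x1) (hdisp m x0) 0; rewrite !subr0 normc_sub.
  by have := tg _ n0; lra.
have u2 : normc (hdisp m x2) <= 4 * normc (hdisp m x0).
  have := normc_triangle_sub (hdisp m x2) (hdisp m x1) 0; rewrite !subr0 normc_sub.
  by have := tg _ n1; lra.
have := normc_triangle_sub (hdisp m x0) (hdisp m x1) (hdisp m x3).
have := normc_triangle_sub (hdisp m x1) (hdisp m x2) (hdisp m x3).
have t0 : 0 <= t by case/andP: t01 => /ltW.
have v1 : t * normc (hdisp m x1) <= t * (2 * normc (hdisp m x0)) by rewrite ler_wpM2l.
have v2 : t * normc (hdisp m x2) <= t * (4 * normc (hdisp m x0)) by rewrite ler_wpM2l.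
have v3 : s * normc (hdisp m x0) = 7 * (t * normc (hdisp m x0)) by rewrite /t; field.
lra.
Qed.

End gap_chain.

(** * Pointwise bounds on p-th powers of the gap *)

Section recursion_bounds.
Context {R : realType}.
Implicit Types (x y w g h v m z : R[i]) (p t k s lam nu C : R).
Local Notation Re := complex.Re.
Local Notation Im := complex.Im.
Local Notation normc := Normc.normc.

(** Bundles all that is used about [Gamma z]; the constants below depend on [p] and [t] alone, hence
    are uniform in [z]. *)
Definition fixed_at t m z :=
  [/\ t <= Im m, normc m <= 1, 0 < Im z & m * (z + m) = -1].

Lemma powR_hgap_rmap_near p t : 1 <= p -> 0 < t ->
  exists2 C, 0 < C & forall m z lam nu h v, fixed_at t m z ->
    0 < lam <= 2^-1 -> 0 < Im h -> 0 <= Im v -> `|nu - 1| <= lam ->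
    normc v <= lam ->
    hgap m (rmap z (nu%:C * h + v)) `^ p
      <= (1 + C * lam) * hgap m h `^ p + C * lam.
Proof.
move=> p1 t0; set c := 12 + 64 / t ^+ 2.
have c0 : 0 <= c by rewrite addr_ge0// divr_ge0// sqr_ge0.
exists ((1 + 2 * c) `^ p * (1 + c)).
  by rewrite mulr_gt0 ?powR_gt0//; lra.
move=> m z lam nu h v [tm m1 z0 mz] l01 h0 v0 nul vl.
have m0 : 0 < Im m by exact: lt_le_trans tm.
have near := hgap_rmap_near m0 m1 z0 mz t0 tm l01 h0 v0 nul vl.
have [l0 l1] := andP l01.
have nu0 : 0 <= nu by move: nul; rewrite distrC ler_distlC => /andP[? ?]; lra.
have lam01 : 0 <= lam <= 1 by lra.
apply: le_trans (powR_perturb p1 c0 lam01 (hgap_ge0 m h0)).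
apply: ler_powRl => //; first by lra.
by apply: hgap_ge0; apply: (Im_rmap_gt0 z0); exact: Im_scale_ge0.
Qed.

Lemma powR_hgap_rmap_weight p t : 1 <= p -> 0 < t ->
  exists2 C, 0 < C & forall m z nu h v, fixed_at t m z ->
    0 < nu -> 0 < Im h -> 0 <= Im v ->
    hgap m (rmap z (nu%:C * h + v)) `^ p
      <= C * weight nu v `^ p * (1 + hgap m h `^ p).
Proof.
move=> p1 t0; set c := 3 + 12 / t ^+ 2.
have c0 : 0 < c by rewrite ltr_pwDl// divr_ge0// sqr_ge0.
exists (c `^ p * 2 `^ p); first by rewrite mulr_gt0 ?powR_gt0.
move=> m z nu h v [tm m1 z0 mz] nu0 h0 v0.
have m0 : 0 < Im m by exact: lt_le_trans tm.
have w0 : 0 <= weight nu v by apply: le_trans (weight_ge1 v nu0).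
have g0 := hgap_ge0 m h0.
apply: (@le_trans _ _ ((c * weight nu v * (1 + hgap m h)) `^ p)).
  apply: ler_powRl; first by lra.
    by apply: hgap_ge0; apply: (Im_rmap_gt0 z0); apply: Im_scale_ge0 => //; exact: ltW.
  exact: hgap_rmap_weight.
have wp : 0 <= c * weight nu v by rewrite mulr_ge0// ltW.
rewrite powRM//; last by lra.
rewrite powRM//; last by exact: ltW.
have := @powR_addl R p 1 (hgap m h) _ ler01 g0; rewrite powR1 => h1.
rewrite [X in _ <= X](_ : _ = c `^ p * weight nu v `^ p *
  (2 `^ p * (1 + hgap m h `^ p))); last by ring.
by apply: ler_wpM2l; [apply: mulr_ge0; exact: powR_ge0|apply: h1; lra].
Qed.

Lemma powR_hgap_rmap_crude p t m z nu h v : 1 <= p -> 0 < t -> fixed_at t m z ->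
  0 < nu -> 0 < Im h -> 0 <= Im v -> normc h ^+ 2 * Im z <= Im h ->
  hgap m (rmap z (nu%:C * h + v)) `^ p <= (6 / Im z) `^ p * weight nu v `^ p.
Proof.
move=> p1 t0 [tm m1 z0 mz] nu0 h0 v0 hz.
have w0 : 0 <= weight nu v by apply: le_trans (weight_ge1 v nu0).
rewrite -powRM//; last by rewrite divr_ge0// ltW.
apply: ler_powRl; first by lra.
  by apply: hgap_ge0; apply: (Im_rmap_gt0 z0); apply: Im_scale_ge0 => //; exact: ltW.
exact: hgap_rmap_crude.
Qed.

(** There are two regimes. If [h] is within [L * lam] of [m], its gap is already O(lam). Otherwise
    the perturbation of [h] caused by [nu] and [v] is at most [s * normc (h - m)], so
    [hdisp_rmap_far] applies and the chain estimate follows. *)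
Lemma powR_hgap_chain p t : 2 <= p -> 0 < t <= 1 ->
  exists C lam0, [/\ 0 < C, 0 < lam0 & forall m z lam nu h v x y,
    fixed_at t m z -> 0 < lam <= lam0 -> 0 < Im h -> 0 <= Im v ->
    `|nu - 1| <= lam -> normc v <= lam -> 0 < Im x -> 0 < Im y ->
    hgap m h `^ p <= C * (hconv_gap p m h y + hconv_gap p m y x +
        hconv_gap p m x (rmap z (nu%:C * h + v))) + C * lam].
Proof.
move=> p2 /andP[t0 t1]; pose s := t / 8.
have s0 : 0 < s by rewrite /s; lra.
have s1 : s <= 8^-1 by rewrite /s; lra.
have pp : 0 <= p by lra.
(* [L * s = 4] lets [s * normc (h - m)] dominate the perturbation [lam * (normc (h - m) + 2)]
   outside the ball. The bound [s ^+ 2 / 8] on [lam] gives [L * lam <= s / 2], which keeps [Im h]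
   above [t / 2] inside it. *)
pose L := 4 / s; have L0 : 0 < L by rewrite divr_gt0.
have Ls : L * s = 4 by rewrite /L mulfVK// gt_eqF.
pose c := ((s / 7) ^+ 2 / 1000) ^+ 2 * 8^-1 `^ p.
have c0 : 0 < c.
  apply: mulr_gt0; last by apply: powR_gt0; lra.
  have : 0 < (s / 7) ^+ 2 by apply: exprn_gt0; lra.
  by move=> ?; apply: exprn_gt0; lra.
have lp0 : 0 <= (L ^+ 2) `^ p by exact: powR_ge0.
have ci0 : 0 < c^-1 by rewrite invr_gt0.
exists (c^-1 + (L ^+ 2) `^ p), (s ^+ 2 / 8); split.
- by rewrite ltr_pwDl.
- by rewrite divr_gt0// exprn_gt0.
move=> m z lam nu h v x y [tm m1 z0 mz] /andP[l0 l1] h0 v0 nul vl x0 y0.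
have m0 : 0 < Im m by exact: lt_le_trans tm.
have Ll : L * lam <= s / 2.
  have : L * lam <= L * (s ^+ 2 / 8) by rewrite ler_pM2l.
  have -> : L * (s ^+ 2 / 8) = L * s * s / 8 by ring.
  by rewrite Ls; lra.
have ls : lam <= s / 2 by nra.
have nu0 : 0 <= nu by move: nul; rewrite distrC ler_distlC => /andP[? ?]; lra.
have w0 := Im_scale_ge0 nu0 h0 v0.
set w := nu%:C * h + v in w0 *.
have g0 : 0 < Im (rmap z w) by exact: (Im_rmap_gt0 z0).
set F := _ + _ + _.
have F0 : 0 <= F by apply: addr_ge0; [apply: addr_ge0|]; exact: hconv_gap_ge0.
set a := normc (h - m).
have aE : hgap m h = a ^+ 2 / Im h by [].
have a0 : 0 <= a by exact: normc_ge0.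
have [la|al] := ltP a (L * lam).
  have hy : t / 2 <= Im h.
    have := normc_Im (h - m); rewrite -/a ImD ImN ler_norml => /andP[? ?].
    by rewrite /s in Ll s1 *; lra.
  have gh : hgap m h <= L ^+ 2 * lam.
    rewrite aE ler_pdivrMr//.
    have q1 : a ^+ 2 <= (L * lam) ^+ 2.
      have La : 0 <= L * lam by apply: mulr_ge0; exact: ltW.
      by rewrite ler_sqr ?nnegrE//; exact: ltW.
    apply: (le_trans q1); rewrite exprMn -[X in _ <= X]mulrA.
    apply: ler_wpM2l; first exact: sqr_ge0.
    rewrite expr2 ler_pM2l//; apply: le_trans hy; rewrite /s in ls; lra.
  apply: (@le_trans _ _ ((L ^+ 2) `^ p * lam)).
    apply: (@le_trans _ _ ((L ^+ 2 * lam) `^ p)).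
      by apply: ler_powRl => //; exact: hgap_ge0.
    rewrite powRM ?sqr_ge0//; last exact: ltW.
    apply: ler_wpM2l => //.
    by apply: ge1r_powR; [rewrite l0/=; lra|lra].
  have e1 : 0 <= (c^-1 + (L ^+ 2) `^ p) * F.
    by apply: mulr_ge0 => //; apply: addr_ge0 => //; exact: ltW.
  have e2 : 0 <= c^-1 * lam by apply: mulr_ge0; exact: ltW.
  by rewrite [X in _ <= _ + X]mulrDl; lra.
have ap : 0 < a by apply: lt_le_trans al; rewrite mulr_gt0.
have hm : h != m.
  by apply: contraTneq ap => hmE; rewrite /a hmE subrr Normc.normc0 ltxx.
have wh : normc (w - h) <= s * normc (h - m).
  have -> : w - h = (nu - 1)%:C * h + v by rewrite /w rmorphB rmorph1; ring.
  apply: (le_trans (normc_triangle _ _)); rewrite Normc.normcM normc_real -/a.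
  have nh : normc h <= a + 1.
    rewrite -[h](subrK m); apply: (le_trans (normc_triangle _ _)).
    by rewrite lerD2l.
  have : `|nu - 1| * normc h <= lam * (a + 1).
    by apply: ler_pM => //; exact: normc_ge0.
  have : s * (L * lam) <= s * a by rewrite ler_pM2l.
  have -> : s * (L * lam) = 4 * lam by rewrite mulrA [s * L]mulrC Ls.
  have : lam * a <= s / 2 * a by rewrite ler_pM2r.
  by lra.
have s8 : 8 * s <= t by rewrite /s; lra.
have far := hdisp_rmap_far m1 z0 mz s0 s8 tm h0 w0 hm wh.
have s01 : 0 < s <= 1 by lra.
have := hconv_gap_chain p2 s01 h0 y0 x0 g0 far.
rewrite -/c -/F -ler_pdivlMl// => hF.
have e1 : 0 <= (L ^+ 2) `^ p * F by rewrite mulr_ge0.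
have e2 : 0 <= (c^-1 + (L ^+ 2) `^ p) * lam.
  by apply: mulr_ge0; [apply: addr_ge0 => //|]; exact: ltW.
by rewrite mulrDl; lra.
Qed.

End recursion_bounds.

(** * The Stieltjes transform of the semicircle law *)

Section semicircle_integral.
Context {R : realType}.
Implicit Types (x y a b c : R) (f F : R -> R).
Local Notation mu := (@lebesgue_measure R).

Lemma is_derive_continuous f F : (forall x, is_derive x 1 F (f x)) -> continuous F.
Proof.
move=> dF x; apply: differentiable_continuous; apply/derivable1_diffP.
by have [] := dF x.
Qed.

Lemma Rintegral_antiderivative f F a b : a < b -> continuous f ->
  (forall x, is_derive x 1 F (f x)) ->
  \int[mu]_(x in `[a, b]) f x = F b - F a.
Proof.
move=> ab cf dF; have cF := is_derive_continuous dF.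
rewrite /Rintegral (@continuous_FTC2 _ f F)//.
- exact/continuous_subspaceT.
- split.
  + by move=> x _; have [] := dF x.
  + by apply: cvg_at_right_filter; exact: cF.
  + by apply: cvg_at_left_filter; exact: cF.
- by move=> x _; rewrite derive1E; have dFx := dF x; rewrite derive_val.
Qed.

Lemma is_derive_sinZ c x : is_derive x 1 (fun y : R => sin (c * y)) (c * cos (c * x)).
Proof.
have d1 : is_derive x 1 (fun y : R => c * y) c.
  by have := is_deriveZ c (is_derive_id x (1 : R)); rewrite -[c *: 1]/(c * 1) mulr1.
by have := is_derive1_comp (is_derive_sin (c * x)) d1; rewrite mulrC.
Qed.

Lemma sin_natpi n : sin (n%:R * pi) = 0 :> R.
Proof.
elim: n => [|n IH]; first by rewrite mul0r sin0.
by rewrite -natr1 mulrDl mul1r sinDpi IH oppr0.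
Qed.

Lemma continuous_sinZ c : continuous (fun y : R => sin (c * y)).
Proof. exact: (is_derive_continuous (is_derive_sinZ c)). Qed.

Lemma Rintegral_sin_sin n :
  \int[mu]_(t in `[0, pi]) (sin (n.+1%:R * t) * sin t) = (n == 0)%:R * (pi / 2).
Proof.
have prod (t : R) : sin (n.+1%:R * t) * sin t = (cos (n%:R * t) - cos (n.+2%:R * t)) / 2.
  have -> : n%:R * t = n.+1%:R * t - t by rewrite -[in RHS]natr1; ring.
  have -> : n.+2%:R * t = n.+1%:R * t + t by rewrite -[in LHS]natr1; ring.
  by rewrite cosB cosD; field.
have cc : continuous (fun t : R => sin (n.+1%:R * t) * sin t).
  move=> t; apply: cvgM; first exact: continuous_sinZ.
  exact: continuous_sin.
have n2 : (n.+2%:R : R) != 0 by rewrite pnatr_eq0.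
case: n prod cc n2 => [|n] prod cc n2.
  have dF (t : R) : is_derive t 1 (fun t : R => 2^-1 * t - 4^-1 * sin (2 * t))
      (sin (1%:R * t) * sin t).
    have d1 := is_deriveZ 2^-1 (is_derive_id t (1 : R)).
    have d2 := is_deriveZ 4^-1 (is_derive_sinZ 2 t).
    have := is_deriveB d1 d2 => /is_derive_eq; apply; rewrite prod mul0r cos0.
    by rewrite -[_ *: 1]/(_ * 1) -[_ *: (_ * _)]/(_ * (_ * _)); field.
  rewrite (Rintegral_antiderivative (pi_gt0 R) cc dF).
  by rewrite !mulr0 sin0 sin_natpi !mulr0 !subr0 mul1r mulrC.
have n1 : (n.+1%:R : R) != 0 by rewrite pnatr_eq0.
have dF (t : R) : is_derive t 1 (fun t : R => (2 * n.+1%:R)^-1 * sin (n.+1%:R * t)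
   - (2 * n.+3%:R)^-1 * sin (n.+3%:R * t)) (sin (n.+2%:R * t) * sin t).
  have d1 := is_deriveZ (2 * n.+1%:R)^-1 (is_derive_sinZ n.+1%:R t).
  have d2 := is_deriveZ (2 * n.+3%:R)^-1 (is_derive_sinZ n.+3%:R t).
  have := is_deriveB d1 d2 => /is_derive_eq; apply; rewrite prod.
  set a := n.+1%:R in n1 *; set b := n.+3%:R in n2 *; clearbody a b.
  rewrite -[(2 * a)^-1 *: _]/(_ * _) -[(2 * b)^-1 *: _]/(_ * _); field.
  by rewrite n1 n2.
rewrite (Rintegral_antiderivative (pi_gt0 R) cc dF).
by rewrite !mulr0 sin0 !sin_natpi !mulr0 !subr0 mul0r.
Qed.

Lemma is_derive_2cos x : is_derive x 1 (fun t : R => 2 * cos t) (- (2 * sin x)).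
Proof.
have /is_derive_eq := is_deriveZ 2 (is_derive_cos x); apply.
by rewrite -[_ *: _]/(_ * _) mulrN.
Qed.

Lemma Rintegral_semicircle (f : R -> R) : continuous f ->
  \int[mu]_x (f x * semicircle_pdf x) =
  \int[mu]_(t in `[0, pi]) (f (2 * cos t) * (2 / pi * sin t ^+ 2)).
Proof.
move=> cf; have pi0 : 0 < pi :> R by exact: pi_gt0.
pose G x : R := f x * ((2 * pi)^-1 * Num.sqrt (4 - x ^+ 2)).
have cG : continuous G.
  move=> x; apply: cvgM; first exact: cf.
  apply: cvgMr; apply: (@continuous_comp _ _ _ (fun x => 4 - x ^+ 2) Num.sqrt).
    by apply: cvgB; [exact: cvg_cst|exact: exprn_continuous].
  exact: sqrt_continuous.
transitivity (\int[mu]_(x in `[-2, 2]) G x).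
  rewrite [RHS]Rintegral_mkcond; apply: eq_Rintegral => x _.
  rewrite /G /semicircle_pdf patchE indicE; case: ifPn => _ /=.
    by rewrite mulr1.
  by rewrite mulr0 mul0r mulr0.
pose F t : R := 2 * cos t.
have dF (t : R) : derive1 F t = - (2 * sin t).
  by rewrite derive1E; have dt := is_derive_2cos t; rewrite derive_val.
have dFE : derive1 F = fun t => - (2 * sin t) by apply/funext.
have cF : continuous F by apply: is_derive_continuous is_derive_2cos.
have cF' : continuous (derive1 F).
  rewrite dFE => t; apply: cvgN; apply: cvgMr; exact: continuous_sin.
rewrite /Rintegral.
have := @integration_by_substitution_decreasing R F G 0 pi (ltW pi0).
rewrite /F cos0 cospi mulr1 mulrN1 => ->.
- congr fine; apply: eq_integral => t; rewrite inE/= in_itv/= => tpi.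
  congr (_%:E); transitivity (G (F t) * - derive1 F t) => //.
  rewrite dF opprK /G /F.
  have s0 := sin_ge0_pi tpi.
  have -> : 4 - (2 * cos t) ^+ 2 = (2 * sin t) ^+ 2.
    by rewrite !exprMn sin2cos2; ring.
  rewrite sqrtr_sqr ger0_norm ?mulr_ge0//.
  by move: (lt0r_neq0 pi0); generalize (pi : R) => q q0; field.
- by move=> x y xpi ypi xy; rewrite ltr_pM2l// ltr_cos.
- by move=> x _; exact: cF'.
- by apply/cvg_ex; exists (derive1 F 0); apply: cvg_at_right_filter; exact: cF'.
- by apply/cvg_ex; exists (derive1 F pi); apply: cvg_at_left_filter; exact: cF'.
- split.
  + by move=> x _; have [] := is_derive_2cos x.
  + by apply: cvg_at_right_filter; exact: cF.
  + by apply: cvg_at_left_filter; exact: cF.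
- exact/continuous_subspaceT.
Qed.

End semicircle_integral.

(** * Expansion of the resolvent and its semicircle integral *)

Section stieltjes_semicircle.
Context {R : realType}.
Implicit Types (x y a b c t : R) (z m w : R[i]).
Local Notation Re := complex.Re.
Local Notation Im := complex.Im.
Local Notation normc := Normc.normc.
Local Notation mu := (@lebesgue_measure R).

Lemma geometric_squeeze a c (r : R) : 0 <= r < 1 -> 0 <= c ->
  (forall n, `|a| <= c * r ^+ n) -> a = 0.
Proof.
move=> /andP[r0 r1] c0 h; apply/eqP; rewrite -normr_eq0; apply/eqP/le_anti.
rewrite normr_ge0 andbT.
have cv : (fun n => c * r ^+ n) @ \oo --> c * 0.
  by apply: cvgMr; apply: cvg_expr; rewrite ger0_norm.
have cu : cvgn (fun n => c * r ^+ n) by apply/cvg_ex; exists (c * 0).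
have := @limr_ge _ _ _ _ `|a| (fun n => c * r ^+ n) cu _.
by rewrite (cvg_lim _ cv)// mulr0; apply; exact: nearW.
Qed.

Lemma normc_exp z n : normc (z ^+ n) = normc z ^+ n.
Proof.
elim: n => [|n IH]; first by rewrite !expr0 Normc.normc1.
by rewrite !exprS Normc.normcM IH.
Qed.

Section series.
Variables (z m : R[i]).
Hypotheses (z0 : 0 < Im z) (mz : m * (z + m) = -1) (m1 : normc m < 1).

Let D t : R[i] := (2 * cos t)%:C - z.
(** Since sin t times U_k(cos t) is sin((k+1)t), this is sin t times a partial sum of the generating
    function of the Chebyshev polynomials at -m. Keeping the factor sin t avoids dividing by it at
    the endpoints. *)
Let S n t : R[i] := \sum_(k < n) (- m) ^+ k * (sin (k.+1%:R * t))%:C.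
Let rem n t : R[i] := (- m) ^+ n * (sin (n.+1%:R * t))%:C -
  (- m) ^+ n.+1 * (sin (n%:R * t))%:C.

Let ImDt t : Im (D t) = - Im z.
Proof. by rewrite /D; case: (z) => a b /=; rewrite add0r. Qed.

Let D_neq0 t : D t != 0.
Proof.
by apply/eqP => /(congr1 (@complex.Im R)); rewrite ImDt => /= /eqP; rewrite oppr_eq0 gt_eqF.
Qed.

Let normD t : Im z <= normc (D t).
Proof.
by apply: le_trans (normc_Im _); rewrite ImDt normrN gtr0_norm.
Qed.

(** The equation for [m] turns [m * D t] into the denominator 1 + 2 m cos t + m^2 of the generating
    function. The sum then telescopes through the three-term recurrence for sin(nt). *)
Let mS n t : m * S n t * D t = (sin t)%:C - rem n t.
Proof.
have mD : m * D t = 1 + (2 * cos t)%:C * m + m ^+ 2.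
  have -> : m * D t = (2 * cos t)%:C * m + m ^+ 2 - m * (z + m) by rewrite /D; ring.
  by rewrite mz; ring.
rewrite mulrAC mD; elim: n => [|n IH].
  by rewrite /S /rem big_ord0 mul0r sin0 expr0 !mul1r !mulr0 subr0 subrr.
have ss : sin (n.+2%:R * t) = 2 * cos t * sin (n.+1%:R * t) - sin (n%:R * t).
  have -> : n.+2%:R * t = n.+1%:R * t + t by rewrite -[in LHS]natr1; ring.
  have -> : n%:R * t = n.+1%:R * t - t by rewrite -[in RHS]natr1; ring.
  by rewrite sinD sinB; ring.
rewrite /S big_ord_recr/= -/(S n t) mulrDr IH /rem ss rmorphB rmorphM !exprS.
by ring.
Qed.

Let remE n t : (sin t)%:C / D t = m * S n t + rem n t / D t.
Proof.
by apply: (mulIf (D_neq0 t)); rewrite mulrDl !mulfVK// mS subrK.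
Qed.

Let norm_rem n t : normc (rem n t / D t) <= 2 / Im z * normc m ^+ n.
Proof.
have b k (u : R) : normc ((- m) ^+ k * (sin u)%:C) <= normc m ^+ k.
  rewrite Normc.normcM normc_exp normcN normc_real ler_piMr ?sin_max//.
  by apply: exprn_ge0; exact: normc_ge0.
rewrite Normc.normcM Normc.normcV mulrAC ler_pM// ?normc_ge0 ?invr_ge0//.
  apply: normc_ge0.
  apply: (le_trans (normc_triangleB _ _)).
  have := b n (n.+1%:R * t); have := b n.+1 (n%:R * t).
  have : normc m ^+ n.+1 <= normc m ^+ n.
    by rewrite exprS ler_piMl ?exprn_ge0 ?normc_ge0// ltW.
  lra.
by rewrite lef_pV2// posrE// (lt_le_trans z0).
Qed.

Variable l : R[i] -> R.
Hypotheses (lD : forall x y : R[i], l (x + y) = l x + l y)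
  (lZ : forall (r : R) (x : R[i]), l (r%:C * x) = r * l x)
  (l_le : forall x : R[i], `|l x| <= normc x)
  (lc : continuous (fun x : R => l ((x%:C - z)^-1))).

Let P n t := 2 / pi * \sum_(k < n) l (m * (- m) ^+ k) * (sin (k.+1%:R * t) * sin t).

Let integrable_pi (f : R -> R) : continuous f ->
  mu.-integrable `[0, pi] (EFin \o f).
Proof.
move=> cf; apply: continuous_compact_integrable; first exact: segment_compact.
exact/continuous_subspaceT.
Qed.

Let l0 : l 0 = 0.
Proof. by have := lZ 0 0; rewrite mulr0 mul0r. Qed.

Let cs k : continuous (fun t : R => sin (k.+1%:R * t) * sin t).
Proof. by move=> t; apply: cvgM; [exact: continuous_sinZ|exact: continuous_sin]. Qed.

Let csum n : continuous (fun t : R =>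
  \sum_(k < n) l (m * (- m) ^+ k) * (sin (k.+1%:R * t) * sin t)).
Proof.
elim: n => [|n IH].
  rewrite (_ : (fun t => _) = cst 0); last by apply/funext => t; rewrite big_ord0.
  exact: cst_continuous.
rewrite (_ : (fun t => _) = (fun t : R =>
    \sum_(k < n) l (m * (- m) ^+ k) * (sin (k.+1%:R * t) * sin t) +
    l (m * (- m) ^+ n) * (sin (n.+1%:R * t) * sin t))); last first.
  by apply/funext => t; rewrite big_ord_recr.
by move=> t; apply: cvgD; [exact: IH|apply: cvgMr; exact: cs].
Qed.

Let cP n : continuous (P n).
Proof. by move=> t; apply: cvgMr; exact: csum. Qed.

Let intP n : \int[mu]_(t in `[0, pi]) P n.+1 t = l m.
Proof.
have pi0 : 0 < pi :> R by exact: pi_gt0.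
rewrite RintegralZl//; last by apply: integrable_pi; exact: csum.
rewrite (_ : Rintegral _ _ _ = l m * (pi / 2)); last first.
  elim: n => [|n IH].
    under eq_Rintegral do rewrite big_ord_recl big_ord0 addr0 expr0 mulr1.
    rewrite RintegralZl//; last by apply: integrable_pi; exact: cs.
    by rewrite Rintegral_sin_sin mul1r.
  under eq_Rintegral do rewrite big_ord_recr/=.
  rewrite RintegralD//; last 2 first.
  - by apply: integrable_pi; exact: csum.
  - by apply: integrable_pi => t; apply: cvgMr; exact: cs.
  rewrite IH RintegralZl//; last by apply: integrable_pi; exact: cs.
  by rewrite Rintegral_sin_sin mul0r mulr0 addr0.
by move: (lt0r_neq0 pi0); generalize (pi : R) => q q0; field.
Qed.

(** [l] stands for the real or the imaginary part, matching the componentwise [Gamma]. By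
    orthogonality only the term k = 0 contributes, so every nonempty partial sum integrates to
    exactly [l m]. The remainder is at most a constant times |m|^n uniformly in t, which makes an
    interchange of series and integral unnecessary. *)
Lemma Rintegral_stieltjes : \int[mu]_x (l ((x%:C - z)^-1) * semicircle_pdf x) = l m.
Proof.
have pi0 : 0 < pi :> R by exact: pi_gt0.
rewrite Rintegral_semicircle//.
pose I t := l (((2 * cos t)%:C - z)^-1) * (2 / pi * sin t ^+ 2).
rewrite (_ : Rintegral _ _ _ = \int[mu]_(t in `[0, pi]) I t)//.
have cI : continuous I.
  move=> t; apply: cvgM.
    apply: (@continuous_comp _ _ _ (fun t : R => 2 * cos t) (fun x : R => l ((x%:C - z)^-1))).
      by apply: cvgMr; exact: continuous_cos.
    exact: lc.
  by apply: cvgMr; apply: cvgM; exact: continuous_sin.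
apply/eqP; rewrite -subr_eq0; apply/eqP.
apply: (@geometric_squeeze _ (4 / Im z * normc m) (normc m)) => //.
- by rewrite normc_ge0 m1.
- by rewrite mulr_ge0 ?normc_ge0// divr_ge0// ltW.
move=> n; rewrite -(intP n) -RintegralB//; last 2 first.
- exact: (integrable_pi cI).
- by apply: integrable_pi; apply: cP.
have cIP : continuous (fun t => I t - P n.+1 t).
  by move=> t; apply: cvgB; [exact: cI|exact: cP].
apply: (le_trans (le_normr_Rintegral _ _)) => //; first exact: integrable_pi.
have bound t : `|I t - P n.+1 t| <= 4 / pi / Im z * normc m ^+ n.+1.
  have -> : I t - P n.+1 t = 2 / pi * sin t * l (rem n.+1 t / D t).
    rewrite /I /P.
    have -> : l ((((2 * cos t)%:C - z)^-1)) * (2 / pi * sin t ^+ 2) =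
        2 / pi * sin t * l ((sin t)%:C / D t) by rewrite lZ /D; ring.
    rewrite (remE n.+1) lD mulrDr [X in X + _ - _](_ : _ = 2 / pi *
      (\sum_(k < n.+1) l (m * (- m) ^+ k) * (sin (k.+1%:R * t) * sin t))); first by ring.
    rewrite -mulrA; congr (_ * _); rewrite /S mulr_sumr.
    have -> : forall F : 'I_n.+1 -> R[i], l (\sum_(k < n.+1) F k) = \sum_(k < n.+1) l (F k).
      by move=> F; elim/big_ind2 : _ => // x1 x2 y1 y2 <- <-.
    rewrite mulr_sumr; apply: eq_bigr => k _.
    have -> : m * ((- m) ^+ k * (sin (k.+1%:R * t))%:C) =
      (sin (k.+1%:R * t))%:C * (m * (- m) ^+ k) by ring.
    by rewrite lZ; ring.
  rewrite 2!normrM [`|2 / pi|]ger0_norm; last by rewrite divr_ge0// ltW.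
  have h1 : `|sin t| <= 1 by exact: sin_max.
  have h2 := le_trans (l_le _) (norm_rem n.+1 t).
  have h3 : `|sin t| * `|l (rem n.+1 t / D t)| <= 1 * (2 / Im z * normc m ^+ n.+1).
    by apply: ler_pM.
  rewrite -mulrA; apply: (@le_trans _ _ (2 / pi * (1 * (2 / Im z * normc m ^+ n.+1)))).
    by rewrite ler_wpM2l// divr_ge0// ltW.
  by rewrite le_eqVlt; apply/orP; left; apply/eqP; ring.
apply: (@le_trans _ _ (\int[mu]_(t in `[0, pi]) (4 / pi / Im z * normc m ^+ n.+1))).
  apply: le_Rintegral => //.
  - by apply: integrable_pi => t; apply: cvg_norm; exact: cIP.
  - by apply: integrable_pi => t; exact: cvg_cst.
rewrite Rintegral_cst//= lebesgue_measure_itv/= lte_fin pi0 -EFinD/= subr0.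
rewrite le_eqVlt; apply/orP; left; apply/eqP; rewrite exprS.
move: (lt0r_neq0 pi0) (lt0r_neq0 z0); generalize (pi : R) => q q0 zn0; field.
by rewrite q0 zn0.
Qed.

End series.
End stieltjes_semicircle.

(** * The quadratic equation for the Stieltjes transform and the bulk lower bound *)

Section Gamma_fixed_point.
Context {R : realType}.
Implicit Types (x y a b c t : R) (z m w : R[i]).
Local Notation Re := complex.Re.
Local Notation Im := complex.Im.
Local Notation normc := Normc.normc.
Local Notation mu := (@lebesgue_measure R).

Lemma Re_inv w : Re w^-1 = Re w / normc w ^+ 2.
Proof. by rewrite normc_sq; case: w. Qed.

Lemma Im_inv w : Im w^-1 = - (Im w / normc w ^+ 2).
Proof. by rewrite normc_sq; case: w. Qed.

Lemma continuous_resolvent z : 0 < Im z ->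
  continuous (fun x : R => Re ((x%:C - z)^-1)) /\
  continuous (fun x : R => Im ((x%:C - z)^-1)).
Proof.
move=> z0; set a := Re z; set b := Im z.
have nE x : normc (x%:C - z) ^+ 2 = (x - a) ^+ 2 + b ^+ 2.
  by rewrite normc_sq /a /b; case: (z) => u v /=; rewrite add0r sqrrN.
have n0 x : (x - a) ^+ 2 + b ^+ 2 != 0.
  by rewrite gt_eqF// ltr_wpDl ?sqr_ge0// exprn_gt0.
have c1 : continuous (fun x : R => x - a).
  by move=> x; apply: cvgB; [exact: cvg_id|exact: cvg_cst].
have c2 : continuous (fun x : R => ((x - a) ^+ 2 + b ^+ 2)^-1).
  move=> x; apply: cvgV; first exact: n0.
  apply: cvgD; last exact: cvg_cst.
  apply: (@continuous_comp _ _ _ (fun x : R => x - a) (fun y : R => y ^+ 2)); first exact: c1.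
  exact: exprn_continuous.
split.
- rewrite (_ : (fun x => _) = (fun x : R => (x - a) * ((x - a) ^+ 2 + b ^+ 2)^-1)).
    by move=> x; apply: cvgM; [exact: c1|exact: c2].
  by apply/funext => x; rewrite Re_inv nE /a; case: (z).
- rewrite (_ : (fun x => _) = (fun x : R => b * ((x - a) ^+ 2 + b ^+ 2)^-1)).
    by move=> x; apply: cvgMr; exact: c2.
  apply/funext => x; rewrite Im_inv nE -mulNr; congr (_ * _).
  by rewrite /b; case: (z) => u v /=; rewrite add0r opprK.
Qed.

Lemma quadratic_root_zE z m : m * (z + m) = -1 -> m != 0 /\ z = - (m + m^-1).
Proof.
move=> mz; have mn0 : m != 0.
  by apply: contra_eq_neq mz => ->; rewrite mul0r eq_sym oppr_eq0 oner_neq0.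
split => //; apply: (mulfI mn0); rewrite mulrN mulrDr divff//.
have -> : m * z = m * (z + m) - m * m by ring.
by rewrite mz; ring.
Qed.

(** The two roots have product 1. From z = -(m + 1/m) one gets Im z = Im m (|m|^-2 - 1), which
    excludes modulus 1 and makes the imaginary part of the root inside the unit disc positive. *)
Lemma quadratic_root z : 0 < Im z ->
  exists m, [/\ m * (z + m) = -1, normc m < 1 & 0 < Im m].
Proof.
move=> z0; pose s := sqrtC (z ^+ 2 - 4).
have ss : s ^+ 2 = z ^+ 2 - 4 by rewrite sqrtCK.
have key m : m * (z + m) = -1 -> normc m < 1 -> 0 < Im m.
  move=> mz m1.
  have [mn0 zE] := quadratic_root_zE mz.
  have nm0 : 0 < normc m ^+ 2.
    rewrite exprn_gt0// lt_def normc_ge0 andbT; apply: contra mn0 => /eqP.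
    by move/Normc.eq0_normc => ->.
  move: z0; rewrite zE ImN ImD Im_inv -{1}[Im m]mulr1 -mulrBr -mulrN opprB.
  have q : (normc m ^+ 2)^-1 - 1 > 0.
    by rewrite subr_gt0 invf_gt1// expr_lt1// normc_ge0.
  by rewrite pmulr_lgt0.
suff [m mz m1] : exists2 m, m * (z + m) = -1 & normc m < 1.
  by exists m; split => //; exact: key.
pose u := (- z + s) / 2; pose v := (- z - s) / 2.
have uv : u * v = 1.
  have -> : u * v = (z ^+ 2 - s ^+ 2) / 4 by rewrite /u /v; field.
  by rewrite ss; field.
have uz : u * (z + u) = -1.
  have -> : u * (z + u) = - (u * v) by rewrite /u /v; field.
  by rewrite uv.
have vz : v * (z + v) = -1.
  have -> : v * (z + v) = - (u * v) by rewrite /u /v; field.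
  by rewrite uv.
have nuv : normc u * normc v = 1 by rewrite -Normc.normcM uv Normc.normc1.
have [u1|u1|u1] := ltgtP (normc u) 1; first by exists u.
- exists v => //; rewrite -nuv ltr_pMl//.
  have := normc_ge0 v; rewrite le_eqVlt => /predU1P[v0|//].
  by move: nuv; rewrite -v0 mulr0 => /esym/eqP; rewrite oner_eq0.
exfalso.
have : normc u ^+ 2 = 1 by rewrite u1 expr1n.
have [_ zE] := quadratic_root_zE uz.
by move=> u2; move: z0; rewrite zE ImN ImD Im_inv u2 divr1 subrr oppr0 ltxx.
Qed.

Lemma Gamma_solves z : 0 < Im z ->
  [/\ Gamma z * (z + Gamma z) = -1, normc (Gamma z) < 1 & 0 < Im (Gamma z)].
Proof.
move=> z0; have [m [mz m1 m0]] := quadratic_root z0.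
suff -> : Gamma z = m by [].
have [cR cI] := continuous_resolvent z0.
rewrite /Gamma (Rintegral_stieltjes z0 mz m1 (@ReD R) (@ReZ R) (@normc_Re R) cR).
rewrite (Rintegral_stieltjes z0 mz m1 (@ImD R) (@ImZ R) (@normc_Im R) cI).
by case: (m).
Qed.

(** With r = |m|^2, the real part of z = -(m + 1/m) gives Re z r = - Re m (r + 1). Then 4r <= (r +
    1)^2 yields (Re m)^2 <= r E^2/4, hence (Im m)^2 >= r (1 - E^2/4). Finally |m| |z + m| = 1 with
    |z + m| <= 3 + 1 gives r >= 1/16, and the factor 1/6 leaves room. *)
Lemma Gamma_fixed_at (E : R) z : 0 < E < 2 -> upper_half_strip E z ->
  fixed_at ((1 - E ^+ 2 / 4) / 6) (Gamma z) z.
Proof.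
move=> /andP[E0 E2] [zE z0 z1]; have [mz m1 m0] := Gamma_solves z0.
split => //; last exact: ltW.
move: mz m1 m0; set m := Gamma z => mz m1 m0.
have n0 := normc_gt0 m0.
have [_ zm] := quadratic_root_zE mz.
set r := normc m ^+ 2.
have r0 : 0 < r by rewrite exprn_gt0.
have r1 : r < 1 by rewrite expr_lt1// ltW.
have rE : r = Re m ^+ 2 + Im m ^+ 2 by rewrite /r normc_sq.
have Rz : Re z * r = - (Re m * (r + 1)).
  by rewrite zm ReN ReD Re_inv -/r; field; rewrite gt_eqF.
have Iz : Im z * r = Im m * (1 - r).
  by rewrite zm ImN ImD Im_inv -/r; field; rewrite gt_eqF.
have zE' : `|Re z| <= E by rewrite ler_norml; case/andP: zE => /ltW -> /ltW ->.
have nz : normc z <= 3.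
  apply: (@le_trans _ _ (`|Re z| + `|Im z|)).
    rewrite -ler_sqr ?nnegrE ?normc_ge0 ?addr_ge0// normc_sq sqrrD.
    rewrite !real_normK ?num_real// lerD2r lerDl mulrn_wge0// mulr_ge0//.
  rewrite (gtr0_norm z0).
  lra.
have nr : 1 <= 16 * r.
  have : 1 = normc m * normc (z + m).
    by rewrite -Normc.normcM mz normcN Normc.normc1.
  have : normc (z + m) <= 4 by apply: (le_trans (normc_triangle _ _)); lra.
  move=> h h1; have h2 : 1 <= normc m * 4 by rewrite {1}h1 ler_pM2l.
  by rewrite /r; nra.
have Re2 : Re m ^+ 2 <= r * (E ^+ 2 / 4).
  have a1 : (Re m * (r + 1)) ^+ 2 <= (E * r) ^+ 2.
    rewrite -(sqrrN (Re m * _)) -Rz !exprMn ler_wpM2r ?sqr_ge0//.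
    by rewrite -[leLHS]real_normK ?num_real// ler_sqr ?nnegrE// ltW.
  have a2 : 4 * r <= (r + 1) ^+ 2.
    by rewrite -subr_ge0 [X in 0 <= X](_ : _ = (r - 1) ^+ 2) ?sqr_ge0//; ring.
  have a3 : Re m ^+ 2 * (4 * r) <= E ^+ 2 * r ^+ 2.
    rewrite -[E ^+ 2 * _]exprMn; apply: le_trans a1; rewrite exprMn.
    by rewrite ler_wpM2l// sqr_ge0.
  by rewrite -(ler_pM2r r0); nra.
set t := 1 - E ^+ 2 / 4.
have t0 : 0 < t by rewrite /t; nra.
have t1 : t <= 1 by rewrite /t; nra.
have Im2 : r * t <= Im m ^+ 2 by rewrite /t; nra.
have Im3 : (t / 6) ^+ 2 <= Im m ^+ 2 by apply: le_trans Im2; nra.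
move: Im3; rewrite ler_sqr// nnegrE; last exact: ltW.
by rewrite divr_ge0// ltW.
Qed.

End Gamma_fixed_point.

(** * Measurability and independence *)

Section complex_measurability.
Context {R : realType}.
Local Notation Re := complex.Re.
Local Notation Im := complex.Im.
Local Notation normc := Normc.normc.

Lemma measurable_complex_pair : measurable_fun [set: R[i]] (@complex_pair R).
Proof. by move=> _ B mB; exists B. Qed.

Lemma measurable_Re : measurable_fun [set: R[i]] (@complex.Re R).
Proof.
exact: (measurableT_comp (@measurable_fst _ _ _ _) measurable_complex_pair).
Qed.

Lemma measurable_Im : measurable_fun [set: R[i]] (@complex.Im R).
Proof.
exact: (measurableT_comp (@measurable_snd _ _ _ _) measurable_complex_pair).
Qed.

Section functions.
Context d (T : measurableType d).
Implicit Types f g : T -> R[i].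

Lemma measurable_complexP f :
  measurable_fun setT (fun x => Re (f x)) ->
  measurable_fun setT (fun x => Im (f x)) -> measurable_fun setT f.
Proof.
move=> mr mi _ A [B mB <-]; rewrite !setTI.
by have := measurable_fun_pair mr mi measurableT mB; rewrite setTI.
Qed.

Lemma measurable_fun_Re f : measurable_fun setT f ->
  measurable_fun setT (fun x => Re (f x)).
Proof. exact: measurableT_comp measurable_Re. Qed.

Lemma measurable_fun_Im f : measurable_fun setT f ->
  measurable_fun setT (fun x => Im (f x)).
Proof. exact: measurableT_comp measurable_Im. Qed.

Lemma measurable_fun_caddc f g : measurable_fun setT f -> measurable_fun setT g ->
  measurable_fun setT (fun x => f x + g x).
Proof.
move=> mf mg; apply: measurable_complexP.
  under eq_fun do rewrite ReD.
  by apply: measurable_funD; exact: measurable_fun_Re.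
under eq_fun do rewrite ImD.
by apply: measurable_funD; exact: measurable_fun_Im.
Qed.

Lemma measurable_fun_coppc f : measurable_fun setT f ->
  measurable_fun setT (fun x => - f x).
Proof.
move=> mf; apply: measurable_complexP.
  under eq_fun do rewrite ReN.
  by apply: measurable_funN; exact: measurable_fun_Re.
under eq_fun do rewrite ImN.
by apply: measurable_funN; exact: measurable_fun_Im.
Qed.

Lemma measurable_fun_cscale (r : R) f : measurable_fun setT f ->
  measurable_fun setT (fun x => r%:C * f x).
Proof.
move=> mf; apply: measurable_complexP.
  under eq_fun do rewrite ReZ.
  by apply: measurable_funM => //; exact: measurable_fun_Re.
under eq_fun do rewrite ImZ.
by apply: measurable_funM => //; exact: measurable_fun_Im.
Qed.

Lemma measurable_fun_normc f : measurable_fun setT f ->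
  measurable_fun setT (fun x => normc (f x)).
Proof.
move=> mf; rewrite (_ : (fun _ => _) =
    (fun x => Num.sqrt (Re (f x) ^+ 2 + Im (f x) ^+ 2))); last first.
  by apply/funext => x; case: (f x).
apply: measurableT_comp; first exact: (continuous_measurable_fun (@sqrt_continuous R)).
by apply: measurable_funD; apply: measurable_funX;
  [exact: measurable_fun_Re|exact: measurable_fun_Im].
Qed.

Lemma measurable_fun_invr (h : T -> R) : measurable_fun setT h ->
  measurable_fun setT (fun x => (h x)^-1).
Proof.
(* The inverse is discontinuous at 0, so it is written through a measurable real power of the
   square; where [h x = 0] both sides are 0. *)
move=> mh; rewrite (_ : (fun _ => _) = (fun x => h x * (h x ^+ 2) `^ (-1))).
  apply: measurable_funM => //; apply: (measurableT_comp (measurable_powR _)).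
  exact: measurable_funX.
apply/funext => x; rewrite powR_inv1 ?sqr_ge0//.
have [->|hx] := eqVneq (h x) 0; first by rewrite invr0 mul0r.
by field.
Qed.

Lemma measurable_fun_cinv f : measurable_fun setT f ->
  measurable_fun setT (fun x => (f x)^-1).
Proof.
move=> mf; apply: measurable_complexP.
  under eq_fun do rewrite Re_inv.
  apply: measurable_funM; first exact: measurable_fun_Re.
  by apply: measurable_fun_invr; apply: measurable_funX; exact: measurable_fun_normc.
under eq_fun do rewrite Im_inv.
apply: measurable_funN; apply: measurable_funM; first exact: measurable_fun_Im.
by apply: measurable_fun_invr; apply: measurable_funX; exact: measurable_fun_normc.
Qed.

Lemma measurable_fun_hgap m f : measurable_fun setT f ->
  measurable_fun setT (fun x => hgap m (f x)).
Proof.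
move=> mf; apply: measurable_funM.
  apply: measurable_funX; apply: measurable_fun_normc.
  exact: measurable_fun_caddc.
by apply: measurable_fun_invr; exact: measurable_fun_Im.
Qed.

Lemma measurable_fun_powRc (p : R) (h : T -> R) : measurable_fun setT h ->
  measurable_fun setT (fun x => h x `^ p).
Proof. exact: (measurableT_comp (measurable_powR p)). Qed.

Lemma measurable_fun_hconv_gap p m f g : measurable_fun setT f ->
  measurable_fun setT g ->
  measurable_fun setT (fun x => hconv_gap p m (f x) (g x)).
Proof.
move=> mf mg; apply: measurable_funB.
  apply: measurable_funM => //; apply: measurable_funD;
  by apply: measurable_fun_powRc; exact: measurable_fun_hgap.
apply: measurable_fun_powRc; apply: measurable_fun_hgap.
by apply: measurable_fun_cscale; exact: measurable_fun_caddc.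
Qed.

Lemma measurable_fun_nat_index dS (S : measurableType dS) (N : T -> nat)
    (f : nat -> T -> S) : measurable_fun setT N ->
  (forall n, measurable_fun setT (f n)) ->
  measurable_fun setT (fun x => f (N x) x).
Proof.
move=> mN mf.
have mNn n : measurable (N @^-1` [set n]) by rewrite -[X in measurable X]setTI; exact: mN.
rewrite [X in measurable_fun X](_ : _ = \bigcup_n (N @^-1` [set n])); last first.
  by apply/esym/seteqP; split => // x _; exists (N x).
apply/(measurable_fun_bigcup _ mNn) => n.
apply: (@eq_measurable_fun _ _ _ _ _ (f n)).
  by move=> x; rewrite inE/= => ->.
exact: measurable_funTS.
Qed.

Lemma measurable_fun_csum n (f : nat -> T -> R[i]) :
  (forall i, measurable_fun setT (f i)) ->
  measurable_fun setT (fun x => \sum_(i < n) f i x).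
Proof.
move=> mf; elim: n => [|n IH].
  by under eq_fun do rewrite big_ord0; exact: measurable_cst.
by under eq_fun do rewrite big_ord_recr/=; exact: measurable_fun_caddc.
Qed.

Lemma measurable_fun_cmean n (f : nat -> T -> R[i]) :
  (forall i, measurable_fun setT (f i)) ->
  measurable_fun setT (fun x => cmean n (f ^~ x)).
Proof. by move=> mf; apply: measurable_fun_cscale; exact: measurable_fun_csum. Qed.

Lemma measurable_fun_mean n (f : nat -> T -> R) :
  (forall i, measurable_fun setT (f i)) ->
  measurable_fun setT (fun x => mean n (f ^~ x)).
Proof. by move=> mf; apply: measurable_funM => //; exact: measurable_sum. Qed.

End functions.
End complex_measurability.

(** Images are kept as finite measures rather than laws because they are also taken of restrictions
    of [P] to an event, which need not have mass 1. *)
Definition finite_image d1 d2 (T1 : measurableType d1) (T2 : measurableType d2)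
    (R : realType) (m : {finite_measure set T1 -> \bar R})
    (f : {mfun T1 >-> T2}) := pushforward m f.

Section finite_image_measure.
Context d1 d2 (T1 : measurableType d1) (T2 : measurableType d2) {R : realType}.
Variables (m : {finite_measure set T1 -> \bar R}) (f : {mfun T1 >-> T2}).

Let finite_image0 : finite_image m f set0 = 0%E.
Proof. exact: measure0. Qed.

Let finite_image_ge0 A : (0 <= finite_image m f A)%E.
Proof. exact: measure_ge0. Qed.

Let finite_image_sigma_additive : semi_sigma_additive (finite_image m f).
Proof. exact: measure_semi_sigma_additive. Qed.

HB.instance Definition _ := isMeasure.Build _ _ _ (finite_image m f)
  finite_image0 finite_image_ge0 finite_image_sigma_additive.

Let finite_image_fin_num : fin_num_fun (finite_image m f).
Proof.
move=> A mA; rewrite /finite_image /pushforward fin_num_measure//.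
by rewrite -[X in measurable X]setTI; exact: measurable_funP.
Qed.

HB.instance Definition _ := Measure_isFinite.Build _ _ _ (finite_image m f)
  finite_image_fin_num.

End finite_image_measure.

Section integral_transfer.
Local Open Scope ereal_scope.
Context {R : realType}.

Lemma ge0_integral_mrestr d (T : measurableType d) (mu : {measure set T -> \bar R})
    (D : set T) (mD : measurable D) (f : T -> \bar R) :
  measurable_fun setT f -> (forall x, 0 <= f x) ->
  \int[mrestr mu mD]_x f x = \int[mu]_(x in D) f x.
Proof.
move=> mf f0.
rewrite (@ge0_negligible_integral _ _ _ _ setT (~` D))//=; last 2 first.
- exact: measurableC.
- by rewrite /mrestr setICl measure0.
rewrite setTD setCK; apply: eq_measure_integral => A mA AD.
by rewrite /= /mrestr setIidl.
Qed.

Lemma ge0_integral_same_law d1 d2 d (T1 : measurableType d1) (T2 : measurableType d2)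
    (S : measurableType d) (P1 : probability T1 R) (X1 : T1 -> S)
    (P2 : probability T2 R) (X2 : T2 -> S) (f : S -> \bar R) :
  measurable_fun setT X1 -> measurable_fun setT X2 ->
  measurable_fun setT f -> (forall x, 0 <= f x) -> same_law P1 X1 P2 X2 ->
  \int[P1]_w f (X1 w) = \int[P2]_w f (X2 w).
Proof.
move=> m1 m2 mf f0 sl.
have e1 := @ge0_integral_pushforward _ _ _ _ _ _ m1 P1 setT f measurableT mf (fun y _ => f0 y).
have e2 := @ge0_integral_pushforward _ _ _ _ _ _ m2 P2 setT f measurableT mf (fun y _ => f0 y).
rewrite !preimage_setT in e1 e2; rewrite -[LHS]e1 -[RHS]e2.
pose F1 := isMeasurableFun.Build _ _ _ _ _ m1.
pose F2 := isMeasurableFun.Build _ _ _ _ _ m2.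
pose X1' : {mfun T1 >-> S} := HB.pack X1 F1.
pose X2' : {mfun T2 >-> S} := HB.pack X2 F2.
by apply: (@eq_measure_integral _ _ _ _ (distribution P2 X2') (distribution P1 X1')) => A mA _; exact: sl.
Qed.

(* If Y is independent of X, it may be replaced under the integral by an
   independent copy defined on another space. *)
Lemma ge0_integral_independent d d1 d2 d' (T : measurableType d) (T' : measurableType d')
    (S1 : measurableType d1) (S2 : measurableType d2)
    (Q : {finite_measure set T -> \bar R}) (P' : probability T' R)
    (X : T -> S1) (Y : T -> S2) (Y' : T' -> S2) (f : S1 -> S2 -> \bar R) :
  measurable_fun setT X -> measurable_fun setT Y -> measurable_fun setT Y' ->
  measurable_fun [set: S1 * S2] (fun s => f s.1 s.2) -> (forall x y, 0 <= f x y) ->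
  (forall A B, measurable A -> measurable B ->
    Q (X @^-1` A `&` Y @^-1` B) = Q (X @^-1` A) * P' (Y' @^-1` B)) ->
  \int[Q]_w f (X w) (Y w) = \int[Q]_w \int[P']_w' f (X w) (Y' w').
Proof.
move=> mX mY mY' mf f0 indep.
pose F1 := isMeasurableFun.Build _ _ _ _ _ mX.
pose F2 := isMeasurableFun.Build _ _ _ _ _ mY'.
pose X1 : {mfun T >-> S1} := HB.pack X F1.
pose X2 : {mfun T' >-> S2} := HB.pack Y' F2.
have mXY := measurable_fun_pair mX mY.
pose F3 := isMeasurableFun.Build _ _ _ _ _ mXY.
pose X3 : {mfun T >-> (S1 * S2)%type} := HB.pack (fun w => (X w, Y w)) F3.
pose m1 : {finite_measure set S1 -> \bar R} := finite_image Q X1.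
pose m2 : {finite_measure set S2 -> \bar R} := distribution P' X2.
pose F (s : S1 * S2) := f s.1 s.2.
transitivity (\int[finite_image Q X3]_s F s).
  by rewrite (ge0_integral_pushforward mXY)// => s _; exact: f0.
transitivity (\int[(m1 \x m2)%E]_s F s).
  apply: (@eq_measure_integral _ _ _ _ (m1 \x m2)%E (finite_image Q X3)) => A mA _.
  by apply/esym; apply: product_measure_unique.
rewrite fubini_tonelli1//; last by move=> s; exact: f0.
rewrite (ge0_integral_pushforward mX)//; last 2 first.
- by apply: measurable_fun_fubini_tonelli_F => // s; exact: f0.
- by move=> x _; apply: integral_ge0 => y _; exact: f0.
apply: eq_integral => w _ /=.
rewrite /fubini_F (ge0_integral_pushforward mY')//.
- exact: measurable_fun_pair2 mf.
- by move=> y _; exact: f0.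
Qed.

End integral_transfer.

(** * Integrals of functions of independent copies *)

Section independent_copies.
Local Open Scope ereal_scope.
Context {R : realType} d d1 d2 d' (T : measurableType d) (T' : measurableType d')
  (S1 : measurableType d1) (S2 : measurableType d2).
Variables (P : probability T R) (P' : probability T' R).
Variables (X : T -> S1) (Y : nat -> T -> S2) (Y' : T' -> S2).
Hypotheses (mX : measurable_fun setT X) (mY : forall i, measurable_fun setT (Y i))
  (mY' : measurable_fun setT Y').
Hypotheses (indep : independent_of_sequence P X Y)
  (same : forall i, same_law P (Y i) P' Y').

Lemma independent_pair i j A B C : i != j -> measurable A -> measurable B ->
  measurable C ->
  P (X @^-1` A `&` (Y i @^-1` B `&` Y j @^-1` C)) =
    P (X @^-1` A) * (P' (Y' @^-1` B) * P' (Y' @^-1` C)).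
Proof.
move=> ij mA mB mC.
pose D k := if k == i then B else if k == j then C else setT.
have mD k : measurable (D k) by rewrite /D; do 2 case: ifP => // _.
have ii : (i < (maxn i j).+1)%N by rewrite ltnS leq_maxl.
have jj : (j < (maxn i j).+1)%N by rewrite ltnS leq_maxr.
have Di : D i = B by rewrite /D eqxx.
have Dj : D j = C by rewrite /D eq_sym (negbTE ij) eqxx.
have Dk k : k != i -> k != j -> D k = setT.
  by move=> ki kj; rewrite /D (negbTE ki) (negbTE kj).
have := indep (maxn i j).+1 mA mD.
rewrite (_ : \bigcap_(k < (maxn i j).+1) (Y k @^-1` D k) =
    Y i @^-1` B `&` Y j @^-1` C); last first.
  apply/seteqP; split => w.
    by move=> h; split; [have := h i ii; rewrite Di|have := h j jj; rewrite Dj].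
  move=> [Yi Yj] k _; have [->|ki] := eqVneq k i; first by rewrite Di.
  by have [->|kj] := eqVneq k j; [rewrite Dj|rewrite Dk].
move=> ->; congr (_ * _).
rewrite (bigD1 (Ordinal ii))//= (bigD1 (Ordinal jj))/=; last first.
  by apply/negP => /eqP[] /eqP; rewrite eq_sym (negbTE ij).
rewrite big1 ?mule1 => [|k /andP[ki kj]].
  by rewrite Di Dj !same.
rewrite Dk ?preimage_setT ?probability_setT//.
Qed.

Lemma independent_single i A B : measurable A -> measurable B ->
  P (X @^-1` A `&` Y i @^-1` B) = P (X @^-1` A) * P' (Y' @^-1` B).
Proof.
move=> mA mB; have ij : i != i.+1 by rewrite neq_ltn ltnSn.
have := independent_pair ij mA mB measurableT.
by rewrite !preimage_setT setIT probability_setT mule1.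
Qed.

Let mpre A : measurable A -> measurable (X @^-1` A).
Proof. by move=> mA; rewrite -[X in measurable X]setTI; exact: mX. Qed.

(** The restriction of [P] to an event of [X] still satisfies the product rule between [X] and
    [Y i], so [Y i] can be integrated out first. *)
Lemma integral_independent_single i (A : set S1) (c : S1 -> R) (f : S2 -> R) (K : R) :
  measurable A -> measurable_fun setT c -> (forall x, 0 <= c x)%R ->
  measurable_fun setT f -> (forall y, 0 <= f y)%R ->
  \int[P']_w (f (Y' w))%:E = K%:E ->
  \int[P]_(w in X @^-1` A) (c (X w) * f (Y i w))%:E =
    K%:E * \int[P]_(w in X @^-1` A) (c (X w))%:E.
Proof.
move=> mA mc c0 mf f0 fK; have mXA := mpre mA.
have mcX : measurable_fun setT (fun w => (c (X w))%:E).
  by apply/measurable_EFinP; exact: measurableT_comp mc mX.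
have mfY : measurable_fun setT (fun w => (f (Y' w))%:E).
  by apply/measurable_EFinP; exact: measurableT_comp mf mY'.
have mcf : measurable_fun [set: S1 * S2] (fun s => (c s.1 * f s.2)%:E).
  apply/measurable_EFinP; apply: measurable_funM.
    exact: measurableT_comp mc measurable_fst.
  exact: measurableT_comp mf measurable_snd.
rewrite -[LHS](ge0_integral_mrestr P mXA)//; last 2 first.
- exact: (measurableT_comp mcf (measurable_fun_pair mX (mY i))).
- by move=> w; rewrite lee_fin mulr_ge0.
rewrite (@ge0_integral_independent R _ _ _ _ _ _ _ _ (mrestr P mXA) P' X (Y i) Y'
  (fun x y => (c x * f y)%:E))//; last 2 first.
- by move=> x y; rewrite lee_fin mulr_ge0.
- move=> B C mB mC; rewrite /= /mrestr setIAC -preimage_setI.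
  by rewrite independent_single//; exact: measurableI.
rewrite -(ge0_integral_mrestr P mXA)//; last by move=> w; rewrite lee_fin.
rewrite -ge0_integralZl//; last 2 first.
- by move=> w _; rewrite lee_fin.
- by rewrite -fK; apply: integral_ge0 => w _; rewrite lee_fin.
apply: eq_integral => w _; rewrite -fK muleC -ge0_integralZl//.
- by move=> w' _; rewrite lee_fin.
- by rewrite lee_fin.
Qed.

(** [Y j] is replaced by the external copy [Y'] with [Y i] frozen; this leaves [H (Y i)], to which
    the single-variable case applies. *)
Lemma integral_independent_pair i j (A : set S1) (f : S2 -> S2 -> R) (H : S2 -> R) (K : R) :
  i != j -> measurable A ->
  measurable_fun [set: S2 * S2] (fun s => f s.1 s.2) -> (forall x y, 0 <= f x y)%R ->
  (forall x, \int[P']_w (f x (Y' w))%:E = (H x)%:E) ->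
  measurable_fun setT H ->
  \int[P']_w (H (Y' w))%:E = K%:E ->
  \int[P]_(w in X @^-1` A) (f (Y i w) (Y j w))%:E = K%:E * P (X @^-1` A).
Proof.
move=> ij mA mf f0 fH mH HK; have mXA := mpre mA.
have mfE : measurable_fun [set: S2 * S2] (fun s => (f s.1 s.2)%:E).
  exact/measurable_EFinP.
have H0 x : (0 <= H x)%R.
  by rewrite -lee_fin -fH; apply: integral_ge0 => w _; rewrite lee_fin.
rewrite -[LHS](ge0_integral_mrestr P mXA)//; last 2 first.
- exact: (measurableT_comp mfE (measurable_fun_pair (mY i) (mY j))).
- by move=> w; rewrite lee_fin.
rewrite (@ge0_integral_independent R _ _ _ _ _ _ _ _ (mrestr P mXA) P' (Y i) (Y j) Y'
  (fun x y => (f x y)%:E))//; last first.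
  move=> B C mB mC; rewrite /= /mrestr setIC independent_pair//.
  by rewrite [X in _ = P X * _]setIC independent_single// muleA.
under eq_integral do rewrite fH.
rewrite (ge0_integral_mrestr P mXA); last 2 first.
- by apply/measurable_EFinP; exact: measurableT_comp mH (mY i).
- by move=> w; rewrite lee_fin.
have e := @integral_independent_single i A (cst 1%R) H K mA (measurable_cst _)
  (fun=> ler01) mH H0 HK.
transitivity (\int[P]_(w in X @^-1` A) (cst 1%R (X w) * H (Y i w))%:E).
  by apply: eq_integral => w _; rewrite mul1r.
rewrite e; congr (_ * _).
by rewrite (eq_integral (cst 1))// integral_cst// mul1e.
Qed.

End independent_copies.

Section random_mean.
Local Open Scope ereal_scope.
Context {R : realType} d (T : measurableType d).
Variables (P : probability T R) (N : T -> nat).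
Hypothesis mN : measurable_fun setT N.

(** On each level set [N = n] all n terms have the same integral, so division by n returns it. The
    family [u] may depend on [n] because the cyclic neighbour of an index does. *)
Lemma integral_random_mean (D : set T) (c : T -> R) (u : nat -> nat -> T -> R) (K : R) :
  measurable D -> (forall w, D w -> (0 < N w)%N) ->
  measurable_fun setT c -> (forall w, 0 <= c w)%R ->
  (forall n i, measurable_fun setT (u n i)) -> (forall n i w, 0 <= u n i w)%R ->
  (forall n i, (i < n)%N ->
    \int[P]_(w in D `&` N @^-1` [set n]) (c w * u n i w)%:E =
      K%:E * \int[P]_(w in D `&` N @^-1` [set n]) (c w)%:E) ->
  (0 <= K)%R ->
  \int[P]_(w in D) (c w * mean (N w) (fun i => u (N w) i w))%:E =
    K%:E * \int[P]_(w in D) (c w)%:E.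
Proof.
move=> mD D0 mc c0 mu u0 h K0.
have mNn n : measurable (N @^-1` [set n]) by rewrite -[X in measurable X]setTI; exact: mN.
pose F n := D `&` N @^-1` [set n].
have mF n : measurable (F n) by exact: measurableI.
have DF : D = \bigcup_n F n.
  by apply/seteqP; split => [w Dw|w [n _ []]//]; exists (N w).
have tF : trivIset setT F.
  apply/trivIsetP => i j _ _ /eqP ij; apply/seteqP; split => // w.
  by move=> [[_ /= Ni] [_ /= Nj]]; apply: ij; rewrite -Ni.
have mm n : measurable_fun setT (fun w => mean n (fun i => u n i w)).
  by apply: measurable_fun_mean.
have mM : measurable_fun setT (fun w => (c w * mean (N w) (fun i => u (N w) i w))%:E).
  apply/measurable_EFinP; apply: measurable_funM => //.
  exact: (measurable_fun_nat_index (f := fun n w => mean n (fun i => u n i w)) mN mm).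
have M0 w : 0 <= (c w * mean (N w) (fun i => u (N w) i w))%:E.
  by rewrite lee_fin mulr_ge0// mean_ge0.
have mcE : measurable_fun setT (fun w => (c w)%:E) by exact/measurable_EFinP.
have split_D (f : T -> \bar R) : measurable_fun setT f -> (forall w, 0 <= f w) ->
    \int[P]_(w in D) f w = \sum_(n <oo) \int[P]_(w in F n) f w.
  move=> mf f0; rewrite {1}DF ge0_integral_bigcup//.
  exact: measurable_funTS.
rewrite !split_D//.
rewrite -nneseriesZl//; last first.
  by move=> n _; apply: integral_ge0 => w _; rewrite lee_fin.
apply: eq_eseriesr => n _.
have [->|n0] := posnP n.
  have -> : F 0%N = set0.
    by apply/seteqP; split => // w [Dw /= Nw]; have := D0 _ Dw; rewrite Nw.
  by rewrite !integral_set0 mule0.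
transitivity (\int[P]_(w in F n) (n%:R^-1%:E * \sum_(i < n) (c w * u n i w)%:E)).
  apply: eq_integral => w; rewrite inE => -[_ /= ->].
  by rewrite sumEFin -EFinM /mean mulrCA mulr_sumr.
rewrite ge0_integralZl//=; last 2 first.
- apply: emeasurable_sum => i; apply: measurable_funTS; apply/measurable_EFinP.
  exact: measurable_funM.
- by move=> w _; apply: sume_ge0 => i _; rewrite lee_fin mulr_ge0.
rewrite ge0_integral_sum//; last 2 first.
- by move=> i; apply: measurable_funTS; apply/measurable_EFinP; exact: measurable_funM.
- by move=> i w _; rewrite lee_fin mulr_ge0.
rewrite (eq_bigr (fun=> K%:E * \int[P]_(w in F n) (c w)%:E)); last by move=> i _; exact: h.
set Z := K%:E * _.
have Z0 : 0 <= Z.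
  by apply: mule_ge0; [rewrite lee_fin|apply: integral_ge0 => w _; rewrite lee_fin].
have sumZ k : \sum_(i < k) Z = k%:R%:E * Z.
  elim: k => [|k IH]; first by rewrite big_ord0 mul0e.
  by rewrite big_ord_recr/= IH -natr1 EFinD ge0_muleDl ?mul1e ?lee_fin.
rewrite sumZ muleA -EFinM mulVf ?mul1e//.
by rewrite pnatr_eq0 -lt0n.
Qed.

End random_mean.

Section measure_lemmas.
Context {R : realType}.

Lemma measurable_ltr_set d (T : measurableType d) (f g : T -> R) :
  measurable_fun setT f -> measurable_fun setT g ->
  measurable [set x | f x < g x].
Proof.
move=> mf mg; rewrite (_ : [set _ | _] = (fun x => f x < g x) @^-1` [set true]).
  by rewrite -[X in measurable X]setTI; exact: measurable_fun_ltr.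
by apply/seteqP; split => x.
Qed.

Lemma measurable_ler_set d (T : measurableType d) (f g : T -> R) :
  measurable_fun setT f -> measurable_fun setT g ->
  measurable [set x | f x <= g x].
Proof.
move=> mf mg; rewrite (_ : [set _ | _] = (fun x => f x <= g x) @^-1` [set true]).
  by rewrite -[X in measurable X]setTI; exact: measurable_fun_ler.
by apply/seteqP; split => x.
Qed.

Lemma ae_probability1 d (T : measurableType d) (P : probability T R) (A : set T) :
  measurable A -> P A = 1%E -> {ae P, forall w, A w}.
Proof.
move=> mA PA; exists (~` A); split => //; first exact: measurableC.
by rewrite probability_setC// PA subee.
Qed.

Lemma max0_id (x : R) : 0 <= x -> Num.max 0 x = x.
Proof. by move=> x0; apply/max_idPr. Qed.

Lemma ge0_integral_affine d (T : measurableType d) (Q : probability T R)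
    (f : T -> R) (b c K : R) :
  measurable_fun setT f -> (forall w, 0 <= f w) -> 0 <= b -> 0 <= c ->
  (\int[Q]_w (f w)%:E = K%:E)%E ->
  (\int[Q]_w (b + c * f w)%:E = (b + c * K)%:E)%E.
Proof.
move=> mf f0 b0 c0 fK.
have mfE : measurable_fun setT (fun w => (f w)%:E) by exact/measurable_EFinP.
transitivity (\int[Q]_w (b%:E + c%:E * (f w)%:E))%E; first exact: eq_integral.
rewrite ge0_integralD//; last 2 first.
- by move=> w _; rewrite mule_ge0 ?lee_fin.
- exact: emeasurable_funM.
rewrite integral_cst//= probability_setT mule1 ge0_integralZl//.
- by rewrite fK.
- by move=> w _; rewrite lee_fin.
Qed.

Lemma ge0_integral_linear d (T : measurableType d) (Q : probability T R)
    (D : set T) (f h : T -> R) (b c : R) :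
  measurable D -> measurable_fun setT f -> measurable_fun setT h ->
  (forall w, 0 <= f w) -> (forall w, 0 <= h w) -> 0 <= b -> 0 <= c ->
  (\int[Q]_(w in D) (b * f w + c * h w)%:E =
   b%:E * \int[Q]_(w in D) (f w)%:E + c%:E * \int[Q]_(w in D) (h w)%:E)%E.
Proof.
move=> mD mf mh f0 h0 b0 c0.
have mE (u : T -> R) : measurable_fun setT u -> measurable_fun D (fun w => (u w)%:E).
  by move=> mu; apply: measurable_funTS; exact/measurable_EFinP.
transitivity (\int[Q]_(w in D) (b%:E * (f w)%:E + c%:E * (h w)%:E))%E.
  exact: eq_integral.
rewrite ge0_integralD//; last 4 first.
- by move=> w _; rewrite mule_ge0 ?lee_fin.
- by apply: emeasurable_funM => //; exact: mE.
- by move=> w _; rewrite mule_ge0 ?lee_fin.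
- by apply: emeasurable_funM => //; exact: mE.
rewrite !ge0_integralZl//; [exact: mE|by move=> w _; rewrite lee_fin|exact: mE|].
by move=> w _; rewrite lee_fin.
Qed.

Lemma ge0_integral_mean d (T : measurableType d) (Q : probability T R)
    n (f : nat -> T -> R) (h : nat -> R) :
  (forall i, measurable_fun setT (f i)) -> (forall i w, 0 <= f i w) ->
  (forall i, \int[Q]_w (f i w)%:E = (h i)%:E)%E ->
  (\int[Q]_w (mean n (f ^~ w))%:E = (mean n h)%:E)%E.
Proof.
move=> mf f0 fh.
transitivity (\int[Q]_w (n%:R^-1%:E * \sum_(i < n) (f i w)%:E))%E.
  by apply: eq_integral => w _; rewrite sumEFin.
rewrite ge0_integralZl//; last 2 first.
- by apply: emeasurable_sum => i; exact/measurable_EFinP.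
- by move=> w _; apply: sume_ge0 => i _; rewrite lee_fin.
rewrite ge0_integral_sum//; last 2 first.
- by move=> i; exact/measurable_EFinP.
- by move=> i w _; rewrite lee_fin.
by rewrite (eq_bigr (fun i : 'I_n => (h i)%:E))// sumEFin.
Qed.

End measure_lemmas.

(** * The recursive distributional equation *)

Section recursive_equation.
Context {R : realType} d0 (T : measurableType d0) (P : probability T R)
  (N : {RV P >-> nat}) (v : {RV P >-> R[i]}) (d lam p t a : R)
  d1 (T' : measurableType d1) (P' : probability T' R) (g : {RV P' >-> R[i]})
  (gs : nat -> {RV P >-> R[i]}) (m z : R[i]).
Local Notation Re := complex.Re.
Local Notation Im := complex.Im.
Local Notation normc := Normc.normc.
Hypotheses (p2 : 2 <= p) (t01 : 0 < t <= 1) (fix_m : fixed_at t m z)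
  (v0 : forall w, 0 <= Im (v w)) (dE : ('E_P[fun w => (N w)%:R%R] = d%:E)%E)
  (N1 : P [set w | (1 <= N w)%N] = 1%E) (lam01 : 0 < lam <= 2^-1)
  (alphaE : alpha N v d p lam = a%:E) (g0 : forall w, 0 < Im (g w))
  (gs_law : forall i, same_law P (gs i) P' g)
  (gs_indep : independent_of_sequence P (fun w => (N w, v w)) (fun i => gs i))
  (g_law : same_law P' g P (rde_rhs N v d z (fun i => gs i))).

Let XV w := (N w, v w).
Let G x := hgap m x `^ p.
Let nu (x : nat * R[i]) : R := x.1%:R / d.
Let W (x : nat * R[i]) : R := weight (nu x) x.2 `^ p.
Let hh w := cmean (N w) (fun i => gs i w).
Let gp := rde_rhs N v d z (fun i => gs i).
Let good := good_event N v d lam.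
(** The null event [N = 0] is removed so that the weight is at least 1 and means have at least one
    term everywhere on [bad], not just almost everywhere. *)
Let bad := ~` good `\` [set w | N w = 0%N].
Let z0 : 0 < Im z. Proof. by case: fix_m. Qed.
Let p1 : 1 <= p. Proof. by have := p2; lra. Qed.

Let mN : measurable_fun setT N. Proof. exact: measurable_funP. Qed.
Let mv : measurable_fun setT v. Proof. exact: measurable_funP. Qed.
Let mg : measurable_fun setT g. Proof. exact: measurable_funP. Qed.
Let mgs i : measurable_fun setT (gs i). Proof. exact: measurable_funP. Qed.
Let mXV : measurable_fun setT XV. Proof. exact: measurable_fun_pair. Qed.

Let m_nat (S : measurableType default_measure_display) (f : nat -> S) : measurable_fun setT f.
Proof. by []. Qed.

Let mnu : measurable_fun setT nu.
Proof. exact: (measurableT_comp (m_nat (fun n => n%:R / d : R)) measurable_fst). Qed.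

Let msnd : measurable_fun [set: nat * R[i]] snd. Proof. exact: measurable_snd. Qed.

Let mW : measurable_fun setT W.
Proof.
apply: measurable_fun_powRc; apply: measurable_funM.
  by apply: measurable_funD => //; exact: measurable_fun_invr.
apply: measurable_funX; apply: measurable_funD => //.
exact: measurable_fun_normc.
Qed.

(** The good event as a set of values of [(N, v)]: independence of the g_i is available only over
    preimages under this pair. *)
Let goodX : set (nat * R[i]) :=
  [set x | normc x.2 < lam] `&` fst @^-1` [set n | (2 <= n)%N] `&`
  ([set x | 1 - lam < nu x] `&` [set x | nu x < 1 + lam]).
Let badX : set (nat * R[i]) := ~` goodX `\` fst @^-1` [set 0%N].

Let mgoodX : measurable goodX.
Proof.
apply: measurableI; last by apply: measurableI; exact: measurable_ltr_set.
apply: measurableI.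
  by apply: measurable_ltr_set => //; exact: measurable_fun_normc.
by rewrite -[X in measurable X]setTI; exact: measurable_fst.
Qed.

Let mbadX : measurable badX.
Proof.
apply: measurableD; first exact: measurableC.
by rewrite -[X in measurable X]setTI; exact: measurable_fst.
Qed.

Let goodE : good = XV @^-1` goodX.
Proof.
apply/seteqP; split => w /=.
  by move=> [? ? /andP[? ?]]; split.
by move=> [[? ?] [? ?]]; split => //; apply/andP; split.
Qed.

Let badE : bad = XV @^-1` badX.
Proof. by rewrite /bad goodE; apply/seteqP; split => w. Qed.

Let mpre A : measurable A -> measurable (XV @^-1` A).
Proof. by move=> mA; rewrite -[X in measurable X]setTI; exact: mXV. Qed.

Let mgood : measurable good. Proof. by rewrite goodE; exact: mpre. Qed.
Let mbad : measurable bad. Proof. by rewrite badE; exact: mpre. Qed.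

Let good_N w : good w -> (0 < N w)%N. Proof. by case=> _ + _; exact: ltnW. Qed.
Let bad_N w : bad w -> (0 < N w)%N.
Proof. by move=> [_ /= /eqP]; rewrite lt0n. Qed.

Let mhh : measurable_fun setT hh.
Proof.
apply: (measurable_fun_nat_index (f := fun n w => cmean n (fun i => gs i w)) mN) => n.
exact: (@measurable_fun_cmean R _ T n (fun i w => gs i w)).
Qed.

Let mgp : measurable_fun setT gp.
Proof.
apply: measurable_fun_coppc; apply: measurable_fun_cinv.
apply: measurable_fun_caddc => //; apply: measurable_fun_caddc; first exact: measurable_cst.
apply: measurable_fun_cscale.
apply: (measurable_fun_nat_index (f := fun n w => \sum_(i < n) gs i w) mN) => n.
exact: (@measurable_fun_csum R _ T n (fun i w => gs i w)).
Qed.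

Let mG dS (S : measurableType dS) (f : S -> R[i]) : measurable_fun setT f ->
  measurable_fun setT (fun x => G (f x)).
Proof. by move=> mf; apply: measurable_fun_powRc; exact: measurable_fun_hgap. Qed.

Let G_ge0 x : 0 <= G x. Proof. exact: powR_ge0. Qed.

Let ae_N : {ae P, forall w, (0 < N w)%N}.
Proof.
apply: ae_probability1 N1.
by have := mN measurableT (Y := [set n | (1 <= n)%N]); rewrite setTI; apply.
Qed.

Let d_ge1 : 1 <= d.
Proof.
have h : (\int[P]_w 1 <= \int[P]_w ((N w)%:R)%:E)%E.
  apply: ae_ge0_le_integral => //.
  - apply/measurable_EFinP.
    exact: (measurableT_comp (m_nat (fun n => n%:R : R)) mN).
  - by apply: filterS ae_N => w wN _; rewrite lee_fin ler1n.
move: dE h; rewrite unlock => ->.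
by rewrite integral_cst//= probability_setT mule1 lee_fin.
Qed.

Let gpE w : (0 < N w)%N -> gp w = rmap z ((nu (XV w))%:C * hh w + v w).
Proof.
move=> Nw; rewrite /gp /rde_rhs /rmap addrA; congr (- (_ + _ + _)^-1).
rewrite /hh /cmean mulrA -rmorphM /nu/= mulrAC divff ?mul1r//.
by rewrite pnatr_eq0 -lt0n.
Qed.

Let nu_gt0 w : (0 < N w)%N -> 0 < nu (XV w).
Proof. by move=> Nw; rewrite divr_gt0 ?ltr0n//; have := d_ge1; lra. Qed.

Let ae_Im : {ae P, forall w i, 0 < Im (gs i w)}.
Proof.
apply: (@ae_foralln _ _ _ _ (fun i w => 0 < Im (gs i w))) => i.
have mS : measurable [set x : R[i] | 0 < Im x].
  by apply: measurable_ltr_set => //; exact: measurable_Im.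
apply: (@ae_probability1 _ _ _ P (gs i @^-1` [set x : R[i] | 0 < Im x])).
  by rewrite -[X in measurable X]setTI; exact: mgs.
rewrite gs_law// (_ : _ @^-1` _ = setT) ?probability_setT//.
by apply/seteqP; split => // w _; exact: g0.
Qed.

Let ok w := [/\ (0 < N w)%N, forall i, 0 < Im (gs i w) &
  forall i, normc (gs i w) ^+ 2 * Im z <= Im (gs i w)].

Let hh_gt0 w : (0 < N w)%N -> (forall i, 0 < Im (gs i w)) -> 0 < Im (hh w).
Proof. by move=> Nw gw; apply: cmean_Im_gt0. Qed.

(** The formula for [Im (rmap w)] puts every image of the recursion in the horodisc
    [normc x ^+ 2 * Im z <= Im x], and the equation in law transports this to each g_i. *)
Let ae_ok : {ae P, forall w, ok w}.
Proof.
have aeNI : {ae P, forall w, (0 < N w)%N /\ forall i, 0 < Im (gs i w)}.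
  by apply: filterS2 ae_N ae_Im => w.
suff h : {ae P, forall w i, normc (gs i w) ^+ 2 * Im z <= Im (gs i w)}.
  by apply: filterS2 aeNI h => w [].
apply: (@ae_foralln _ _ _ _ (fun i w => normc (gs i w) ^+ 2 * Im z <= Im (gs i w))) => i.
pose S := [set x : R[i] | normc x ^+ 2 * Im z <= Im x].
have mS : measurable S.
  apply: measurable_ler_set; last exact: measurable_Im.
  by apply: measurable_funM => //; apply: measurable_funX; exact: measurable_fun_normc.
apply: (@ae_probability1 _ _ _ P (gs i @^-1` S)).
  by rewrite -[X in measurable X]setTI; exact: mgs.
rewrite gs_law// g_law//.
have mgS : measurable (gp @^-1` S) by rewrite -[X in measurable X]setTI; exact: mgp.
have [B [mB PB hB]] := aeNI.
have sub : ~` B `<=` gp @^-1` S.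
  move=> w nB; have [Nw Iw] : (0 < N w)%N /\ forall i, 0 < Im (gs i w).
    by apply: contrapT => hn; apply: nB; apply: hB.
  have hw := hh_gt0 Nw Iw.
  have w0 := Im_scale_ge0 (ltW (nu_gt0 Nw)) hw (v0 w).
  suff : normc (gp w) ^+ 2 * Im z <= Im (gp w) by [].
  by rewrite gpE// (Im_rmap z w0) mulrC ler_wpM2r ?sqr_ge0// lerDr.
apply/eqP; rewrite eq_le probability_le1//=.
have <- : P (~` B) = 1%E by rewrite probability_setC// PB sube0.
by apply: le_measure => //; rewrite inE//; exact: measurableC.
Qed.

Let WE w : W (XV w) =
  (1 + normc (v w)) `^ (2 * p) * ((N w)%:R / d + d / (N w)%:R) `^ p.
Proof.
have dge0 : 0 <= d by have := d_ge1; lra.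
have n0 : 0 <= nu (XV w) by rewrite divr_ge0.
have V0 : 0 <= 1 + normc (v w) by rewrite addr_ge0// normc_ge0.
rewrite /W /weight powRM ?sqr_ge0//; last by rewrite addr_ge0// invr_ge0.
by rewrite powRrM powR_mulrn// mulrC /nu/= invf_div.
Qed.

Let W_ge0 x : 0 <= W x. Proof. exact: powR_ge0. Qed.

Let mWX : measurable_fun setT (fun w => (W (XV w))%:E).
Proof. by apply/measurable_EFinP; exact: measurableT_comp mW mXV. Qed.

Let alpha_int : (\int[P]_(w in ~` good) (W (XV w))%:E = a%:E)%E.
Proof.
rewrite -alphaE /alpha unlock integral_mkcond.
apply: eq_integral => w _; rewrite patchE.
have [wg|wg] := boolP (w \in ~` good).
  by rewrite indicE -/good wg mul1r WE.
by rewrite indicE -/good (negbTE wg) !mul0r.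
Qed.

Let bad_int : (\int[P]_(w in bad) (W (XV w))%:E <= a%:E)%E.
Proof.
rewrite -alpha_int; apply: ge0_subset_integral => //.
- exact: measurableC.
- exact: measurable_funTS.
- by move=> w _; rewrite lee_fin.
- by move=> w [].
Qed.

Let a_ge0 : 0 <= a.
Proof. by rewrite -lee_fin -alpha_int integral_ge0// => w _; rewrite lee_fin. Qed.

Let N0_null : P [set w | N w = 0%N] = 0%E.
Proof.
have mA : measurable [set w | (1 <= N w)%N].
  by have := mN measurableT (Y := [set n | (1 <= n)%N]); rewrite setTI; apply.
rewrite (_ : [set w | N w = 0%N] = ~` [set w | (1 <= N w)%N]).
  by rewrite probability_setC// N1 subee.
by apply/seteqP; split => w /=; [move=> ->|case: (N w)].
Qed.

Let mN0 : measurable [set w | N w = 0%N].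
Proof. by have := mN measurableT (Y := [set 0%N]); rewrite setTI; apply. Qed.

Let split_int (f : T -> \bar R) : measurable_fun setT f -> (forall w, 0 <= f w)%E ->
  (\int[P]_w f w = \int[P]_(w in good) f w + \int[P]_(w in bad) f w)%E.
Proof.
move=> mf f0; rewrite (_ : [set: T] = good `|` ~` good); last by rewrite setUv.
rewrite ge0_integral_setU//; last 3 first.
- exact: measurableC.
- by rewrite setUv.
- by rewrite /disj_set setICr.
congr (_ + _)%E; rewrite (@ge0_negligible_integral _ _ _ P _ [set w | N w = 0%N])//.
- exact: measurableC.
- exact: measurable_funTS.
Qed.

Let bad_le : (P bad <= a%:E)%E.
Proof.
apply: le_trans bad_int.
rewrite -[X in (X <= _)%E]mul1e -(integral_cst P mbad 1%E).
apply: ge0_le_integral => //.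
- exact: measurable_funTS.
- move=> w bw; rewrite lee_fin /W.
  apply: (@le_trans _ _ (1 `^ p)); first by rewrite powR1.
  apply: ler_powRl => //; first by have := p1; lra.
  by apply: weight_ge1; apply: nu_gt0; exact: bad_N.
Qed.

Let fin_good : P good = (fine (P good))%:E.
Proof. by rewrite fineK// fin_num_measure. Qed.

Let good_ge : 1 - a <= fine (P good).
Proof.
have := split_int (measurable_cst 1%E) (fun=> lee01).
rewrite !integral_cst//= !mul1e probability_setT.
have fb : P bad \is a fin_num by rewrite fin_num_measure.
rewrite fin_good -(fineK fb) -EFinD => -[h].
by have := bad_le; rewrite -(fineK fb) lee_fin; lra.
Qed.

Let good_le : fine (P good) <= 1.
Proof. by rewrite -lee_fin -fin_good probability_le1. Qed.

Let Xint : (\int[P']_w (G (g w))%:E = \int[P]_w (G (gp w))%:E)%E.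
Proof.
apply: (ge0_integral_same_law (f := fun x => (G x)%:E) mg mgp) => //.
by apply/measurable_EFinP; exact: (mG (f := id)).
Qed.

Let mGE dS (S : measurableType dS) (f : S -> R[i]) : measurable_fun setT f ->
  measurable_fun setT (fun x => (G (f x))%:E).
Proof. by move=> mf; apply/measurable_EFinP; exact: mG. Qed.

(** The bound found here degenerates with [Im z] and is discarded. Only finiteness is kept, which is
    what allows the moment to be absorbed into the left-hand side at the end. *)
Let XK : exists2 K, 0 <= K & (\int[P']_w (G (g w))%:E = K%:E)%E.
Proof.
suff h : (\int[P']_w (G (g w))%:E < +oo)%E.
  exists (fine (\int[P']_w (G (g w))%:E)%E).
    by apply: fine_ge0; apply: integral_ge0 => w _; rewrite lee_fin.
  by rewrite fineK// ge0_fin_numE// integral_ge0// => w _; rewrite lee_fin.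
rewrite Xint.
have c0 : 0 <= (6 / Im z) `^ p by exact: powR_ge0.
apply: (@le_lt_trans _ _ (\int[P]_w ((6 / Im z) `^ p * W (XV w))%:E)%E).
  apply: ae_ge0_le_integral => //.
  - by move=> w _; rewrite lee_fin.
  - exact: (mGE mgp).
  - by move=> w _; rewrite lee_fin mulr_ge0.
  - by apply/measurable_EFinP; apply: measurable_funM => //; exact/measurable_EFinP.
  - apply: filterS ae_ok => w [Nw Iw Sw] _; rewrite lee_fin gpE//.
    have [t0 _] := andP t01.
    apply: (powR_hgap_rmap_crude p1 t0 fix_m) => //; [exact: nu_gt0|exact: hh_gt0|].
    rewrite -subr_le0; apply: le_trans (jensen_cmean (f := fun i => gs i w)
      (normc_sq_convex (ltW z0)) Nw (fun i _ => Iw i)) _.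
    rewrite -[leRHS](mean_const 0 Nw); apply: ler_mean => i _ /=.
    by rewrite subr_le0; exact: Sw.
under eq_integral do rewrite EFinM.
rewrite ge0_integralZl//; last by move=> w _; rewrite lee_fin.
rewrite lte_mul_pinfty// ?lee_fin// split_int//; last by move=> w; rewrite lee_fin.
rewrite lte_add_pinfty//; last by apply: (le_lt_trans bad_int); rewrite ltry.
(* On the good event N/d and its inverse are at most 2 and (1 + |v|)^2 is at most 4, so the weight
   is at most 4 * 4. *)
apply: (@le_lt_trans _ _ (\int[P]_(w in good) (16 `^ p)%:E)%E).
  apply: ge0_le_integral => //.
  - by move=> w _; rewrite lee_fin.
  - exact: measurable_funTS.
  - move=> w [vl N2 /andP[n1 n2]]; rewrite lee_fin.
    apply: ler_powRl; first by have := p1; lra.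
      by apply: le_trans (weight_ge1 (v w) (nu_gt0 (ltnW N2))).
    have [l0 l1] := andP lam01.
    have V0 := normc_ge0 (v w).
    rewrite /weight; set n := nu (XV w).
    have n1' : 2^-1 <= n by rewrite /n /nu/=; lra.
    have n3 : n^-1 <= 2 by rewrite -[2]invrK lef_pV2// posrE; lra.
    have n3' : 0 <= n^-1 by rewrite invr_ge0; lra.
    have n4 : n <= 2 by rewrite /n /nu/=; lra.
    have q1 : (1 + normc (v w)) ^+ 2 <= 4 by rewrite /=; nra.
    apply: (@le_trans _ _ (4 * 4)); last by lra.
    by apply: ler_pM => //; [lra|exact: sqr_ge0|lra].
by rewrite integral_cst//= fin_good -EFinM ltry.
Qed.

(** The convexity gap is known to be nonnegative only on the half-plane. Truncation makes it
    nonnegative on all of [R[i]], as the integration lemmas require. *)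
Let F x y := Num.max 0 (hconv_gap p m x y).

Let F_ge0 x y : 0 <= F x y. Proof. by rewrite /F le_max lexx. Qed.

Let F_le x y : F x y <= 2^-1 * G x + 2^-1 * G y.
Proof.
have := G_ge0 x; have := G_ge0 y; have := G_ge0 (midc x y).
by rewrite /F /hconv_gap ge_max -/(G x) -/(G y) -/(G _) => *; apply/andP; split; lra.
Qed.

Let F_id x y : 0 < Im x -> 0 < Im y -> F x y = hconv_gap p m x y.
Proof. by move=> x0 y0; apply: max0_id; exact: hconv_gap_ge0. Qed.

Let mF : measurable_fun [set: R[i] * R[i]] (fun s => F s.1 s.2).
Proof.
apply: measurable_maxr => //.
by apply: measurable_fun_hconv_gap; [exact: measurable_fst|exact: measurable_snd].
Qed.

Let mFx x : measurable_fun setT (fun y => F x y).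
Proof. exact: (measurableT_comp mF (measurable_pair1 x)). Qed.

(** Averages over the fresh copy g~, which lives on the space of [g]; the space carrying [N], [v]
    and the g_i need not be enlarged. *)
Let H x : R := fine (\int[P']_w (F x (g w))%:E)%E.

Let H_ge0 x : 0 <= H x.
Proof. by apply: fine_ge0; apply: integral_ge0 => w _; rewrite lee_fin. Qed.

Let mFg x : measurable_fun setT (fun w => (F x (g w))%:E).
Proof. by apply/measurable_EFinP; exact: measurableT_comp (mFx x) mg. Qed.

(* [K_G] = E gap(g)^p, [K_F] = E F(g, g~) for an independent copy g~ of g, and
   [K_Y] = E [good; gap(h)^p]. *)
Let K_G : R := fine (\int[P']_w (G (g w))%:E)%E.

Let K_GE : (\int[P']_w (G (g w))%:E = K_G%:E)%E.
Proof. by rewrite /K_G; have [K _ ->] := XK. Qed.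

Let K_G_ge0 : 0 <= K_G.
Proof. by rewrite /K_G; have [K K0 ->] := XK. Qed.

Let H_int x : (\int[P']_w (F x (g w))%:E = (H x)%:E)%E /\ H x <= 2^-1 * G x + 2^-1 * K_G.
Proof.
have le : (\int[P']_w (F x (g w))%:E <= (2^-1 * G x + 2^-1 * K_G)%:E)%E.
  rewrite -(ge0_integral_affine (mG mg) (fun=> G_ge0 _) _ _ K_GE)//; last by rewrite mulr_ge0.
  apply: ge0_le_integral => //.
  - by move=> w _; rewrite lee_fin.
  - apply/measurable_EFinP; apply: measurable_funD => //.
    by apply: measurable_funM => //; exact: mG.
  - by move=> w _; rewrite lee_fin F_le.
have fin : (\int[P']_w (F x (g w))%:E \is a fin_num)%E.
  rewrite ge0_fin_numE; first exact: le_lt_trans le (ltry _).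
  by apply: integral_ge0 => w _; rewrite lee_fin.
by split; [rewrite fineK|rewrite -lee_fin fineK].
Qed.

Let mH : measurable_fun setT H.
Proof.
have mf : measurable_fun [set: R[i] * T'] (fun s => (F s.1 (g s.2))%:E).
  have m2 : measurable_fun [set: R[i] * T'] (fun s => g s.2).
    exact: (measurableT_comp mg measurable_snd).
  have mp : measurable_fun [set: R[i] * T'] (fun s => (s.1, g s.2)).
    exact: (measurable_fun_pair measurable_fst m2).
  by apply/measurable_EFinP; exact: (measurableT_comp mF mp).
apply/measurable_EFinP.
rewrite (_ : EFin \o H = fubini_F P' (fun s => (F s.1 (g s.2))%:E)); last first.
  by apply/funext => x; rewrite /= /fubini_F -(H_int x).1.
by apply: measurable_fun_fubini_tonelli_F => // s; rewrite lee_fin.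
Qed.

Let K_F : R := fine (\int[P']_w (H (g w))%:E)%E.

Let K_FE : (\int[P']_w (H (g w))%:E = K_F%:E)%E.
Proof.
rewrite /K_F fineK// ge0_fin_numE; last by apply: integral_ge0 => w _; rewrite lee_fin.
apply: (@le_lt_trans _ _ (\int[P']_w (2^-1 * K_G + 2^-1 * G (g w))%:E)%E).
  apply: ge0_le_integral => //.
  - by move=> w _; rewrite lee_fin.
  - by apply/measurable_EFinP; exact: measurableT_comp mH mg.
  - apply/measurable_EFinP; apply: measurable_funD => //.
    by apply: measurable_funM => //; exact: mG.
  - by move=> w _; rewrite lee_fin addrC; exact: (H_int _).2.
rewrite (ge0_integral_affine (mG mg) (fun=> G_ge0 _) _ _ K_GE)//; last by rewrite mulr_ge0.
exact: ltry.
Qed.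

Let K_F_ge0 : 0 <= K_F.
Proof. by apply: fine_ge0; apply: integral_ge0 => w _; rewrite lee_fin. Qed.

(** Once g~ has been integrated out, only the law of g' matters, so its dependence on the g_i is
    harmless. *)
Let Hint : (\int[P]_w (H (gp w))%:E = K_F%:E)%E.
Proof.
rewrite -K_FE; apply/esym.
apply: (ge0_integral_same_law (f := fun x => (H x)%:E) mg mgp) => //.
exact/measurable_EFinP.
Qed.

Let mpreN (A : set (nat * R[i])) n : measurable A ->
  XV @^-1` A `&` N @^-1` [set n] = XV @^-1` (A `&` fst @^-1` [set n]) /\
  measurable (A `&` fst @^-1` [set n]).
Proof.
move=> mA; split; first by apply/seteqP; split.
apply: measurableI => //.
by rewrite -[X in measurable X]setTI; exact: measurable_fst.
Qed.

Let mean_single (A : set (nat * R[i])) (c : nat * R[i] -> R) (f : R[i] -> R) (K : R) :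
  measurable A -> (forall w, (XV @^-1` A) w -> (0 < N w)%N) ->
  measurable_fun setT c -> (forall x, 0 <= c x) ->
  measurable_fun setT f -> (forall x, 0 <= f x) ->
  (\int[P']_w (f (g w))%:E = K%:E)%E ->
  (\int[P]_(w in XV @^-1` A) (c (XV w) * mean (N w) (fun i => f (gs i w)))%:E =
    K%:E * \int[P]_(w in XV @^-1` A) (c (XV w))%:E)%E.
Proof.
move=> mA AN mc c0 mf f0 fK.
have K0 : 0 <= K.
  by rewrite -lee_fin -fK; apply: integral_ge0 => w _; rewrite lee_fin.
apply: (@integral_random_mean _ _ _ P N mN _ (fun w => c (XV w)) (fun _ i w => f (gs i w))) => //.
- exact: mpre.
- exact: measurableT_comp mc mXV.
- by move=> n i; exact: measurableT_comp mf (mgs i).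
move=> n i _; have [-> mAn] := mpreN n mA.
exact: (integral_independent_single mXV mgs mg gs_indep gs_law).
Qed.

(** The condition [2 <= N] on the good event enters here: cyclic neighbours, including the wrap from
    the last index to 0, are distinct and hence independent. *)
Let mean_pair : (\int[P]_(w in good)
    (mean (N w) (fun i => F (gs i w) (gs (i.+1 %% N w)%N w)))%:E = K_F%:E * P good)%E.
Proof.
have h := @integral_random_mean _ _ _ P N mN good (cst 1)
  (fun n i w => F (gs i w) (gs (i.+1 %% n)%N w)) K_F mgood good_N (measurable_cst _)
  (fun=> ler01) _ _ _ K_F_ge0.
transitivity (\int[P]_(w in good) (cst 1 w *
    mean (N w) (fun i => F (gs i w) (gs (i.+1 %% N w)%N w)))%:E)%E.
  by apply: eq_integral => w _; rewrite mul1r.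
rewrite {}h//.
- by rewrite (eq_integral (cst 1%E))// integral_cst// mul1e.
- by move=> n i; exact: (measurableT_comp mF (measurable_fun_pair (mgs _) (mgs _))).
move=> n i ni.
have [n2|n2] := leqP n 1.
  rewrite (_ : good `&` _ = set0) ?integral_set0 ?mule0//.
  by apply/seteqP; split => // w [[_ + _] /= Nw]; rewrite Nw ltnNge n2.
rewrite goodE; have [-> mAn] := mpreN n mgoodX.
rewrite [X in (_ = _ * X)%E](eq_integral (cst 1%E))// integral_cst; last exact: mpre.
rewrite mul1e (eq_integral (fun w => (F (gs i w) (gs (i.+1 %% n)%N w))%:E)); last first.
  by move=> w _; rewrite mul1r.
apply: (integral_independent_pair mXV mgs mg gs_indep gs_law _ mAn mF F_ge0 _ mH K_FE).
- have [ni1|ni1] := ltnP i.+1 n; first by rewrite modn_small// neq_ltn ltnSn.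
  have ne : n = i.+1 by apply/eqP; rewrite eqn_leq ni1 ni.
  by move: n2; rewrite ne modnn ltnS lt0n.
- by move=> x; exact: (H_int x).1.
Qed.

(** * The three integrated inequalities and their solution *)

Variable C : R.
Hypotheses (C0 : 0 < C)
  (near : forall k h y, 0 < Im h -> 0 <= Im y -> `|k - 1| <= lam ->
    normc y <= lam ->
    hgap m (rmap z (k%:C * h + y)) `^ p
      <= (1 + C * lam) * hgap m h `^ p + C * lam)
  (heavy : forall k h y, 0 < k -> 0 < Im h -> 0 <= Im y ->
    hgap m (rmap z (k%:C * h + y)) `^ p
      <= C * weight k y `^ p * (1 + hgap m h `^ p))
  (chain : forall k h y x x', 0 < Im h -> 0 <= Im y -> `|k - 1| <= lam ->
    normc y <= lam -> 0 < Im x -> 0 < Im x' ->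
    hgap m h `^ p <= C * (hconv_gap p m h x' + hconv_gap p m x' x +
      hconv_gap p m x (rmap z (k%:C * h + y))) + C * lam).

Let good_close w : good w -> `|nu (XV w) - 1| <= lam /\ normc (v w) <= lam.
Proof.
move=> [vl _ /andP[n1 n2]]; split; last exact: ltW.
by rewrite ler_norml; apply/andP; split; rewrite /nu /=; lra.
Qed.

Let near_w w : ok w -> good w -> G (gp w) <= (1 + C * lam) * G (hh w) + C * lam * 1.
Proof.
move=> [Nw Iw _] gw; have [n1 n2] := good_close gw.
by rewrite mulr1 gpE//; apply: near => //; exact: hh_gt0.
Qed.

Let heavy_w w : ok w -> bad w -> G (gp w) <=
  C * W (XV w) + C * (W (XV w) * mean (N w) (fun i => G (gs i w))).
Proof.
move=> [Nw Iw _] _; rewrite gpE//.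
apply: (le_trans (heavy (nu_gt0 Nw) (hh_gt0 Nw Iw) (v0 w))).
rewrite mulrDr mulr1 -/(W (XV w)) lerD2l -mulrA ler_pM2l// ler_wpM2l//.
exact: (jensen_cmean (f := fun i => gs i w) (hgap_powR_convex m p1) Nw (fun i _ => Iw i)).
Qed.

Let shift_w w : ok w -> good w ->
  1 * mean (N w) (fun i => F (gs i w) (gs (i.+1 %% N w)%N w)) + 1 * G (hh w)
    <= mean (N w) (fun i => G (gs i w)).
Proof.
move=> [Nw Iw _] _; rewrite !mul1r.
have := @mean_gap_shift R p m (N w) (fun i => gs i w) p1 Nw (fun i _ => Iw i).
rewrite (eq_mean (g := fun i => F (gs i w) (gs (i.+1 %% N w)%N w)))// => i _.
by rewrite F_id.
Qed.

(** The chain h, g_i, g~, g' is averaged over i and then over g~. By [mean_gap_center] the first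
    link costs half of mean G - G(h); moving G(h) to the left creates the factor [1 + C / 2]. The
    factors 1 on the right give the nested two-term sums to which [ge0_integral_linear] applies
    repeatedly. *)
Let chain_w w : ok w -> good w ->
  (1 + C / 2) * G (hh w) <=
    (C / 2) * mean (N w) (fun i => G (gs i w)) +
    1 * (C * mean (N w) (fun i => H (gs i w)) + 1 * (C * H (gp w) + C * lam * 1)).
Proof.
move=> okw gw; have [Nw Iw _] := okw; have [n1 n2] := good_close gw.
have hw := hh_gt0 Nw Iw.
have gpw : 0 < Im (gp w).
  by rewrite gpE//; apply: (Im_rmap_gt0 z0); apply: Im_scale_ge0 => //; exact/ltW/nu_gt0.
pose M := mean (N w) (fun i => G (gs i w)).
pose f w' := mean (N w) (fun i => F (gs i w) (g w')) + F (gp w) (g w').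
have pw w' : (1 + C / 2) * G (hh w) <= C / 2 * M + C * lam + C * f w'.
  have gap : mean (N w) (fun i => hconv_gap p m (hh w) (gs i w)) <=
      2^-1 * M - 2^-1 * G (hh w).
    have := @mean_gap_center R p m (N w) (fun i => gs i w) p1 Nw (fun i _ => Iw i).
    rewrite -/(hh w) -/(G (hh w)) -/M.
    have -> : mean (N w) (fun i => hconv_gap p m (gs i w) (hh w)) =
        mean (N w) (fun i => hconv_gap p m (hh w) (gs i w)).
      by congr mean; apply/funext => i; exact: hconv_gapC.
    lra.
  have ave : G (hh w) <= C * (mean (N w) (fun i => hconv_gap p m (hh w) (gs i w)) + f w') + C * lam.
    rewrite -[leLHS](mean_const _ Nw) -[C * lam](mean_const _ Nw).
    rewrite /f -[F (gp w) _](mean_const _ Nw) -!meanD -meanZ -meanD.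
    apply: ler_mean => i _.
    rewrite addrA F_id// F_id// [hconv_gap p m (gp w) _]hconv_gapC gpE//.
    exact: chain.
  have : C * (mean (N w) (fun i => hconv_gap p m (hh w) (gs i w)) + f w') <=
      C * (2^-1 * M - 2^-1 * G (hh w) + f w') by rewrite ler_pM2l// lerD2r.
  lra.
have mf : measurable_fun setT f.
  apply: measurable_funD; last exact: measurableT_comp (mFx _) mg.
  apply: (@measurable_fun_mean R _ T' (N w) (fun i w' => F (gs i w) (g w'))) => i.
  exact: measurableT_comp (mFx _) mg.
have f0 w' : 0 <= f w' by rewrite addr_ge0// mean_ge0.
have fK : (\int[P']_w' (f w')%:E =
    (mean (N w) (fun i => H (gs i w)) + H (gp w))%:E)%E.
  have e1 := @ge0_integral_mean R _ T' P' (N w) (fun i w' => F (gs i w) (g w'))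
     (fun i => H (gs i w)) (fun i => measurableT_comp (mFx _) mg) (fun i w' => F_ge0 _ _)
     (fun i => (H_int _).1).
  have mm : measurable_fun setT (fun w' => mean (N w) (fun i => F (gs i w) (g w'))).
    apply: (@measurable_fun_mean R _ T' (N w) (fun i w' => F (gs i w) (g w'))) => i.
    exact: measurableT_comp (mFx _) mg.
  transitivity (\int[P']_w' (1 * mean (N w) (fun i => F (gs i w) (g w')) + 1 * F (gp w) (g w'))%:E)%E.
    by apply: eq_integral => w' _; rewrite !mul1r.
  rewrite ge0_integral_linear//; last 2 first.
  - exact: measurableT_comp (mFx _) mg.
  - by move=> w'; rewrite mean_ge0.
  by rewrite e1 (H_int _).1 !mul1e.
have b0 : 0 <= C / 2 * M + C * lam.
  have [l0 _] := andP lam01.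
  have q1 : 0 <= C * M by apply: mulr_ge0; [exact: ltW|exact: mean_ge0].
  have q2 : 0 <= C * lam by apply: mulr_ge0; exact: ltW.
  lra.
have aff := ge0_integral_affine mf f0 b0 (ltW C0) fK.
have : (((1 + C / 2) * G (hh w))%:E <=
   (C / 2 * M + C * lam + C * (mean (N w) (fun i => H (gs i w)) + H (gp w)))%:E)%E.
  rewrite -aff -[X in (X <= _)%E](_ : \int[P']_w' cst (((1 + C / 2) * G (hh w))%:E) w' = _)%E; last first.
    by rewrite integral_cst//= probability_setT mule1.
  apply: ge0_le_integral => //.
  - by move=> w' _; rewrite lee_fin mulr_ge0//; have := C0; lra.
  - apply/measurable_EFinP; apply: measurable_funD => //.
    exact: measurable_funM.
  - by move=> w' _; rewrite lee_fin; exact: pw.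
rewrite lee_fin -/M => h; lra.
Qed.

Let M w := mean (N w) (fun i => G (gs i w)).
Let MH w := mean (N w) (fun i => H (gs i w)).
Let MF w := mean (N w) (fun i => F (gs i w) (gs (i.+1 %% N w)%N w)).

Let M_ge0 w : 0 <= M w. Proof. exact: mean_ge0. Qed.
Let MH_ge0 w : 0 <= MH w. Proof. exact: mean_ge0. Qed.
Let MF_ge0 w : 0 <= MF w. Proof. exact: mean_ge0. Qed.

Let mM : measurable_fun setT M.
Proof.
apply: (measurable_fun_nat_index (f := fun n w => mean n (fun i => G (gs i w))) mN) => n.
by apply: (@measurable_fun_mean R _ T n (fun i w => G (gs i w))) => i; exact: mG.
Qed.

Let mMH : measurable_fun setT MH.
Proof.
apply: (measurable_fun_nat_index (f := fun n w => mean n (fun i => H (gs i w))) mN) => n.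
apply: (@measurable_fun_mean R _ T n (fun i w => H (gs i w))) => i.
exact: measurableT_comp mH (mgs i).
Qed.

Let mMF : measurable_fun setT MF.
Proof.
apply: (measurable_fun_nat_index
  (f := fun n w => mean n (fun i => F (gs i w) (gs (i.+1 %% n)%N w))) mN) => n.
apply: (@measurable_fun_mean R _ T n (fun i w => F (gs i w) (gs (i.+1 %% n)%N w))) => i.
exact: (measurableT_comp mF (measurable_fun_pair (mgs _) (mgs _))).
Qed.

Let mHgp : measurable_fun setT (fun w => H (gp w)).
Proof. exact: measurableT_comp mH mgp. Qed.

Let int_good1 : (\int[P]_(w in good) (cst 1 w)%:E = P good)%E.
Proof. by rewrite (eq_integral (cst 1%E))// integral_cst// mul1e. Qed.

Let int_M : (\int[P]_(w in good) (M w)%:E = (K_G * fine (P good))%:E)%E.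
Proof.
have h := @mean_single goodX (cst 1) G K_G mgoodX _ (measurable_cst _)
  (fun=> ler01) (mG (f := id) (@measurable_id _ _ _)) G_ge0 K_GE.
rewrite EFinM -fin_good -int_good1 goodE -h.
  by apply: eq_integral => w _; rewrite mul1r.
by rewrite -goodE.
Qed.

Let int_MH : (\int[P]_(w in good) (MH w)%:E = (K_F * fine (P good))%:E)%E.
Proof.
have h := @mean_single goodX (cst 1) H K_F mgoodX _ (measurable_cst _)
  (fun=> ler01) mH H_ge0 K_FE.
rewrite EFinM -fin_good -int_good1 goodE -h.
  by apply: eq_integral => w _; rewrite mul1r.
by rewrite -goodE.
Qed.

Let int_bad_M : (\int[P]_(w in bad) (W (XV w) * M w)%:E =
  K_G%:E * \int[P]_(w in bad) (W (XV w))%:E)%E.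
Proof.
rewrite badE; apply: (mean_single mbadX) => //; last exact: (mG (f := id)).
by move=> w; rewrite -badE; exact: bad_N.
Qed.

Let mEon (D : set T) (f : T -> R) : measurable_fun setT f ->
  measurable_fun D (fun w => (f w)%:E).
Proof. by move=> mf; apply: measurable_funTS; exact/measurable_EFinP. Qed.

Let le_on (D : set T) (f h : T -> R) : measurable D ->
  measurable_fun setT f -> measurable_fun setT h ->
  (forall w, 0 <= f w) -> (forall w, 0 <= h w) ->
  (forall w, ok w -> D w -> f w <= h w) ->
  (\int[P]_(w in D) (f w)%:E <= \int[P]_(w in D) (h w)%:E)%E.
Proof.
move=> mD mf mh f0 h0 fh; apply: ae_ge0_le_integral => //.
- by move=> w _; rewrite lee_fin.
- exact: mEon.
- by move=> w _; rewrite lee_fin.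
- exact: mEon.
- by apply: filterS ae_ok => w okw Dw; rewrite lee_fin fh.
Qed.

Let K_Y : R := fine (\int[P]_(w in good) (G (hh w))%:E)%E.

Let shift_int : (\int[P]_(w in good) (MF w)%:E +
  \int[P]_(w in good) (G (hh w))%:E <= (K_G * fine (P good))%:E)%E.
Proof.
rewrite -int_M -[X in (X + _)%E]mul1e -[X in (_ + X)%E]mul1e.
rewrite -ge0_integral_linear//; last exact: mG.
apply: le_on => //.
- by apply: measurable_funD; apply: measurable_funM => //; exact: mG.
- by move=> w; rewrite !mul1r addr_ge0.
Qed.

Let K_YE : (\int[P]_(w in good) (G (hh w))%:E = K_Y%:E)%E.
Proof.
rewrite /K_Y fineK// ge0_fin_numE; last by apply: integral_ge0 => w _; rewrite lee_fin.
apply: le_lt_trans (ltry (K_G * fine (P good))); apply: le_trans shift_int.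
by rewrite leeDr// integral_ge0// => w _; rewrite lee_fin.
Qed.

Let shift_ineq : K_F * fine (P good) + K_Y <= K_G * fine (P good).
Proof. by have := shift_int; rewrite K_YE mean_pair fin_good -EFinM -EFinD lee_fin. Qed.

Let Cl0 : 0 <= C * lam.
Proof. by have [l0 _] := andP lam01; apply: mulr_ge0; exact: ltW. Qed.

(** The good event contributes through [near_w], the bad one through [heavy_w]. There, independence
    of (N, v) from the g_i factors the weighted mean into [K_G] times an integral that is at most
    [a]. *)
Let near_ineq : K_G <= (1 + C * lam) * K_Y + C * lam * fine (P good) + (C * a + C * (K_G * a)).
Proof.
have Cge := ltW C0; have Cl := Cl0.
rewrite -lee_fin -K_GE Xint split_int; last 2 first.
- exact: mGE.
- by move=> w; rewrite lee_fin.
rewrite EFinD; apply: leeD.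
  apply: (@le_trans _ _ (\int[P]_(w in good) ((1 + C * lam) * G (hh w) + C * lam * cst 1 w)%:E)%E).
    apply: le_on => //.
    - exact: mG.
    - apply: measurable_funD; apply: measurable_funM => //; exact: mG.
    - by move=> w; rewrite addr_ge0// mulr_ge0// addr_ge0.
  rewrite ge0_integral_linear//; [|exact: mG|by rewrite addr_ge0].
  by rewrite K_YE int_good1 fin_good.
apply: (@le_trans _ _ (\int[P]_(w in bad) (C * W (XV w) + C * (W (XV w) * M w))%:E)%E).
  have mWXV : measurable_fun setT (fun w => W (XV w)) by exact: measurableT_comp mW mXV.
  apply: le_on => //.
  - exact: mG.
  - apply: measurable_funD; apply: measurable_funM => //; exact: measurable_funM.
  - by move=> w; rewrite addr_ge0// mulr_ge0// mulr_ge0.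
rewrite ge0_integral_linear//; last 3 first.
- exact: measurableT_comp mW mXV.
- by apply: measurable_funM => //; exact: measurableT_comp mW mXV.
- by move=> w; rewrite mulr_ge0.
rewrite EFinD; apply: leeD.
  by rewrite EFinM lee_wpmul2l// lee_fin.
by rewrite int_bad_M !EFinM; do 2 (apply: lee_wpmul2l; first by rewrite lee_fin).
Qed.

(** One [K_F] comes without the factor [P good]: g' depends on (N, v), so the integral of H(g') is
    enlarged to the whole space instead of being factored. *)
Let chain_ineq : (1 + C / 2) * K_Y <= C / 2 * (K_G * fine (P good)) +
  (C * (K_F * fine (P good)) + (C * K_F + C * lam * fine (P good))).
Proof.
have Cge := ltW C0; have Cl := Cl0.
have C2 : 0 <= C / 2 by lra.
have m3 : measurable_fun setT (fun w => C * H (gp w) + C * lam * cst 1 w).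
  by apply: measurable_funD; apply: measurable_funM.
have m2 : measurable_fun setT (fun w => C * MH w + 1 * (C * H (gp w) + C * lam * cst 1 w)).
  by apply: measurable_funD; apply: measurable_funM.
have p3 w : 0 <= C * H (gp w) + C * lam * cst 1 w.
  by apply: addr_ge0; apply: mulr_ge0.
have p_2 w : 0 <= C * MH w + 1 * (C * H (gp w) + C * lam * cst 1 w).
  by apply: addr_ge0; apply: mulr_ge0.
have int_H : (\int[P]_(w in good) (H (gp w))%:E <= K_F%:E)%E.
  rewrite -Hint; apply: ge0_subset_integral => //.
  - exact: mEon.
  - by move=> w _; rewrite lee_fin.
have le1 : (\int[P]_(w in good) ((1 + C / 2) * G (hh w) + 0 * cst 1 w)%:E <=
    \int[P]_(w in good) (C / 2 * M w + 1 * (C * MH w + 1 * (C * H (gp w) + C * lam * cst 1 w)))%:E)%E.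
  apply: le_on => //.
  - by apply: measurable_funD; apply: measurable_funM => //; exact: mG.
  - by apply: measurable_funD; apply: measurable_funM.
  - by move=> w; rewrite mul0r addr0 mulr_ge0//; lra.
  - by move=> w; apply: addr_ge0; apply: mulr_ge0.
  - by move=> w okw gw; rewrite mul0r addr0; exact: chain_w.
move: le1; rewrite ge0_integral_linear//; [|exact: mG|by lra].
rewrite mul0e adde0 K_YE !ge0_integral_linear//.
rewrite int_M int_MH int_good1 fin_good !mul1e -EFinM => le1.
rewrite -lee_fin; apply: (le_trans le1).
rewrite !EFinD -!EFinM leeD2l// leeD2l// leeD2r// EFinM.
by apply: lee_wpmul2l; rewrite ?lee_fin.
Qed.

Lemma hgap_moment_le : (5 * C ^+ 2 + 2 * C) * (lam + a) <= 2^-1 -> a <= 2^-1 ->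
  (\int[P']_w (hgap m (g w) `^ p)%:E <= (2 * (5 * C ^+ 2 + 2 * C) * (lam + a))%:E)%E.
Proof.
move=> small a2; have a0 := a_ge0; have [l0 l2] := andP lam01.
rewrite [X in (X <= _)%E]K_GE lee_fin.
move: near_ineq chain_ineq shift_ineq K_G_ge0 K_F_ge0 good_ge good_le C0.
have : 0 <= K_Y by apply: fine_ge0; apply: integral_ge0 => w _; rewrite lee_fin.
move: a0 small a2 l0 l2; set x := K_G; set i := K_F; set y := K_Y; set q := fine (P good).
clearbody x i y q.
move=> a0 small a2 l0 l2 y0 A1 A2 A3 x0 i0 q1 q2 Cp.
set e := lam + a in small *.
have e0 : 0 < e by rewrite /e; lra.
have Ce : 0 <= C * e by rewrite mulr_ge0// ltW.
have xq : x * q <= x by rewrite ler_piMr.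
have iq0 : i * 2^-1 <= i * q by rewrite ler_wpM2l//; lra.
have yx : y <= x by lra.
have cl : C * lam * y <= C * lam * x by rewrite ler_wpM2l// mulr_ge0// ltW.
have clq : C * lam * q <= C * lam by rewrite ler_piMr// mulr_ge0// ltW.
(* With unit C e (1 + x), the near inequality bounds x - y by 1 and, as [q >= 2^-1], the shift
   inequality bounds i by 2. The chain inequality then bounds y by C/2 + 4C + 1. Adding the bound on
   x - y gives (9/2) C^2 + 2C times e (1 + x), rounded up to the stated constant; smallness of e
   absorbs half of x. *)
have D1 : x - y <= C * e * (1 + x) by rewrite /e; lra.
have D2 : i <= 2 * (C * e * (1 + x)) by lra.
have iq : C * (i * q) <= C * i by rewrite ler_pM2l// ler_piMr.
have D2' : C * i <= C * (2 * (C * e * (1 + x))) by rewrite ler_pM2l.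
have D1' : C / 2 * (x * q - y) <= C / 2 * (C * e * (1 + x)).
  by rewrite ler_pM2l ?divr_gt0//; lra.
have D3 : C * lam <= C * e * (1 + x).
  apply: (@le_trans _ _ (C * e)); first by rewrite ler_pM2l// /e; lra.
  by rewrite ler_peMr//; lra.
have D4 : y <= (C / 2 + 4 * C) * (C * e * (1 + x)) + C * e * (1 + x) by lra.
have D5 : 0 <= C * (C * e * (1 + x)) by rewrite !mulr_ge0//; lra.
have D6 : x <= (5 * C ^+ 2 + 2 * C) * e * (1 + x) by lra.
have D7 : (5 * C ^+ 2 + 2 * C) * e * x <= 2^-1 * x by rewrite ler_wpM2r.
lra.
Qed.

End recursive_equation.

(** * From the gap moment to the two bounds *)

Section conclusion.
Context {R : realType}.
Local Notation Re := complex.Re.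
Local Notation Im := complex.Im.
Local Notation normc := Normc.normc.

Lemma recursion_constants (p t : R) : 2 <= p -> 0 < t <= 1 ->
  exists C lam0, [/\ 0 < C, 0 < lam0 & forall (m z : R[i]) lam, fixed_at t m z ->
    0 < lam <= 2^-1 -> lam <= lam0 ->
  [/\ forall k h y, 0 < Im h -> 0 <= Im y -> `|k - 1| <= lam -> normc y <= lam ->
        hgap m (rmap z (k%:C * h + y)) `^ p
          <= (1 + C * lam) * hgap m h `^ p + C * lam,
      forall k h y, 0 < k -> 0 < Im h -> 0 <= Im y ->
        hgap m (rmap z (k%:C * h + y)) `^ p
          <= C * weight k y `^ p * (1 + hgap m h `^ p) &
      forall k h y x x', 0 < Im h -> 0 <= Im y -> `|k - 1| <= lam ->
        normc y <= lam -> 0 < Im x -> 0 < Im x' ->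
        hgap m h `^ p <= C * (hconv_gap p m h x' + hconv_gap p m x' x +
          hconv_gap p m x (rmap z (k%:C * h + y))) + C * lam]].
Proof.
move=> p2 t01; have p1 : 1 <= p by lra.
have [t0 _] := andP t01.
have [C1 C10 near] := powR_hgap_rmap_near p1 t0.
have [C2 C20 heavy] := powR_hgap_rmap_weight p1 t0.
have [C3 [lam0 [C30 lam00 chain]]] := powR_hgap_chain p2 t01.
exists (C1 + C2 + C3), lam0; split => //; first by lra.
move=> m z lam fx lam2 laml; have [l0 _] := andP lam2.
have mono c X : c <= C1 + C2 + C3 -> 0 <= X -> c * X <= (C1 + C2 + C3) * X.
  by move=> cC X0; rewrite ler_wpM2r.
have z0 : 0 < Im z by case: fx.
split=> [k h y h0 y0 k1 yl|k h y k0 h0 y0|k h y x x' h0 y0 k1 yl x0 x'0].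
- apply: (le_trans (near m z lam k h y fx lam2 h0 y0 k1 yl)).
  have c1 : C1 * lam <= (C1 + C2 + C3) * lam by apply: mono; lra.
  by apply: lerD => //; rewrite ler_wpM2r ?powR_ge0// lerD2l.
- apply: (le_trans (heavy m z k h y fx k0 h0 y0)); rewrite -!mulrA; apply: mono.
    by lra.
  by apply: mulr_ge0; [exact: powR_ge0|apply: addr_ge0 => //; exact: powR_ge0].
- have l0' : 0 < lam <= lam0 by rewrite l0.
  apply: (le_trans (chain m z lam k h y x x' fx l0' h0 y0 k1 yl x0 x'0)).
  have k0 : 0 <= k by move: k1; rewrite distrC ler_distlC => /andP[? ?]; lra.
  have g0 := Im_rmap_gt0 z0 (Im_scale_ge0 k0 h0 y0).
  apply: lerD; apply: mono; [lra| |lra|exact: ltW].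
  by apply: addr_ge0; [apply: addr_ge0|]; exact: hconv_gap_ge0.
Qed.

(** With n = |g - m| and G the gap, n^2 = G Im g <= G (1 + n), whence n <= G + sqrt G. Young's
    inequality with parameter [s] trades the resulting G^(p/2) for [s / 2] and G^p / (2s), so only
    the p-th moment of the gap is needed. *)
Lemma normc_powR_le_hgap (p s : R) (m g : R[i]) : 2 <= p -> 0 < s ->
  normc m <= 1 -> 0 < Im g ->
  normc (g - m) `^ p <=
    2 `^ p * (s / 2) + 2 `^ p * (1 + (2 * s)^-1) * hgap m g `^ p.
Proof.
move=> p2 s0 m1 g0; have G0 := hgap_ge0 m g0; set G := hgap m g in G0 *.
have n0 := normc_ge0 (g - m).
set r := Num.sqrt G; have r0 : 0 <= r by exact: sqrtr_ge0.
have rr : r ^+ 2 = G by rewrite sqr_sqrtr.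
have ng : normc (g - m) <= G + r.
  have e : normc (g - m) ^+ 2 = G * Im g by rewrite /G /hgap mulfVK// gt_eqF.
  have Ig : Im g <= 1 + normc (g - m).
    have := normc_Im (g - m); rewrite ImD ImN ler_norml => /andP[_ ?].
    have : Im m <= 1 by apply: le_trans m1; exact: Im_le_normc.
    lra.
  have e2 : normc (g - m) ^+ 2 <= G * (1 + normc (g - m)) by rewrite e ler_wpM2l.
  set n := normc (g - m) in n0 e2 *.
  rewrite leNgt; apply/negP => lt.
  have : r * r <= (n - G) * n by apply: ler_pM => //; lra.
  have q : n * (G + r) < n * n by rewrite ltr_pM2l//; lra.
  by rewrite -expr2 rr; nra.
have pp : 0 <= p by lra.
apply: (le_trans (ler_powRl pp n0 ng)).
apply: (le_trans (powR_addl pp G0 r0)).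
have -> : r `^ p = G `^ (p / 2) by rewrite /r -powR12_sqrt// -powRrM mulrC.
have sq : G `^ p = (G `^ (p / 2)) ^+ 2.
  by rewrite -powR_mulrn ?powR_ge0// -powRrM mulfVK.
set u := G `^ (p / 2) in sq *; rewrite sq.
have amgm : u <= s / 2 + (2 * s)^-1 * u ^+ 2.
  rewrite -subr_ge0 (_ : _ - _ = (2 * s)^-1 * (s - u) ^+ 2).
    by rewrite mulr_ge0 ?sqr_ge0// invr_ge0; lra.
  by field; rewrite gt_eqF.
rewrite -mulrA -mulrDr; apply: ler_wpM2l; first exact: powR_ge0.
lra.
Qed.

Lemma Im_powRN_le_hgap (p t : R) (m g : R[i]) : 1 <= p -> 0 < t -> t <= Im m ->
  normc m <= 1 -> 0 < Im g ->
  Im g `^ (- p) <= (8 / t ^+ 2) `^ p + (8 / t ^+ 2) `^ p * hgap m g `^ p.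
Proof.
move=> p1 t0 tm m1 g0; have m0 : 0 < Im m by exact: lt_le_trans tm.
have pp : 0 <= p by lra.
have G0 := hgap_ge0 m g0.
have -> : Im g `^ (- p) = (Im g)^-1 `^ p.
  by rewrite -powR_inv1 ?ltW// -powRrM mulN1r.
have K0 : 0 <= 4 / t ^+ 2 by rewrite divr_ge0// sqr_ge0.
have i0 : 0 <= (Im g)^-1 by rewrite invr_ge0 ltW.
apply: (le_trans (ler_powRl pp i0 (inv_Im_le_hgap m0 m1 t0 tm g0))).
rewrite powRM//; last by rewrite addr_ge0.
have -> : 8 / t ^+ 2 = 4 / t ^+ 2 * 2 by ring.
rewrite [in leRHS]powRM// -[X in _ <= X + _]mulr1 -mulrDr -mulrA.
apply: ler_wpM2l; first exact: powR_ge0.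
by have := powR_addl pp ler01 G0; rewrite powR1.
Qed.

End conclusion.

Theorem theorem4 (R : realType) (E p : R) (hE : 0 < E < 2) (hp : 2 <= p) :
  exists delta C : R, [/\ 0 < delta, 0 < C &
    forall (d0 : measure_display) (T : measurableType d0)
      (P : probability T R) (N : {RV P >-> nat}) (v : {RV P >-> R[i]})
      (d lam : R),
      (forall w, 0 <= complex.Im (v w)) ->
      ('E_P[fun w => (N w)%:R%R] = d%:E)%E ->
      P [set w | (1 <= N w)%N] = 1%E ->
      {ae P, forall w, complex.Im (v w) = 0} \/
        ('E_P[fun w => ((N w)%:R `^ (2 * p))%R] < +oo)%E ->
      0 < lam < 1 ->
      (lam%:E + alpha N v d p lam <= delta%:E)%E ->
      forall (z : R[i]) (d1 : measure_display) (T' : measurableType d1)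
        (P' : probability T' R) (g : {RV P' >-> R[i]}),
        upper_half_strip E z ->
        (forall w, 0 < complex.Im (g w)) ->
        solves_rde N v d z g ->
        ('E_P'[fun w => (Normc.normc (g w - Gamma z) `^ p)%R]
           <= C%:E * sqrte (lam%:E + alpha N v d p lam))%E /\
        ('E_P'[fun w => (complex.Im (g w) `^ (- p))%R] <= C%:E)%E].
Proof.
have [E0 E2] := andP hE; have pp : 0 <= p by lra.
have p1 : 1 <= p by lra.
pose t := (1 - E ^+ 2 / 4) / 6.
have t01 : 0 < t <= 1 by rewrite /t; apply/andP; split; nra.
have [t0 _] := andP t01.
have [C [lam0 [C0 lam00 hC]]] := recursion_constants hp t01.
pose K := 5 * C ^+ 2 + 2 * C.
have K0 : 0 < K by rewrite /K; nra.
(* The three entries make [lam] and [a] at most 1/2, validate the chain estimate, and ensure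
   [K * e <= 2^-1] for the absorption. *)
pose delta := Num.min 2^-1 (Num.min lam0 (2 * K)^-1).
pose K1 := 2 `^ p * (2 * (2 * K) + 1).
pose K2 := (8 / t ^+ 2) `^ p * 2.
have K10 : 0 <= K1 by rewrite /K1 mulr_ge0 ?powR_ge0//; lra.
have K20 : 0 < K2.
  rewrite /K2 mulr_gt0//; apply: powR_gt0; rewrite divr_gt0// exprn_gt0//.
exists delta, (K1 + K2); split.
- by rewrite !lt_min lam00 !invr_gt0 mulr_gt0// andbT /=; lra.
- by rewrite ltr_wpDl.
move=> d0 T P N v d lam v0 dE N1 _ /andP[l0 l1] small z d1 T' P' g hz g0 [gs [glaw gind gsol]].
have fx : fixed_at t (Gamma z) z by exact: Gamma_fixed_at.
have [tm m1 z0 mz] := fx.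
have alpha0 : (0 <= alpha N v d p lam)%E.
  by apply: expectation_ge0 => w; rewrite mulr_ge0 ?powR_ge0// mulr_ge0 ?powR_ge0.
have [a aE] : exists a, alpha N v d p lam = a%:E.
  case: (alpha _ _ _ _ _) alpha0 small => [a| |]//; first by exists a.
move: small; rewrite aE -EFinD lee_fin => small.
have a0 : 0 <= a by rewrite -lee_fin -aE.
move: small; rewrite !le_min => /and3P[s1 s2 s3].
set e := lam + a in s1 s2 s3 *.
have e0 : 0 < e by rewrite /e; lra.
have lam2 : 0 < lam <= 2^-1 by rewrite l0 /=; rewrite /e in s1; lra.
have laml : lam <= lam0 by rewrite /e in s2; lra.
have [near heavy chain] := hC _ _ _ fx lam2 laml.
have Ke : K * e <= 2^-1.
  have : 2 * K * e <= 1 by rewrite mulrC -ler_pdivlMr ?div1r// mulr_gt0.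
  lra.
have a2 : a <= 2^-1 by rewrite /e in s1; lra.
have moment : (\int[P']_w (hgap (Gamma z) (g w) `^ p)%:E <= (2 * K * e)%:E)%E.
  exact: (hgap_moment_le hp t01 fx v0 dE N1 lam2 aE g0 glaw gind gsol C0 near heavy chain).
clear hC near heavy chain gsol gind glaw fx lam2 laml s2 s3 hz dE N1 aE alpha0 v0 mz.
have mg : measurable_fun setT g by exact: measurable_funP.
have mG : measurable_fun setT (fun w => hgap (Gamma z) (g w) `^ p).
  by apply: measurable_fun_powRc; exact: measurable_fun_hgap.
have G0 w : 0 <= hgap (Gamma z) (g w) `^ p by exact: powR_ge0.
have int_le b c (f : T' -> R) : 0 <= b -> 0 <= c -> measurable_fun setT f ->
    (forall w, 0 <= f w) ->
    (forall w, f w <= b + c * hgap (Gamma z) (g w) `^ p) ->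
    ('E_P'[f] <= (b + c * (2 * K * e))%:E)%E.
  move=> b0 c0 mf f0 fle; rewrite unlock.
  apply: (@le_trans _ _ (\int[P']_w (b * cst 1 w + c * hgap (Gamma z) (g w) `^ p)%:E)%E).
    apply: ge0_le_integral => //.
    - by move=> w _; rewrite lee_fin.
    - exact/measurable_EFinP.
    - by apply/measurable_EFinP; apply: measurable_funD; apply: measurable_funM.
    - by move=> w _; rewrite lee_fin mulr1.
  rewrite ge0_integral_linear// (eq_integral (cst 1%E))// integral_cst//=.
  rewrite probability_setT !mule1 EFinD leeD2l// EFinM.
  by apply: lee_wpmul2l; rewrite ?lee_fin.
split.
  (* This choice balances the two error terms of Young's inequality, [s / 2] and
     [2 * K * e / (2 * s)], which then are both of order sqrt e. *)
  set s := Num.sqrt e.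
  have ss : s ^+ 2 = e by rewrite sqr_sqrtr// ltW.
  have s0 : 0 < s by rewrite sqrtr_gt0.
  have sle : s <= 1 by rewrite -sqrtr1 ler_wsqrtr//; lra.
  have h := int_le (2 `^ p * (s / 2)) (2 `^ p * (1 + (2 * s)^-1))
    (fun w => Normc.normc (g w - Gamma z) `^ p).
  apply: le_trans (h _ _ _ _ _) _.
  - by rewrite mulr_ge0 ?powR_ge0//; lra.
  - by rewrite mulr_ge0 ?powR_ge0// addr_ge0// invr_ge0; lra.
  - apply: measurable_fun_powRc; apply: measurable_fun_normc.
    exact: measurable_fun_caddc.
  - by move=> w; exact: powR_ge0.
  - by move=> w; exact: normc_powR_le_hgap.
  rewrite /= -/s -EFinM lee_fin.
  apply: (@le_trans _ _ (K1 * s)); last by rewrite ler_wpM2r//; lra.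
  have -> : 2 `^ p * (s / 2) + 2 `^ p * (1 + (2 * s)^-1) * (2 * K * e) =
      2 `^ p * (s / 2 + 2 * K * s ^+ 2 + K * s).
    by rewrite -ss; field; rewrite gt_eqF.
  rewrite /K1 -[X in _ <= X]mulrA; apply: ler_wpM2l; first exact: powR_ge0.
  have : K * s ^+ 2 <= K * s by rewrite ler_pM2l//; nra.
  have : 0 < K * s by rewrite mulr_gt0.
  lra.
have h := int_le ((8 / t ^+ 2) `^ p) ((8 / t ^+ 2) `^ p)
  (fun w => complex.Im (g w) `^ (- p)).
apply: le_trans (h _ _ _ _ _) _.
- exact: powR_ge0.
- exact: powR_ge0.
- by apply: measurable_fun_powRc; exact: measurable_fun_Im.
- by move=> w; exact: powR_ge0.
- by move=> w; exact: Im_powRN_le_hgap.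
rewrite lee_fin; apply: (@le_trans _ _ K2); last by lra.
have q : (8 / t ^+ 2) `^ p * (2 * K * e) <= (8 / t ^+ 2) `^ p * 1.
  by apply: ler_wpM2l; [exact: powR_ge0|lra].
rewrite /K2; lra.
Qed.
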